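(* For every $n\geq 3$, the groups $\operatorname{SL}_n(\mathbb Z)$, $\operatorname{PSL}_n(\mathbb Z)$ and $\operatorname{PGL}_n(\mathbb Z)$ have the cyclic escape property. Consequently, every totally ergodic probability-measure-preserving action of any of these groups is directionally expansive.
   Context: All unitary representations are on complex Hilbert spaces. For a unitary representation $(V,\pi)$ of a countable group $G$ and a subgroup $H\leq G$, write $V^H=\{v\in V:\pi(h)v=v\text{ for every }h\in H\}$ and let $P_H$ be the orthogonal projection onto $V^H$. The representation $(V,\pi)$ is totally ergodic if $V^H=\{0\}$ for every finite-index subgroup $H\leq G$. An infinite countable group $G$ has the cyclic escape property if, for every totally ergodic unitary representation $(V,\pi)$ of $G$ and every $v\in V$, $\inf_C\|P_Cv\|=0$, where the infimum is over all infinite cyclic subgroups $C\leq G$. A probability-measure-preserving action $G\curvearrowright(X,\mu)$ of a countable discrete group is totally ergodic if its restriction to every finite-index subgroup of $G$ is ergodic. It is directionally expansive if, for every measurable set $B\subset X$ with $\mu(B)>0$ and every $\varepsilon>0$, there exists a cyclic subgroup $C\leq G$ (finite or infinite) such that $\mu(CB)>1-\varepsilon$, where $CB=\bigcup_{c\in C}cB$. *)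

(* Defs.v *)
From HB Require Import structures.
From mathcomp Require Import all_boot all_order all_algebra.
From mathcomp Require Import complex.
From mathcomp Require Import all_classical all_reals all_analysis.
Import numFieldNormedType.Exports.
Import Order.TTheory GRing.Theory Num.Theory.

Set Implicit Arguments.
Unset Strict Implicit.
Unset Printing Implicit Defensive.

Local Open Scope classical_set_scope.
Local Open Scope ring_scope.

Section MatrixGroups.
Variables (R : comUnitRingType) (n : nat).

Record GL := MkGL { GL_val :> 'M[R]_n; GL_valP : GL_val \in unitmx }.
HB.instance Definition _ := [isSub for GL_val].
HB.instance Definition _ := [Choice of GL by <:].

Definition GL_one : GL := MkGL (unitmx1 R n).

Fact GL_mul_subproof (A B : GL) : val A *m val B \in unitmx.
Proof. by rewrite unitmx_mul (valP A) (valP B). Qed.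
Definition GL_mul (A B : GL) : GL := MkGL (GL_mul_subproof A B).

Fact GL_inv_subproof (A : GL) : invmx (val A) \in unitmx.
Proof. by rewrite unitmx_inv (valP A). Qed.
Definition GL_inv (A : GL) : GL := MkGL (GL_inv_subproof A).

Fact GL_mulA : associative GL_mul.
Proof. by move=> A B C; apply: val_inj; rewrite /= mulmxA. Qed.
Fact GL_mul1 : left_id GL_one GL_mul.
Proof. by move=> A; apply: val_inj; rewrite /= mul1mx. Qed.
Fact GL_mulr1 : right_id GL_one GL_mul.
Proof. by move=> A; apply: val_inj; rewrite /= mulmx1. Qed.
Fact GL_mulV : left_inverse GL_one GL_inv GL_mul.
Proof. by move=> A; apply: val_inj; rewrite /= mulVmx ?(valP A). Qed.
Fact GL_mulrV : right_inverse GL_one GL_inv GL_mul.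
Proof. by move=> A; apply: val_inj; rewrite /= mulmxV ?(valP A). Qed.
HB.instance Definition _ :=
  isGroup.Build GL GL_mulA GL_mul1 GL_mulr1 GL_mulV GL_mulrV.

Record SL := MkSL { SL_val :> 'M[R]_n; SL_valP : \det SL_val == 1 }.
HB.instance Definition _ := [isSub for SL_val].
HB.instance Definition _ := [Choice of SL by <:].

Fact SL_unitmx (A : SL) : val A \in unitmx.
Proof. by rewrite unitmxE (eqP (valP A)) unitr1. Qed.

Fact SL_one_subproof : \det (1%:M : 'M[R]_n) == 1.
Proof. by rewrite det1. Qed.
Definition SL_one : SL := MkSL SL_one_subproof.

Fact SL_mul_subproof (A B : SL) : \det (val A *m val B) == 1.
Proof. by rewrite det_mulmx (eqP (valP A)) (eqP (valP B)) mulr1. Qed.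
Definition SL_mul (A B : SL) : SL := MkSL (SL_mul_subproof A B).

Fact SL_inv_subproof (A : SL) : \det (invmx (val A)) == 1.
Proof. by rewrite det_inv (eqP (valP A)) invr1. Qed.
Definition SL_inv (A : SL) : SL := MkSL (SL_inv_subproof A).

Fact SL_mulA : associative SL_mul.
Proof. by move=> A B C; apply: val_inj; rewrite /= mulmxA. Qed.
Fact SL_mul1 : left_id SL_one SL_mul.
Proof. by move=> A; apply: val_inj; rewrite /= mul1mx. Qed.
Fact SL_mulr1 : right_id SL_one SL_mul.
Proof. by move=> A; apply: val_inj; rewrite /= mulmx1. Qed.
Fact SL_mulV : left_inverse SL_one SL_inv SL_mul.
Proof. by move=> A; apply: val_inj; rewrite /= mulVmx ?SL_unitmx. Qed.
Fact SL_mulrV : right_inverse SL_one SL_inv SL_mul.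
Proof. by move=> A; apply: val_inj; rewrite /= mulmxV ?SL_unitmx. Qed.
HB.instance Definition _ :=
  isGroup.Build SL SL_mulA SL_mul1 SL_mulr1 SL_mulV SL_mulrV.

End MatrixGroups.

HB.mixin Record isConjClosed (G : groupType) (N : {pred G}) := {
  conjg_closed : forall x y : G, x \in N -> (x ^ y)%g \in N
}.

#[short(type="normalSubgroup")]
HB.structure Definition NormalSubgroup (G : groupType) :=
  {N of GroupClosed G N & isConjClosed G N}.

Section QuotientGroup.
Local Open Scope group_scope.
Local Open Scope quotient_scope.
Variables (G : groupType) (N : normalSubgroup G).
Implicit Types x y z : G.

Definition coset_eq x y := x^-1 * y \in (N : {pred G}).

Fact coset_eq_refl : reflexive coset_eq.
Proof. by move=> x; rewrite /coset_eq mulVg gpred1. Qed.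
Fact coset_eq_sym : symmetric coset_eq.
Proof. by move=> x y; rewrite /coset_eq -(gpredV N) invgM invgK. Qed.
Fact coset_eq_trans : transitive coset_eq.
Proof.
move=> y x z xy yz; rewrite /coset_eq.
have -> : x^-1 * z = (x^-1 * y) * (y^-1 * z) by rewrite mulgA mulgK.
exact: gpredM.
Qed.
Canonical coset_eq_equiv :=
  EquivRel coset_eq coset_eq_refl coset_eq_sym coset_eq_trans.

Definition quotient_group := {eq_quot coset_eq}.
HB.instance Definition _ := Choice.on quotient_group.
HB.instance Definition _ := EqQuotient.on quotient_group.

Definition quot_one : quotient_group := \pi_quotient_group 1.
Definition quot_mul (a b : quotient_group) : quotient_group :=
  \pi_quotient_group (repr a * repr b).
Definition quot_inv (a : quotient_group) : quotient_group :=
  \pi_quotient_group (repr a)^-1.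

Fact eq_quotP x y :
  reflect (\pi_quotient_group x = \pi_quotient_group y) (coset_eq x y).
Proof. exact: eqmodP. Qed.

Fact coset_eq_repr x : coset_eq (repr (\pi_quotient_group x)) x.
Proof. by apply/eq_quotP; rewrite reprK. Qed.

Fact pi_quotM x y :
  quot_mul (\pi_quotient_group x) (\pi_quotient_group y)
  = \pi_quotient_group (x * y).
Proof.
apply/eq_quotP; rewrite /coset_eq invgM.
set y' := repr _; set x' := repr _.
have -> : y'^-1 * x'^-1 * (x * y) = (x'^-1 * x) ^ y' * (y'^-1 * y).
  by rewrite /conjg !mulgA mulgK.
by apply: gpredM; [apply: conjg_closed|]; exact: coset_eq_repr.
Qed.

Fact pi_quotV x :
  quot_inv (\pi_quotient_group x) = \pi_quotient_group x^-1.
Proof.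
apply/eq_quotP; rewrite /coset_eq invgK; set x' := repr _.
have -> : x' * x^-1 = (x^-1 * x') ^ x^-1.
  by rewrite /conjg invgK !mulgA mulgV mul1g.
apply: conjg_closed; rewrite -/(coset_eq x x') coset_eq_sym.
exact: coset_eq_repr.
Qed.

Fact quot_mulA : associative quot_mul.
Proof.
move=> a b c; rewrite -(reprK a) -(reprK b) -(reprK c).
rewrite (pi_quotM (repr b)) (pi_quotM (repr a) (repr b)) !pi_quotM.
by rewrite mulgA.
Qed.
Fact quot_mul1 : left_id quot_one quot_mul.
Proof. by move=> a; rewrite -(reprK a) pi_quotM mul1g. Qed.
Fact quot_mulr1 : right_id quot_one quot_mul.
Proof. by move=> a; rewrite -(reprK a) pi_quotM mulg1. Qed.
Fact quot_mulV : left_inverse quot_one quot_inv quot_mul.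
Proof. by move=> a; rewrite -(reprK a) pi_quotV pi_quotM mulVg. Qed.
Fact quot_mulrV : right_inverse quot_one quot_inv quot_mul.
Proof. by move=> a; rewrite -(reprK a) pi_quotV pi_quotM mulgV. Qed.
HB.instance Definition _ := isGroup.Build quotient_group
  quot_mulA quot_mul1 quot_mulr1 quot_mulV quot_mulrV.

End QuotientGroup.

Section ProjectiveGroups.
Variables (R : comUnitRingType) (n : nat).

Fact is_scalar_mx_mul (A B : 'M[R]_n) :
  is_scalar_mx A -> is_scalar_mx B -> is_scalar_mx (A *m B).
Proof.
move=> /is_scalar_mxP[a ->] /is_scalar_mxP[b ->]; rewrite -scalar_mxM.
exact: scalar_mx_is_scalar.
Qed.

Fact is_scalar_mx_inv (A : 'M[R]_n) : is_scalar_mx A -> is_scalar_mx (invmx A).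
Proof.
by move=> /is_scalar_mxP[a ->]; rewrite invmx_scalar scalar_mx_is_scalar.
Qed.

Fact is_scalar_mx_conj (A B : 'M[R]_n) : B \in unitmx ->
  is_scalar_mx A -> is_scalar_mx (invmx B *m (A *m B)).
Proof.
move=> Bu /is_scalar_mxP[a ->]; rewrite -scalar_mxC mulmxA mulVmx// mul1mx.
exact: scalar_mx_is_scalar.
Qed.

(* The projective groups are the quotients by all scalar matrices in the group;
   over [int] these are [1] and, when it belongs to the group, [-1]. *)
Definition GL_scalar : {pred GL R n} := fun A => is_scalar_mx (val A).

Fact GL_scalarM : {in GL_scalar &, forall A B, (A * B)%g \in GL_scalar}.
Proof. by move=> A B; exact: is_scalar_mx_mul. Qed.
Fact GL_scalar1 : 1%g \in GL_scalar.
Proof. exact: scalar_mx_is_scalar. Qed.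
Fact GL_scalarV : {in GL_scalar, forall A, (A^-1)%g \in GL_scalar}.
Proof. by move=> A; exact: is_scalar_mx_inv. Qed.
Fact GL_scalarJ (A B : GL R n) : A \in GL_scalar -> (A ^ B)%g \in GL_scalar.
Proof. by apply: is_scalar_mx_conj; exact: valP. Qed.
HB.instance Definition _ := isMulClosed.Build _ GL_scalar GL_scalarM.
HB.instance Definition _ := isMul1Closed.Build _ GL_scalar GL_scalar1.
HB.instance Definition _ := isInvClosed.Build _ GL_scalar GL_scalarV.
HB.instance Definition _ := isConjClosed.Build _ GL_scalar GL_scalarJ.

Definition PGL : groupType := quotient_group GL_scalar.

Definition SL_scalar : {pred SL R n} := fun A => is_scalar_mx (val A).

Fact SL_scalarM : {in SL_scalar &, forall A B, (A * B)%g \in SL_scalar}.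
Proof. by move=> A B; exact: is_scalar_mx_mul. Qed.
Fact SL_scalar1 : 1%g \in SL_scalar.
Proof. exact: scalar_mx_is_scalar. Qed.
Fact SL_scalarV : {in SL_scalar, forall A, (A^-1)%g \in SL_scalar}.
Proof. by move=> A; exact: is_scalar_mx_inv. Qed.
Fact SL_scalarJ (A B : SL R n) : A \in SL_scalar -> (A ^ B)%g \in SL_scalar.
Proof. by apply: is_scalar_mx_conj; exact: SL_unitmx. Qed.
HB.instance Definition _ := isMulClosed.Build _ SL_scalar SL_scalarM.
HB.instance Definition _ := isMul1Closed.Build _ SL_scalar SL_scalar1.
HB.instance Definition _ := isInvClosed.Build _ SL_scalar SL_scalarV.
HB.instance Definition _ := isConjClosed.Build _ SL_scalar SL_scalarJ.

Definition PSL : groupType := quotient_group SL_scalar.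

End ProjectiveGroups.

Section Subgroups.
Variable G : groupType.
Implicit Types H C : set G.
Local Open Scope group_scope.

Definition is_subgroup H :=
  [/\ H 1, forall x y, H x -> H y -> H (x * y) & forall x, H x -> H x^-1].

Definition finite_index H :=
  finite_set [set [set x * h | h in H] | x in [set: G]].

Definition cyclic_subgroup (g : G) : set G :=
  [set x | exists k : nat, x = g ^+ k \/ x = g ^- k].

Definition is_cyclic C := exists g : G, C = cyclic_subgroup g.

End Subgroups.

HB.mixin Record CompleteNormedModule_isHilbert (R : realType) V
    of CompleteNormedModule R[i] V := {
  hdot : {dot V for @Num.conj R[i]};
  hdot_norm : forall v : V, `|v| ^+ 2 = hdot v v
}.

#[short(type="hilbertType")]
HB.structure Definition Hilbert (R : realType) :=
  {V of CompleteNormedModule_isHilbert R V & CompleteNormedModule R[i] V}.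

Section HilbertSpaces.
Variables (R : realType) (V : hilbertType R).
Implicit Types (v w : V) (W : set V).

(* The norm of a normed module over [R[i]] takes its (real) values in [R[i]]. *)
Definition hnorm v : R := complex.Re `|v|.

(* By the projection theorem there is exactly one such [w] when [W] is a closed
   subspace, so the default value [0] is irrelevant then. *)
Definition orth_proj W v : V :=
  xget 0 [set w | W w /\ forall u, W u -> hdot (v - w) u = 0].

End HilbertSpaces.

(* Preserving the inner product makes each [pi g] unitary, since [pi g^-1] is a
   two-sided inverse of [pi g]. *)
Record unitary_rep (R : realType) (G : groupType) (V : hilbertType R) := {
  urep :> G -> {linear V -> V};
  urep1 : forall v, urep 1%g v = v;
  urepM : forall g h v, urep (g * h)%g v = urep g (urep h v);
  urep_dot : forall g v w, hdot (urep g v) (urep g w) = hdot v w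
}.

Section Representations.
Variables (R : realType) (G : groupType) (V : hilbertType R).
Variable pi : unitary_rep G V.

Definition fixed_space (H : set G) : set V :=
  [set v | forall h, H h -> pi h v = v].

Definition rep_totally_ergodic :=
  forall H : set G, is_subgroup H -> finite_index H -> fixed_space H = [set 0].

End Representations.

(* The infimum is taken in the extended reals: over an empty family it is +oo,
   whereas the real-valued [inf] would be 0. *)
Definition cyclic_escape_property (R : realType) (G : groupType) :=
  [/\ infinite_set [set: G], countable [set: G] &
    forall (V : hilbertType R) (pi : unitary_rep G V),
      rep_totally_ergodic pi -> forall v : V,
      ereal_inf [set (hnorm (orth_proj (fixed_space pi C) v))%:E
                | C in [set C | is_cyclic C /\ infinite_set C]] = 0%E].

Record pmp_action (R : realType) (G : groupType) (d : measure_display)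
    (X : measurableType d) (mu : probability X R) := {
  act :> G -> X -> X;
  act1 : forall x, act 1%g x = x;
  actM : forall g h x, act (g * h)%g x = act g (act h x);
  act_measurable : forall g, measurable_fun [set: X] (act g);
  act_preserving : forall g (A : set X), measurable A ->
    mu (act g @^-1` A) = mu A
}.

Section Actions.
Variables (R : realType) (G : groupType) (d : measure_display).
Variables (X : measurableType d) (mu : probability X R).
Variable a : pmp_action G mu.

Definition ergodic_on (H : set G) := forall A : set X, measurable A ->
  (forall h, H h -> a h @` A = A) -> mu A = 0%E \/ mu A = 1%E.

Definition act_totally_ergodic :=
  forall H : set G, is_subgroup H -> finite_index H -> ergodic_on H.

Definition directionally_expansive :=
  forall B : set X, measurable B -> (0 < mu B)%E ->
  forall eps : R, 0 < eps ->
  exists2 C : set G, is_cyclic C &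
    ((1 - eps)%:E < mu (\bigcup_(c in C) (a c @` B)))%E.

End Actions.

(* Main.v *)
From HB Require Import structures.
Require Import Defs.
From mathcomp Require Import all_boot all_order all_algebra.
From mathcomp Require Import complex.
From mathcomp Require Import all_classical all_reals all_analysis.
From mathcomp Require Import measurable_realfun zify ring lra.
Import numFieldNormedType.Exports.
Import Order.TTheory GRing.Theory Num.Theory.

(* Let v be a vector of a real orthogonal representation of SL_n(Z) whose projections to
   the fixed spaces of all conjugates of all e_ij(1) are bounded below. The claim is that
   some finite index subgroup has a nonzero fixed vector; applied to the realification of a
   complex representation and to the mean zero part of L^2 it gives the two statements, a
   group between SL_n(Z) and PGL_n(Z) being handled through the map from SL_n(Z).

   Put k = N! with N large, and let W_x be the space of vectors on which <x> acts
   continuously for the k-adic topology. In a Heisenberg triple [x, y] = c the spaces W_x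
   and W_y are almost orthogonal modulo W_c, up to 1/sqrt N. This gives a spectral gap:
   a vector almost in every W_{e_ij(1)} forces the intersection Z of these spaces to be
   nonzero. Such a vector is found by minimising the norm of the projections over the
   orbit of v and over the roots, and by comparing x with x y^m for m < N (Bessel).

   On the invariant space Z the one-parameter groups e_ij extend to the rationals with
   denominators prime to k and satisfy the Steinberg relations. The torus elements
   h_ij(y, z) agree with h_ij(1, yz): this is a computation when 1 + yz is a power of
   1 + z, and holds in general by density. Therefore the group generated by the e_ij(k^a r)
   has a Gauss decomposition and is boundedly generated; for large a it moves a given vector
   of Z little, and the circumcenter of the orbit is a nonzero fixed vector. The space of
   fixed vectors is SL_n(Z)-invariant, and the kernel of SL_n(Z) on it contains all
   e_ij(k^a), so it has finite index. *)

Set Implicit Arguments.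
Unset Strict Implicit.
Unset Printing Implicit Defensive.

Local Open Scope classical_set_scope.
Local Open Scope ring_scope.

(** * Real Hilbert spaces *)

(** Almost invariance is not given; it is produced by extremality. Whenever [y] is another root of
    the same row or column as [x], the element [x y^m] is a conjugate of [x], so at a near minimum
    its projections are bounded below for every m, while Bessel bounds the sum over m of the excess
    over the part common to [x] and [y]. Hence nearly all of the projection is already common. The
    factorial makes k divisible by all differences of exponents below N: the spaces for [x y^m] and
    [x y^p] then meet inside those of [x] and [y]. The spaces W_x are closed, unlike the union of
    the fixed spaces of the x^(k^s), and do not change when x is replaced by x^m with m dividing a
    power of k. Continuity is used a second time to take limits: over the k-adic integers every 1 +
    k^a r is a unit, and such units are what Gauss elimination with small entries requires. For the
    finite index, congruence elements are shown to be central modulo the kernel, after which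
    Dietzmann's lemma counts cosets. Directional expansiveness comes from the same statement on real
    representations, the invariant vector being the centred indicator of CB. *)

Record hilb (R : realType) := Hilb {
  hsort :> lmodType R;
  dot : hsort -> hsort -> R;
  dotC : forall u v, dot u v = dot v u;
  dotDl : forall u v w, dot (u + v) w = dot u w + dot v w;
  dotZl : forall a u v, dot (a *: u) v = a * dot u v;
  dot_ge0 : forall u, 0 <= dot u u;
  dot_eq0 : forall u, dot u u = 0 -> u = 0;
  hilb_complete : forall f : nat -> hsort,
    (forall e, 0 < e -> exists N : nat, forall m p, (N <= m)%N -> (N <= p)%N ->
       dot (f m - f p) (f m - f p) < e) ->
    exists l, forall e, 0 < e -> exists N : nat, forall m, (N <= m)%N ->
       dot (f m - l) (f m - l) < e
}.
Arguments dot {R h}.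

Lemma inv_small (R : realType) (e : R) : 0 < e ->
  exists N : nat, forall m, (N <= m)%N -> (m.+1%:R^-1 : R) < e.
Proof.
move=> e0; exists (Num.truncn e^-1) => m Nm.
rewrite invf_plt ?posrE ?ltr0n//; apply: lt_le_trans (truncnS_gt _) _.
by rewrite ler_nat ltnS.
Qed.

Section InnerProduct.
Variables (R : realType) (H : hilb R).
Implicit Types (u v w z : H) (a : R).

Lemma dotDr u v w : dot u (v + w) = dot u v + dot u w.
Proof. by rewrite dotC dotDl !(dotC u). Qed.
Lemma dotZr a u v : dot u (a *: v) = a * dot u v.
Proof. by rewrite dotC dotZl dotC. Qed.
Lemma dotNl u v : dot (- u) v = - dot u v.
Proof. by rewrite -scaleN1r dotZl mulN1r. Qed.
Lemma dotNr u v : dot u (- v) = - dot u v.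
Proof. by rewrite dotC dotNl dotC. Qed.
Lemma dotBl u v w : dot (u - v) w = dot u w - dot v w.
Proof. by rewrite dotDl dotNl. Qed.
Lemma dotBr u v w : dot u (v - w) = dot u v - dot u w.
Proof. by rewrite dotDr dotNr. Qed.
Lemma dot0l v : dot 0 v = 0.
Proof. by rewrite -(scale0r v) dotZl mul0r. Qed.
Lemma dot0r v : dot v 0 = 0.
Proof. by rewrite dotC dot0l. Qed.
Lemma dot_suml (I : Type) (r : seq I) (P : pred I) (F : I -> H) v :
  dot (\sum_(i <- r | P i) F i) v = \sum_(i <- r | P i) dot (F i) v.
Proof.
elim/big_rec2 : _ => [|i x y _ <-]; first by rewrite dot0l.
by rewrite dotDl.
Qed.
Lemma dot_sumr (I : Type) (r : seq I) (P : pred I) (F : I -> H) v :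
  dot v (\sum_(i <- r | P i) F i) = \sum_(i <- r | P i) dot v (F i).
Proof. by rewrite dotC dot_suml; apply: eq_bigr => i _; rewrite dotC. Qed.

Definition hn v : R := Num.sqrt (dot v v).

Lemma hn_ge0 v : 0 <= hn v. Proof. exact: sqrtr_ge0. Qed.
Lemma hn_sqr v : hn v ^+ 2 = dot v v.
Proof. by rewrite sqr_sqrtr ?dot_ge0. Qed.
Lemma hn0 : hn 0 = 0. Proof. by rewrite /hn dot0l sqrtr0. Qed.
Lemma hn_eq0 v : hn v = 0 -> v = 0.
Proof. by move=> v0; apply: dot_eq0; rewrite -hn_sqr v0 expr0n. Qed.
Lemma hnN v : hn (- v) = hn v.
Proof. by rewrite /hn dotNl dotNr opprK. Qed.
Lemma hnB u v : hn (u - v) = hn (v - u).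
Proof. by rewrite -hnN opprB. Qed.

Lemma CauchySchwarz u v : dot u v ^+ 2 <= dot u u * dot v v.
Proof.
have [v0|v0] := eqVneq (dot v v) 0.
  by rewrite (dot_eq0 v0) !dot0r mulr0 expr0n.
have vp : 0 < dot v v by rewrite lt_def v0 dot_ge0.
have := dot_ge0 (dot v v *: u - dot u v *: v).
rewrite !(dotBl, dotBr, dotZl, dotZr) (dotC v u).
rewrite (_ : _ - _ = dot v v * (dot u u * dot v v - dot u v ^+ 2)); last by ring.
by rewrite pmulr_rge0 // subr_ge0.
Qed.

Lemma ler_dot u v : `|dot u v| <= hn u * hn v.
Proof.
rewrite -(@ler_pXn2r _ 2) ?nnegrE ?mulr_ge0 ?hn_ge0//.
by rewrite real_normK ?num_real// exprMn !hn_sqr CauchySchwarz.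
Qed.

Lemma hnD u v : hn (u + v) <= hn u + hn v.
Proof.
rewrite -(@ler_pXn2r _ 2) ?nnegrE ?addr_ge0 ?hn_ge0//.
rewrite sqrrD !hn_sqr dotDl !dotDr (dotC v u).
by have := le_trans (ler_norm _) (ler_dot u v); lra.
Qed.

Lemma hn_triangle w u v : hn (u - v) <= hn (u - w) + hn (w - v).
Proof. by rewrite (_ : u - v = (u - w) + (w - v)) ?hnD // addrA subrK. Qed.

Lemma hnZ a v : hn (a *: v) = `|a| * hn v.
Proof.
by rewrite /hn dotZl dotZr mulrA -expr2 sqrtrM ?sqr_ge0// sqrtr_sqr.
Qed.

Lemma hn_lt u e : 0 < e -> dot u u < e ^+ 2 -> hn u < e.
Proof.
move=> e0; rewrite -hn_sqr ltr_pXn2r ?nnegrE ?hn_ge0//; exact: ltW.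
Qed.

Lemma lt_hn u e : 0 < e -> hn u < e -> dot u u < e ^+ 2.
Proof. by move=> e0; rewrite -hn_sqr ltr_pXn2r ?nnegrE ?hn_ge0// ltW. Qed.

Lemma parallelogram u v w : dot (2^-1 *: (u + v) - w) (2^-1 *: (u + v) - w) =
  (dot (u - w) (u - w) + dot (v - w) (v - w)) / 2 - dot (u - v) (u - v) / 4.
Proof.
rewrite !(dotBl, dotBr, dotDl, dotDr, dotZl, dotZr).
by rewrite (dotC v u) (dotC w u) (dotC w v); field.
Qed.

Definition hclosed (W : set H) :=
  forall v, (forall e, 0 < e -> exists2 w, W w & hn (v - w) < e) -> W v.

Lemma hlim (f : nat -> H) :
  (forall e, 0 < e -> exists N : nat, forall m p, (N <= m)%N -> (N <= p)%N ->
     hn (f m - f p) < e) ->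
  exists l, forall e, 0 < e -> exists N : nat, forall m, (N <= m)%N ->
     hn (f m - l) < e.
Proof.
move=> fC; have [e e0|l lP] := @hilb_complete _ H f.
  have se0 : 0 < Num.sqrt e by rewrite sqrtr_gt0.
  have [N NP] := fC _ se0; exists N => m p Nm Np.
  by rewrite -(sqr_sqrtr (ltW e0)); apply: lt_hn => //; exact: NP.
exists l => e e0; have [N NP] := lP _ (exprn_gt0 2 e0); exists N => m Nm.
by apply: hn_lt => //; exact: NP.
Qed.

(** By [parallelogram] the midpoint of two approximate centres has a squared radius smaller by a
    quarter of their squared distance, so approximate centres form a Cauchy sequence. The last
    conclusion is a quantitative uniqueness. With [O] a singleton this yields projections, with [O]
    an orbit a fixed vector. *)
Lemma circumcenter (W O : set H) w0 o0 M : hclosed W ->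
  (forall u v, W u -> W v -> W (2^-1 *: (u + v))) ->
  W w0 -> O o0 -> (forall o, O o -> dot (w0 - o) (w0 - o) <= M) ->
  exists rho c, [/\ W c, forall o, O o -> dot (c - o) (c - o) <= rho, rho <= M &
    forall c' r, W c' -> (forall o, O o -> dot (c' - o) (c' - o) <= r) ->
      dot (c - c') (c - c') <= 2 * (r - rho)].
Proof.
move=> Wcl Wmid Ww0 Oo0 w0M.
pose B c r := forall o, O o -> dot (c - o) (c - o) <= r.
pose S := [set r | exists2 c, W c & B c r].
have SM : S M by exists w0.
have Slb : lbound S 0 by move=> r [c _ cr]; exact: le_trans (dot_ge0 _) (cr _ Oo0).
have hS : has_inf S by split; [exists M | exists 0].
set rho := inf S.
have rholb r : S r -> rho <= r by move=> Sr; apply: ge_inf => //; exists 0.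
have key c c' r r' : W c -> W c' -> B c r -> B c' r' ->
    dot (c - c') (c - c') <= 2 * (r + r') - 4 * rho.
  move=> Wc Wc' Br Br'.
  have : S ((r + r') / 2 - dot (c - c') (c - c') / 4).
    exists (2^-1 *: (c + c')); first exact: Wmid.
    move=> o Oo; rewrite parallelogram.
    by have := Br o Oo; have := Br' o Oo; lra.
  by move/rholb; lra.
have ap (m : nat) : exists c, W c /\ B c (rho + m.+1%:R^-1).
  have m0 : 0 < (m.+1%:R^-1 : R) by rewrite invr_gt0 ltr0n.
  have [r [c Wc cr] rlt] := inf_adherent m0 hS.
  by exists c; split => // o Oo; apply: le_trans (cr o Oo) (ltW _); apply: rlt.
have [f fP] := choice ap.
have fd m p e : (forall q, (minn m p <= q)%N -> (q.+1%:R^-1 : R) < e) ->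
    dot (f m - f p) (f m - f p) <= 4 * e.
  move=> small; have [[Wm Bm] [Wp Bp]] := (fP m, fP p).
  have := key _ _ _ _ Wm Wp Bm Bp.
  have := small m (geq_minl _ _); have := small p (geq_minr _ _).
  by move: (m.+1%:R^-1 : R) (p.+1%:R^-1 : R) => x y; lra.
have [|c cP] := hlim (f := f).
  move=> e e0; have [|N NP] := @inv_small R (e ^+ 2 / 8); first by rewrite divr_gt0 ?exprn_gt0.
  exists N => m p Nm Np; apply: hn_lt => //.
  apply: le_lt_trans (fd m p (e ^+ 2 / 8) _) _.
    by move=> q /(leq_trans _) qN; apply: NP; apply: qN; rewrite leq_min Nm.
  by have := exprn_gt0 2 e0; lra.
have Wc : W c.
  apply: Wcl => e e0; have [N NP] := cP e e0.
  by exists (f N); [case: (fP N) | rewrite hnB; exact: NP].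
have Bc : B c rho.
  move=> o Oo; rewrite -hn_sqr; have rho0 : 0 <= rho by apply: lb_le_inf => //; exists M.
  rewrite -(sqr_sqrtr rho0) ler_pXn2r ?nnegrE ?hn_ge0 ?sqrtr_ge0//.
  apply/ler_addgt0Pr => e e0.
  have e20 : 0 < e / 2 by lra.
  have [N NP] := cP _ e20; have [N' NP'] := inv_small (exprn_gt0 2 e20).
  pose m := maxn N N'.
  have h1 : hn (c - f m) < e / 2 by rewrite hnB; apply: NP; exact: leq_maxl.
  have h2 : hn (f m - o) <= Num.sqrt rho + e / 2.
    rewrite -(@ler_pXn2r _ 2) ?nnegrE ?hn_ge0 ?addr_ge0 ?sqrtr_ge0 ?(ltW e20)//.
    rewrite hn_sqr; apply: le_trans ((fP m).2 o Oo) _.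
    rewrite sqrrD sqr_sqrtr// -addrA lerD2l.
    apply: le_trans (ltW (NP' m (leq_maxr _ _))) _.
    by rewrite lerDr mulrn_wge0 ?mulr_ge0 ?sqrtr_ge0// ltW.
  by apply: le_trans (hn_triangle (f m) _ _) _; lra.
exists rho, c; split => //; first exact: rholb.
by move=> c' r Wc' Br; have := key _ _ _ _ Wc Wc' Bc Br; lra.
Qed.

Record subspace (W : set H) : Prop := Subspace {
  sub0 : W 0;
  subD : forall u v, W u -> W v -> W (u + v);
  subZ : forall a u, W u -> W (a *: u);
  sub_closed : hclosed W
}.

Lemma subN W u : subspace W -> W u -> W (- u).
Proof. by move=> sW Wu; rewrite -scaleN1r; exact: subZ. Qed.
Lemma subB W u v : subspace W -> W u -> W v -> W (u - v).
Proof. by move=> sW Wu Wv; apply: subD => //; exact: subN. Qed.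

Definition proj (W : set H) v : H :=
  xget 0 [set w | W w /\ forall u, W u -> dot (v - w) u = 0].

Lemma subspaceI W W' : subspace W -> subspace W' -> subspace (W `&` W').
Proof.
move=> sW sW'; split.
- by split; exact: sub0.
- by move=> u v [Wu W'u] [Wv W'v]; split; exact: subD.
- by move=> a u [Wu W'u]; split; exact: subZ.
- by move=> v cl; split; apply: sub_closed => // e /cl[w [Ww W'w] lt]; exists w.
Qed.

Section Projection.
Variables (W : set H) (sW : subspace W).

(** The circumcenter c of the singleton of [v] within [W] is the nearest point. Compared with c + t
    u, where t = <v - c, u> / <u, u>, the uniqueness estimate gives t^2 <u, u> <= - 2 t^2 <u, u>, so
    t = 0. *)
Lemma projP v : W (proj W v) /\ forall u, W u -> dot (v - proj W v) u = 0.
Proof.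
rewrite /proj; case: xgetP => [w _ []//|no]; exfalso.
have mid u w : W u -> W w -> W (2^-1 *: (u + w)).
  by move=> Wu Ww; apply: subZ => //; exact: subD.
have c0 o : [set v] o -> dot (0 - o) (0 - o) <= dot (0 - v) (0 - v) by move=> ->.
have [rho [c [Wc Bc _ cmin]]] := circumcenter (sub_closed sW) mid (sub0 sW)
  (erefl v : [set v] v) c0.
apply: (no c); split => // u Wu.
have [u0|u0] := eqVneq (dot u u) 0; first by rewrite (dot_eq0 u0) dot0r.
have up : 0 < dot u u by rewrite lt_def u0 dot_ge0.
have [t vu] : exists t, dot (v - c) u = t * dot u u.
  by exists (dot (v - c) u / dot u u); rewrite divfK.
have Wt : W (c + t *: u) by apply: subD => //; exact: subZ.
have ct o : [set v] o -> dot (c + t *: u - o) (c + t *: u - o) <=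
    dot (c + t *: u - v) (c + t *: u - v) by move=> ->.
have := cmin _ _ Wt ct.
have : dot (c - v) (c - v) <= rho by exact: Bc.
rewrite (_ : c - (c + t *: u) = - (t *: u)); last by rewrite opprD addNKr.
rewrite (_ : c + t *: u - v = (c - v) + t *: u); last by rewrite addrAC.
rewrite vu; move: vu; rewrite -(opprB c v); move: (c - v) => d du.
rewrite !(dotDl, dotDr, dotNl, dotNr, dotZl, dotZr) (dotC u d).
have : 0 <= t * (t * dot u u) by rewrite mulrA -expr2 mulr_ge0 ?sqr_ge0 ?dot_ge0.
have du' : dot d u = - (t * dot u u) by rewrite -du dotNl opprK.
rewrite du' => t0 h1 h2; have : t * (t * dot u u) = 0 by lra.
by move/eqP; rewrite !mulf_eq0 (negPf u0) !orbF orbb => /eqP ->; rewrite mul0r.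
Qed.

Lemma proj_in v : W (proj W v). Proof. by case: (projP v). Qed.
Lemma proj_orth v u : W u -> dot (v - proj W v) u = 0.
Proof. by case: (projP v) => _; exact. Qed.

Lemma proj_unique v w : W w -> (forall u, W u -> dot (v - w) u = 0) -> proj W v = w.
Proof.
move=> Ww wo; apply/eqP; rewrite -subr_eq0; apply/eqP/dot_eq0.
have Wd : W (proj W v - w) by exact: (subB sW (proj_in v)).
rewrite {1}(_ : proj W v - w = (v - w) - (v - proj W v)); last first.
  by rewrite opprB [RHS]addrC addrA addrNK.
by rewrite dotBl wo// proj_orth// subrr.
Qed.

Lemma proj_id v : W v -> proj W v = v.
Proof. by move=> Wv; apply: proj_unique => // u _; rewrite subrr dot0l. Qed.

Lemma projD u v : proj W (u + v) = proj W u + proj W v.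
Proof.
apply: proj_unique => [|w Ww]; first by apply: subD => //; exact: proj_in.
by rewrite opprD addrACA dotDl !proj_orth// addr0.
Qed.

Lemma projZ a v : proj W (a *: v) = a *: proj W v.
Proof.
apply: proj_unique => [|w Ww]; first by apply: subZ => //; exact: proj_in.
by rewrite -scalerBr dotZl proj_orth// mulr0.
Qed.

Lemma projN v : proj W (- v) = - proj W v.
Proof. by rewrite -scaleN1r projZ scaleN1r. Qed.
Lemma projB u v : proj W (u - v) = proj W u - proj W v.
Proof. by rewrite projD projN. Qed.

Lemma dot_projl u v : dot (proj W u) v = dot (proj W u) (proj W v).
Proof.
apply/eqP; rewrite -subr_eq0 -dotBr dotC proj_orth//; exact: proj_in.
Qed.
Lemma dot_proj u v : dot (proj W u) v = dot u (proj W v).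
Proof. by rewrite dot_projl dotC -dot_projl dotC. Qed.
Lemma dot_in u v : W v -> dot (proj W u) v = dot u v.
Proof. by move=> Wv; rewrite dot_proj proj_id. Qed.

Lemma pythagoras v : dot v v =
  dot (proj W v) (proj W v) + dot (v - proj W v) (v - proj W v).
Proof. by rewrite dotBl !dotBr (dotC v) -dot_projl; ring. Qed.

Lemma hn_proj v : hn (proj W v) <= hn v.
Proof. by rewrite ler_sqrt ?dot_ge0// (pythagoras v) lerDl dot_ge0. Qed.

Lemma proj_dist v w : W w -> hn (v - proj W v) <= hn (v - w).
Proof.
move=> Ww; rewrite ler_sqrt ?dot_ge0//.
by rewrite (pythagoras (v - w)) projB (proj_id Ww) opprB addrA addrNK lerDr dot_ge0.
Qed.

End Projection.

Section Commutation.
Variables (W W' : set H) (sW : subspace W) (sW' : subspace W').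

(** Projections are self-adjoint, so a stable [W'] has a stable orthogonal complement. *)
Lemma proj_comm : (forall z, W' z -> W' (proj W z)) ->
  forall v, proj W (proj W' v) = proj W' (proj W v).
Proof.
move=> st v; apply: esym; apply: proj_unique => //; first by apply: st; exact: proj_in.
move=> u Wu; rewrite -projB// dot_proj// proj_orth//; by apply: st.
Qed.

End Commutation.

Lemma projI W W' : subspace W -> subspace W' ->
  (forall v, proj W (proj W' v) = proj W' (proj W v)) ->
  forall v, proj W (proj W' v) = proj (W `&` W') v.
Proof.
move=> sW sW' com v; apply: esym; apply: proj_unique.
- exact: subspaceI.
- by split; [|rewrite com]; exact: proj_in.
move=> u [Wu W'u].
have -> : v - proj W (proj W' v) = (v - proj W' v) + (proj W' v - proj W (proj W' v)).
  by rewrite addrA subrK.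
by rewrite dotDl !proj_orth// addr0.
Qed.

(** The second hypothesis holds when each [xi i] is a projection of [v]; the bound is the
    nonnegativity of the squared norm of v - sum xi. *)
Lemma bessel (m : nat) (xi : 'I_m -> H) v :
  (forall i j, i != j -> dot (xi i) (xi j) = 0) ->
  (forall i, dot (xi i) v = dot (xi i) (xi i)) ->
  \sum_i dot (xi i) (xi i) <= dot v v.
Proof.
move=> orth xv.
have Sv : dot (\sum_i xi i) v = \sum_i dot (xi i) (xi i).
  by rewrite dot_suml; apply: eq_bigr => i _; exact: xv.
have SS : dot (\sum_i xi i) (\sum_i xi i) = \sum_i dot (xi i) (xi i).
  rewrite dot_suml; apply: eq_bigr => i _.
  rewrite dot_sumr (bigD1 i)//= big1 ?addr0// => j ji.
  by rewrite orth// eq_sym.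
have := dot_ge0 (v - \sum_i xi i).
by rewrite dotBl !dotBr (dotC v (\sum_i xi i)) SS Sv; lra.
Qed.

End InnerProduct.

(** * k-adically continuous vectors *)

Record hrep (R : realType) (G : groupType) (H : hilb R) := HRep {
  hact :> G -> H -> H;
  hact1 : forall v, hact 1%g v = v;
  hactM : forall g h v, hact (g * h)%g v = hact g (hact h v);
  hactD : forall g u v, hact g (u + v) = hact g u + hact g v;
  hactZ : forall g a v, hact g (a *: v) = a *: hact g v;
  hact_dot : forall g u v, dot (hact g u) (hact g v) = dot u v
}.

Section GroupFacts.
Variable G : groupType.
Implicit Types x y c g : G.
Local Open Scope group_scope.

Lemma commuteVl x y : commute x y -> commute x^-1 y.
Proof. by move=> /commute_sym/commuteV/commute_sym. Qed.

Lemma commute_conj x g : commute x g -> x ^ g = x.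
Proof. by move=> xg; rewrite conjgE xg mulKg. Qed.

Lemma heis_conjX x y c : x ^ y = c * x -> commute c y ->
  forall b, x ^ (y ^+ b) = c ^+ b * x.
Proof.
move=> xy cy; elim=> [|b IH]; first by rewrite !expg0 conjg1 mul1g.
rewrite !expgSr conjgM IH conjMg conjXg (commute_conj cy) xy.
by rewrite mulgA.
Qed.

Lemma heis_conjXX x y c : x ^ y = c * x -> commute c x -> commute c y ->
  forall a b, (x ^+ a) ^ (y ^+ b) = c ^+ (b * a) * x ^+ a.
Proof.
move=> xy cx cy a b; rewrite conjXg (heis_conjX xy cy) expgMn ?expgnA//.
exact/commute_sym/commuteX/commute_sym.
Qed.

End GroupFacts.

Section TorsionSpace.
Variables (R : realType) (G : groupType) (H : hilb R) (pi : hrep G H) (k : nat).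
Hypothesis k_gt0 : (0 < k)%N.
Implicit Types (x y c g : G) (u v w z : H).

Lemma hactN g u : pi g (- u) = - pi g u.
Proof. by rewrite -scaleN1r hactZ scaleN1r. Qed.
Lemma hactB g u v : pi g (u - v) = pi g u - pi g v.
Proof. by rewrite hactD hactN. Qed.
Lemma hact0 g : pi g 0 = 0.
Proof. by have := hactZ pi g 0 0; rewrite !scale0r. Qed.
Lemma hn_act g u : hn (pi g u) = hn u.
Proof. by rewrite /hn hact_dot. Qed.
Lemma hactK g u : pi g^-1%g (pi g u) = u.
Proof. by rewrite -hactM mulVg hact1. Qed.
Lemma hactVK g u : pi g (pi g^-1%g u) = u.
Proof. by rewrite -hactM mulgV hact1. Qed.
Lemma hact_dotV g u v : dot (pi g u) v = dot u (pi g^-1%g v).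
Proof. by rewrite -(hact_dot pi g^-1%g) hactK. Qed.

(* The vectors on which the cyclic group [<x>] acts continuously for the
   k-adic topology, i.e. the closure of the vectors fixed by some [x ^+ k ^ s]. *)
Definition tors x : set H := [set z | forall e, 0 < e -> exists s : nat,
  forall j : nat, hn (pi (x ^+ (j * k ^ s))%g z - z) <= e].

Lemma tors_sub x : subspace (tors x).
Proof.
split.
- by move=> e e0; exists 0%N => j; rewrite hact0 subr0 hn0 ltW.
- move=> u v tu tv e e0.
  have e20 : 0 < e / 2 by lra.
  have [s sP] := tu _ e20; have [t tP] := tv _ e20; exists (s + t)%N => j.
  rewrite hactD opprD addrACA; apply: le_trans (hnD _ _) _.
  have := sP (j * k ^ t)%N; have := tP (j * k ^ s)%N.
  by rewrite -!mulnA -!expnD (addnC t); lra.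
- move=> a u tu e e0.
  have a0 : 0 < `|a| + 1 by have := normr_ge0 a; lra.
  have [s sP] := tu (e / (`|a| + 1)) (divr_gt0 e0 a0); exists s => j.
  rewrite hactZ -scalerBr hnZ; have := sP j; rewrite ler_pdivlMr//.
  by have := hn_ge0 (pi (x ^+ (j * k ^ s))%g u - u); have := normr_ge0 a; nra.
move=> v cl e e0; have e30 : 0 < e / 3 by lra.
have [w tw vw] := cl _ e30; have [s sP] := tw _ e30; exists s => j.
set g := (x ^+ _)%g.
apply: le_trans (hn_triangle (pi g w) _ _) _; rewrite -hactB hn_act.
apply: le_trans (lerD (lexx _) (hn_triangle w _ _)) _.
by have := sP j; rewrite -/g (hnB w v); lra.
Qed.
Local Hint Resolve tors_sub : core.

Notation P x := (proj (tors x)).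

Lemma torsJ x g z : tors (x ^ g)%g z <-> tors x (pi g z).
Proof.
have aux y h w : tors y w -> tors (y ^ h)%g (pi h^-1%g w).
  move=> tw e e0; have [s sP] := tw e e0; exists s => j.
  by rewrite -conjXg -hactM conjgE -mulgA mulgK hactM -hactB hn_act.
split=> t; last by have := aux _ g _ t; rewrite hactK.
by have := aux _ g^-1%g _ t; rewrite conjgK invgK.
Qed.

Lemma projJ x g v : P (x ^ g)%g v = pi g^-1%g (P x (pi g v)).
Proof.
apply: proj_unique => // [|u]; first by apply/torsJ; rewrite hactVK; exact: proj_in.
move=> /torsJ tu; rewrite -[v](hactK g) -hactB hact_dotV invgK.
by rewrite hactVK proj_orth.
Qed.

Lemma tors_act x g z : commute x g -> tors x z -> tors x (pi g z).
Proof. by move=> xg; rewrite -torsJ commute_conj. Qed.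

(** Powers of [y] fix [x] under conjugation, hence commute with [P x]. As [P x] does not increase
    norms, it preserves continuity along [y], and [proj_comm] applies. *)
Lemma tors_projC x y v : commute x y -> P x (P y v) = P y (P x v).
Proof.
move=> xy; apply: proj_comm => // z tz e e0.
have [s sP] := tz e e0; exists s => j; set g := (y ^+ _)%g.
have -> : pi g (P x z) = P x (pi g z).
  have /(commute_conj)/(congr1 (fun h => P h z)) : commute x g by exact: commuteX.
  by rewrite projJ => <-; rewrite hactVK.
by rewrite -projB//; apply: le_trans (hn_proj _ _) (sP j).
Qed.

Lemma tors_mul x y z : commute x y -> tors x z -> tors y z -> tors (x * y)%g z.
Proof.
move=> xy tx ty e e0; have e20 : 0 < e / 2 by lra.
have [s sP] := tx _ e20; have [t tP] := ty _ e20; exists (s + t)%N => j.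
rewrite expgMn// hactM; apply: le_trans (hn_triangle (pi (x ^+ (j * k ^ (s + t)))%g z) _ _) _.
rewrite -hactB hn_act; have := sP (j * k ^ t)%N; have := tP (j * k ^ s)%N.
by rewrite -!mulnA -!expnD (addnC t); lra.
Qed.

Lemma tors_inv x z : tors x z -> tors x^-1%g z.
Proof.
move=> tx e e0; have [s sP] := tx e e0; exists s => j.
by rewrite expVgn -(hn_act (x ^+ (j * k ^ s))%g) hactB hactVK hnB.
Qed.

Lemma tors_exp x z m : tors x z -> tors (x ^+ m)%g z.
Proof.
move=> tx e e0; have [s sP] := tx e e0; exists s => j.
by rewrite -expgnA mulnA; exact: sP.
Qed.

(** Passing to an m-th power loses nothing when m divides a power of k; this is where the divisors
    of the factorial are used. *)
Lemma tors_root x z m t : (m %| k ^ t)%N -> tors (x ^+ m)%g z -> tors x z.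
Proof.
move=> /dvdnP[q kq] tx e e0; have [s sP] := tx e e0; exists (t + s)%N => j.
have := sP (j * q)%N; rewrite -expgnA expnD kq.
by rewrite (_ : (m * (j * q * k ^ s) = j * (q * m * k ^ s)))%N //; ring.
Qed.

(** A power c^(ab) is a commutator of x^a and y^b, a product of four factors each of which moves [z]
    by at most e / 4. *)
Lemma tors_heis x y c z : (x ^ y = c * x)%g -> commute c x -> commute c y ->
  tors x z -> tors y z -> tors c z.
Proof.
move=> xy cx cy tx ty e e0; have e40 : 0 < e / 4 by lra.
have [s sP] := tx _ e40; have [t tP] := ty _ e40; exists (t + s)%N => j.
have := heis_conjXX xy cx cy (k ^ s) (j * k ^ t).
rewrite -mulnA -expnD; set b := (j * k ^ t)%N; set a := (k ^ s)%N => E.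
have <- : ((x ^+ a) ^ (y ^+ b) * (x ^+ a)^-1 = c ^+ (j * k ^ (t + s)))%g by rewrite E mulgK.
rewrite conjgE.
have xa : hn (pi (x ^+ a)%g z - z) <= e / 4 by have := sP 1%N; rewrite mul1n.
have yb : hn (pi (y ^+ b)%g z - z) <= e / 4 by exact: tP.
have inv_le g : hn (pi g z - z) <= e / 4 -> hn (pi g^-1%g z - z) <= e / 4.
  by move=> gz; rewrite -(hn_act g) hactB hactVK hnB.
have prod_le g h d d' : hn (pi g z - z) <= d -> hn (pi h z - z) <= d' ->
    hn (pi (g * h)%g z - z) <= d + d'.
  move=> gz hz; rewrite hactM; apply: le_trans (hn_triangle (pi g z) _ _) _.
  by rewrite -hactB hn_act; lra.
have h1 := prod_le _ _ _ _ xa yb; have h2 := prod_le _ _ _ _ (inv_le _ yb) h1.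
by have := prod_le _ _ _ _ h2 (inv_le _ xa); lra.
Qed.

(** The product of commuting projections is the projection to the intersection, so <u, w> only sees
    components in [C]. *)
Lemma orth_mod (U W C : set H) u w : subspace U -> subspace W ->
  (forall z, proj U (proj W z) = proj W (proj U z)) -> U `&` W `<=` C ->
  U u -> W w -> (forall z, C z -> dot u z = 0) -> dot u w = 0.
Proof.
move=> sU sW com UWC Uu Ww uC.
rewrite -(proj_id sU Uu) dot_proj// -(proj_id sW Ww) uC//; apply: UWC.
by split; [|rewrite com]; exact: proj_in.
Qed.

Section Heisenberg.
Variables (x y c : G).
Hypotheses (xyc : (x ^ y = c * x)%g) (cx : commute c x) (cy : commute c y).

(** Inside [tors c] the spaces of [x] and of [c ^+ b * x] coincide, because [c] is central in the
    triple. *)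
Lemma proj_heis b z : tors c z -> P (c ^+ b * x)%g z = P x z.
Proof.
move=> tz; have cb : commute (c ^+ b)%g x by exact/commute_sym/commuteX/commute_sym.
have cc : commute c (c ^+ b * x)%g by apply: commuteM => //; exact: commuteX.
have toI h : commute c h -> P h z = proj (tors h `&` tors c) z.
  move=> ch; rewrite -projI// => [|w]; first by rewrite (proj_id _ tz).
  by rewrite tors_projC//; exact/commute_sym.
rewrite !toI//; congr (proj _ z); apply/seteqP; split=> w [t1 t2]; split => //.
  rewrite -(mulKg (c ^+ b)%g x); apply: tors_mul => //; last exact/tors_inv/tors_exp.
  by apply: commuteVl; apply: commuteM => //; exact: commute_refl.
by apply: tors_mul => //; exact: tors_exp.
Qed.

Lemma heis_stable z : tors c z -> tors y z -> tors y (P x z).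
Proof.
move=> tc ty e e0; have [s sP] := ty e e0; exists s => j; set b := (j * _)%N.
have -> : pi (y ^+ b)%g (P x z) = P x (pi (y ^+ b)%g z).
  by rewrite -(proj_heis b tc) -(heis_conjX xyc cy) projJ hactVK.
by rewrite -projB//; apply: le_trans (hn_proj _ _) (sP j).
Qed.

(** On [tors c] the triple behaves as a commuting pair. With w = z - P y z, the vector z - P x z
    splits as (P y z - P x (P y z)) + (w - P x w). The first summand lies in [tors y], hence is
    orthogonal to w; the second pairs with w to the squared norm of w - P x w. *)
Lemma heis_nonneg z : tors c z -> 0 <= dot (z - P x z) (z - P y z).
Proof.
move=> tc.
have tyc : tors c (P y z).
  rewrite -(proj_id _ tc)// tors_projC; last exact/commute_sym.
  exact: proj_in.
have st : tors y (P x (P y z)) by apply: heis_stable => //; exact: proj_in.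
set w := z - P y z.
have -> : z - P x z = (P y z - P x (P y z)) + (w - P x w).
  by rewrite projB// opprB addrACA (addrC (P y z) w) subrK addKr.
have wy : dot (P y z - P x (P y z)) w = 0.
  by rewrite dotC proj_orth//; apply: (subB (tors_sub y)) => //; exact: proj_in.
rewrite dotDl wy add0r; have := dot_ge0 (w - P x w).
rewrite (dotBr (w - _)) (proj_orth (tors_sub x) w (proj_in _ w))//.
by rewrite subr0.
Qed.

(** The translates of [u] by y^(-m k^s), m < N, lie in the spaces of c^(m k^s) x. Two of these
    spaces meet inside [tors c], to which all translates are orthogonal, so the translates are
    pairwise orthogonal. Each pairs with [v] nearly as [u] does, while their sum has norm only sqrt
    N |u|. *)
Lemma heis_orth N u v : (forall m, (0 < m < N)%N -> (m %| k)%N) ->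
  tors x u -> (forall z, tors c z -> dot u z = 0) -> tors y v ->
  N%:R * `|dot u v| <= Num.sqrt N%:R * hn u * hn v.
Proof.
move=> Nk tu uc tv; apply/ler_addgt0Pr => e e0.
(* Tolerance for moving [v]: the N errors, each scaled by |u|, add up to at most e. The summand 1
   covers u = 0. *)
have d0 : 0 < e / (N%:R * hn u + 1).
  by rewrite divr_gt0// ltr_wpDl// mulr_ge0 ?hn_ge0.
have [s sP] := tv _ d0.
pose g (m : nat) := (y ^+ (m * k ^ s))%g.
pose xi (m : nat) := pi (g m)^-1%g u.
have txi m : tors (c ^+ (m * k ^ s) * x)%g (xi m).
  by rewrite -(heis_conjX xyc cy); apply/torsJ; rewrite hactVK.
have xic m z : tors c z -> dot (xi m) z = 0.
  move=> tz; rewrite hact_dotV invgK; apply: uc.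
  by apply: tors_act => //; exact: commuteX.
have cX m : commute (c ^+ m)%g x by exact/commute_sym/commuteX/commute_sym.
have cXX m p : commute (c ^+ m * x)%g (c ^+ p * x)%g.
  apply: commuteM; apply: commute_sym; apply: commuteM => //.
  - exact/commuteX/commute_sym/commuteX/commute_refl.
  - exact: commute_sym.
have orth_lt m p : (m < p < N)%N -> dot (xi m) (xi p) = 0.
  move=> /andP[mp pN].
  apply: (@orth_mod (tors (c ^+ (m * k ^ s) * x)%g)
    (tors (c ^+ (p * k ^ s) * x)%g) (tors c)) => //.
  - by move=> z; exact: tors_projC.
  - move=> z [t1 t2]; apply: (@tors_root c z ((p - m) * k ^ s) s.+1).
      rewrite expnS dvdn_pmul2r ?expn_gt0 ?k_gt0//; apply: Nk.
      by rewrite subn_gt0 mp (leq_ltn_trans (leq_subr _ _)).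
    have -> : (c ^+ ((p - m) * k ^ s) = (c ^+ (p * k ^ s) * x) * (c ^+ (m * k ^ s) * x)^-1)%g.
      by rewrite invgM mulgA mulgK mulnBl expgnFr// leq_mul2r (ltnW mp) orbT.
    by apply: tors_mul => //; [exact/commuteV | exact: tors_inv].
  - by move=> z; exact: xic.
have orth m p : (m < N)%N -> (p < N)%N -> m != p -> dot (xi m) (xi p) = 0.
  move=> mN pN; rewrite neq_ltn => /orP[mp|pm]; first by rewrite orth_lt ?mp.
  by rewrite dotC orth_lt ?pm.
have SS : dot (\sum_(m < N) xi m) (\sum_(m < N) xi m) = N%:R * dot u u.
  rewrite dot_suml (eq_bigr (fun=> dot u u)) => [|m _].
    by rewrite sumr_const card_ord mulr_natl.
  rewrite dot_sumr (bigD1 m)//= big1 ?addr0 => [|p pm]; first by rewrite hact_dot.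
  by rewrite orth// eq_sym.
have hS : hn (\sum_(m < N) xi m) = Num.sqrt N%:R * hn u.
  by rewrite /hn SS sqrtrM.
have near_ m : `|dot u v - dot (xi m) v| <= hn u * (e / (N%:R * hn u + 1)).
  rewrite hact_dotV invgK -dotBr; apply: le_trans (ler_dot _ _) _.
  by rewrite ler_wpM2l ?hn_ge0// hnB; exact: sP.
have -> : N%:R * `|dot u v| = `|\sum_(m < N) (dot u v - dot (xi m) v) + dot (\sum_(m < N) xi m) v|.
  rewrite dot_suml -big_split/= (eq_bigr (fun=> dot u v)) => [|m _]; last by rewrite subrK.
  by rewrite sumr_const card_ord -[in RHS]mulr_natl normrM normr_nat.
apply: le_trans (ler_normD _ _) _; rewrite addrC; apply: lerD.
  by rewrite -hS; exact: ler_dot.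
apply: le_trans (ler_norm_sum _ _ _) _.
apply: (@le_trans _ _ (\sum_(m < N) hn u * (e / (N%:R * hn u + 1)))); first by apply: ler_sum.
rewrite sumr_const card_ord -[X in X <= _]mulr_natl !mulrA ler_pdivrMr; last first.
  by rewrite ltr_wpDl// mulr_ge0 ?hn_ge0.
by rewrite mulrC ler_pM2l// lerDl.
Qed.

End Heisenberg.

(** Bessel for the parts of the projections beyond [C]. If z lies in the spaces of x y^m and x y^p,
    m < p < N, then it lies in that of y^(p - m), hence of [y] since p - m divides k, hence also of
    [x]; so these parts are pairwise orthogonal. *)
Lemma tors_bessel (x y : G) v N : commute x y ->
  (forall m, (0 < m < N)%N -> (m %| k)%N) ->
  let C := P x (P y v) in
  (forall m, 0 <= dot (P (x * y ^+ m)%g v) (P (x * y ^+ m)%g v) - dot C C) /\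
  \sum_(m < N) (dot (P (x * y ^+ m)%g v) (P (x * y ^+ m)%g v) - dot C C) <= dot v v.
Proof.
move=> xy Nk C.
have sC : subspace (tors x `&` tors y) by exact: subspaceI.
have CE : C = proj (tors x `&` tors y) v by apply: projI => // w; exact: tors_projC.
have xym m : commute x (y ^+ m)%g by exact: commuteX.
have Cm m : tors (x * y ^+ m)%g C.
  by have [] := proj_in sC v; rewrite -CE => tx ty; apply: tors_mul => //; exact: tors_exp.
pose xi m := P (x * y ^+ m)%g v - C.
have CvE : dot C v = dot C C by rewrite CE; exact: dot_projl.
have PC m : dot (P (x * y ^+ m)%g v) C = dot C C.
  by rewrite dot_in// dotC CvE.
have xixi m : dot (xi m) (xi m) = dot (P (x * y ^+ m)%g v) (P (x * y ^+ m)%g v) - dot C C.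
  by rewrite dotBl !dotBr (dotC C) PC subrr subr0.
have xiv m : dot (xi m) v = dot (xi m) (xi m).
  by rewrite xixi dotBl dot_projl// CvE.
split=> [m|]; first by rewrite -xixi dot_ge0.
have orth_lt m p : (m < p < N)%N -> dot (xi m) (xi p) = 0.
  move=> /andP[mp pN].
  apply: (@orth_mod (tors (x * y ^+ m)%g) (tors (x * y ^+ p)%g) (tors x `&` tors y)) => //.
  - move=> z; apply: tors_projC; apply: commuteM; apply: commute_sym; apply: commuteM => //.
      exact: commute_sym.
    exact/commuteX/commute_sym/commuteX.
  - move=> z [t1 t2].
    have ty : tors y z.
      apply: (@tors_root y z (p - m) 1).
        rewrite expn1; apply: Nk.
        by rewrite subn_gt0 mp (leq_ltn_trans (leq_subr _ _)).
      have -> : (y ^+ (p - m) = (x * y ^+ m)^-1 * (x * y ^+ p))%g.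
        rewrite invgM -mulgA mulKg expgnFr// ?(ltnW mp)//.
        exact: (commuteV (commuteX m (commute_sym (commuteX p (commute_refl y))))).
      apply: tors_mul => //; last exact: tors_inv.
      apply: commuteVl; apply: commuteM; apply: commute_sym; apply: commuteM => //.
        exact: commute_sym.
      exact/commuteX/commute_sym/commuteX.
    split=> //; rewrite -(mulgK (y ^+ m)%g x); apply: tors_mul => //.
      apply/commuteV/commute_sym/commuteM; last exact: commute_refl.
      exact/commute_sym.
    exact/tors_inv/tors_exp.
  - by apply: (subB (tors_sub _)) => //; exact: proj_in.
  - by apply: (subB (tors_sub _)) => //; exact: proj_in.
  - by move=> z [tx ty]; rewrite dotBl dot_in//; [rewrite CE dot_in// subrr|apply: tors_mul => //; exact: tors_exp].
under eq_bigr do rewrite -xixi.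
apply: (@bessel _ _ N (fun i => xi i) v) => // i j.
 rewrite -val_eqE/= neq_ltn => /orP[lt|lt]; first by rewrite orth_lt ?lt/=.
by rewrite dotC orth_lt ?lt/=.
Qed.

End TorsionSpace.

(** * The spectral gap *)

Lemma expr_small (R : realType) (r e : R) : 0 <= r -> r < 1 -> 0 < e ->
  exists N : nat, forall m, (N <= m)%N -> r ^+ m < e.
Proof.
move=> r0 r1 e0.
have /cvgrPdist_lt/(_ e e0)[N _ NP] : (fun m : nat => r ^+ m) @ \oo --> (0 : R).
  by apply: cvg_expr; rewrite ger0_norm.
by exists N => m /NP/=; rewrite sub0r normrN ger0_norm// exprn_ge0.
Qed.

Definition coproj (R : realType) (H : hilb R) (W : set H) (v : H) : H :=
  locked (v - proj W v).
Lemma coprojE (R : realType) (H : hilb R) (W : set H) v : coproj W v = v - proj W v.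
Proof. by rewrite /coproj -lock. Qed.

Lemma coprojD (R : realType) (H : hilb R) (W : set H) : subspace W ->
  forall u v, coproj W (u + v) = coproj W u + coproj W v.
Proof. by move=> sW u v; rewrite !coprojE projD// opprD addrACA. Qed.

Section Descent.
Variables (R : realType) (H : hilb R) (I : finType) (A : pred I) (W : I -> set H).
Hypothesis W_sub : forall i, subspace (W i).
Local Notation F i v := (coproj (W i) v).
Definition Dsum v := \sum_(i | A i) F i v.
Definition qsum v := \sum_(i | A i) dot (F i v) (F i v).
Local Notation D := Dsum.
Local Notation q := qsum.
Variables (M : R).
Hypothesis ME : M = #|I|.+1%:R.
Let M_gt0 : 0 < M. Proof. by rewrite ME ltr0n. Qed.

Lemma projF_dot i u v : dot (F i u) v = dot (F i u) (F i v).
Proof.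
rewrite [coproj _ v]coprojE dotBr -[LHS]subr0; congr (_ - _).
by rewrite coprojE proj_orth//; exact: proj_in.
Qed.

Lemma hn_projF i v : hn (F i v) <= hn v.
Proof. by rewrite coprojE ler_sqrt ?dot_ge0// (pythagoras (W_sub i) v) lerDr dot_ge0. Qed.

Let FD i u v : F i (u + v) = F i u + F i v.
Proof. by rewrite !coprojE projD// opprD addrACA. Qed.
Let FZ i a v : F i (a *: v) = a *: F i v.
Proof. by rewrite !coprojE projZ// scalerBr. Qed.

Let qE v : q v = dot (D v) v.
Proof. by rewrite dot_suml /qsum; apply: eq_bigr => i _; rewrite [RHS]projF_dot. Qed.

Let q_ge0 v : 0 <= q v.
Proof. by apply: sumr_ge0 => i _; exact: dot_ge0. Qed.

Let q_le v : q v <= M * dot v v.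
Proof.
apply: (@le_trans _ _ (\sum_(i | A i) dot v v)).
  by apply: ler_sum => i _; rewrite -!hn_sqr ler_pXn2r ?nnegrE ?hn_ge0// hn_projF.
rewrite ME sumr_const -[leLHS]mulr_natl ler_wpM2r ?dot_ge0// ler_nat; apply: leqW; exact: max_card.
Qed.

Let dotDE u v : dot (D u) v = \sum_(i | A i) dot (F i u) (F i v).
Proof. by rewrite dot_suml; apply: eq_bigr => i _; rewrite projF_dot. Qed.

(** Termwise 2 <F v, F D v> <= M |F v|^2 + |F D v|^2 / M; after summation [q_le] at [D v] lets half
    of the left side absorb the last term. *)
Let D_le v : dot (D v) (D v) <= M * q v.
Proof.
have DE := dotDE v (D v).
have : 2 * dot (D v) (D v) <= M * q v + M^-1 * q (D v).
  rewrite DE /qsum !mulr_sumr -big_split/=; apply: ler_sum => i _.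
  have := dot_ge0 (F i v - M^-1 *: F i (D v)).
  rewrite dotBl !dotBr !(dotZl, dotZr) (dotC (F i (D v)) (F i v)).
  set a := dot _ _; set b := dot _ _; set c := dot _ _ => abc.
  rewrite -subr_ge0 (_ : _ - _ = M * (a - M^-1 * b - (M^-1 * b - M^-1 * (M^-1 * c)))).
    by rewrite mulr_ge0// ltW.
  by field; rewrite gt_eqF.
have : M^-1 * q (D v) <= dot (D v) (D v) by rewrite ler_pdivrMl.
by lra.
Qed.

Hypothesis gap : forall v, 2^-1 * q v <= dot (D v) (D v).

Let T v := v - M^-1 *: D v.
Let r : R := 1 - (4 * M)^-1.

Let Minv : 0 < M^-1 <= 1.
Proof. by rewrite invr_gt0 M_gt0 invf_le1// ME ler1n. Qed.

Let r01 : 0 <= r < 1.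
Proof. by rewrite /r invfM; have := Minv; lra. Qed.

Let DB u v : D (u - v) = D u - D v.
Proof.
rewrite /Dsum -sumrB; apply: eq_bigr => i _.
by rewrite -[in LHS]scaleN1r FD FZ scaleN1r.
Qed.
Let DZ a v : D (a *: v) = a *: D v.
Proof. by rewrite /Dsum scaler_sumr; apply: eq_bigr => i _; exact: FZ. Qed.

(** [T] is a gradient step for [q]. As q (D v) <= M |D v|^2, half of the first order gain survives,
    and [gap] turns it into q v / (2 M); finally 1 - 1 / (2 M) <= r^2. *)
Let qT v : q (T v) <= r ^+ 2 * q v.
Proof.
have -> : q (T v) = q v - 2 * M^-1 * dot (D v) (D v) + M^-1 ^+ 2 * q (D v).
  rewrite qE /T DB DZ dotBl !dotBr !(dotZl, dotZr) -qE -(qE (D v)).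
  have -> : dot (D (D v)) v = dot (D v) (D v).
    by rewrite !dotDE; apply: eq_bigr => i _; rewrite dotC.
  by ring.
have h1 : M^-1 ^+ 2 * q (D v) <= M^-1 * dot (D v) (D v).
  rewrite expr2 -mulrA ler_wpM2l//; first by case/andP: Minv => /ltW.
  by rewrite ler_pdivrMl.
have h2 : M^-1 * (2^-1 * q v) <= M^-1 * dot (D v) (D v).
  by rewrite ler_wpM2l//; case/andP: Minv => /ltW.
have h3 : (1 - M^-1 / 2) * q v <= r ^+ 2 * q v.
  by rewrite ler_wpM2r// /r invfM; have := Minv; nra.
by lra.
Qed.

Let hT v : hn (T v - v) <= Num.sqrt (q v).
Proof.
rewrite /T addrAC subrr add0r hnN ler_sqrt// dotZl dotZr mulrA.
rewrite -[leRHS]mul1r; apply: (@le_trans _ _ (M^-1 * M^-1 * (M * q v))).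
  by rewrite ler_wpM2l// mulr_ge0 ?invr_ge0 ?(ltW M_gt0).
rewrite mulrA divfK ?gt_eqF// ler_wpM2r//; by case/andP: Minv.
Qed.

(** Along the iterates of [T] the square root of [q] decays like r^t, and the total displacement is
    at most the sum of r^t sqrt (q w), that is 4 M sqrt (q w). The hypothesis makes this smaller
    than |w|, so the limit is not 0. *)
Lemma descent w : 16 * M ^+ 2 * q w < dot w w ->
  exists2 z, z != 0 & forall i, A i -> W i z.
Proof.
move=> qw; pose f t := iter t T w.
have [r0 r1] := andP r01.
have qf t : Num.sqrt (q (f t)) <= r ^+ t * Num.sqrt (q w).
  elim: t => [|t IH]; first by rewrite mul1r.
  apply: (@le_trans _ _ (r * Num.sqrt (q (f t)))); last first.
    by rewrite exprS -mulrA ler_wpM2l.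
  by rewrite -[r in leRHS]ger0_norm// -sqrtr_sqr -sqrtrM ?sqr_ge0// ler_sqrt ?mulr_ge0 ?sqr_ge0//; exact: qT.
have fd t s : hn (f (t + s)%N - f t) <= 4 * M * r ^+ t * Num.sqrt (q w).
  have : hn (f (t + s)%N - f t) <= 4 * M * (r ^+ t - r ^+ (t + s)) * Num.sqrt (q w).
    elim: s => [|s IH]; first by rewrite addn0 !subrr mulr0 mul0r hn0.
    apply: le_trans (hn_triangle (f (t + s)%N) _ _) _; rewrite addnS.
    have h1 : hn (f (t + s).+1 - f (t + s)%N) <= r ^+ (t + s) * Num.sqrt (q w).
      by apply: le_trans (hT _) (qf _).
    apply: le_trans (lerD h1 IH) _; rewrite -mulrDl ler_wpM2r ?sqrtr_ge0// exprS.
    have -> : 4 * M * (r ^+ t - r * r ^+ (t + s)) = 4 * M * (r ^+ t - r ^+ (t + s)) + r ^+ (t + s) * (4 * M * (1 - r)) by ring.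
    rewrite {5}/r opprB addrCA subrr addr0 mulfV ?mulr1; last by rewrite mulf_neq0 ?gt_eqF//; lra.
    by rewrite addrC.
  move/le_trans; apply; rewrite ler_wpM2r ?sqrtr_ge0// ler_wpM2l ?mulr_ge0 ?(ltW M_gt0)//.
  by rewrite gerBl exprn_ge0.
have small e : 0 < e -> exists N : nat, forall m, (N <= m)%N -> 4 * M * r ^+ m * Num.sqrt (q w) < e.
  move=> e0; have d0 : 0 < 4 * M * Num.sqrt (q w) + 1.
    by rewrite ltr_wpDl ?ltr01// !mulr_ge0 ?sqrtr_ge0 ?(ltW M_gt0).
  have [N NP] := expr_small r0 r1 (divr_gt0 e0 d0); exists N => m /NP.
  rewrite ltr_pdivlMr//; apply: le_lt_trans; rewrite mulrDr mulr1 -[leLHS]addr0.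
  rewrite lerD ?exprn_ge0// (_ : _ * _ * _ * _ = r ^+ m * (4 * M * Num.sqrt (q w)))//; ring.
have [|z zP] := hlim (f := f).
  move=> e e0; have [N NP] := small _ e0; exists N => m p Nm Np.
  have aux a b : (N <= a)%N -> (a <= b)%N -> hn (f b - f a) < e.
    by move=> Na /subnKC <-; apply: le_lt_trans (fd _ _) (NP _ Na).
  by case: (leqP p m) => [|/ltnW] pm; [|rewrite hnB]; exact: aux.
exists z.
  apply: contraTneq qw => z0; rewrite -leNgt.
  rewrite -hn_sqr -[in leRHS](sqr_sqrtr (q_ge0 w)).
  rewrite (_ : 16 * M ^+ 2 * _ = (4 * M * Num.sqrt (q w)) ^+ 2); last by ring.
  rewrite ler_pXn2r ?nnegrE ?hn_ge0 ?mulr_ge0 ?sqrtr_ge0 ?(ltW M_gt0)//.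
  apply/ler_addgt0Pr => e e0; have [N NP] := zP e e0.
  have := NP N (leqnn _); rewrite z0 subr0 => fN.
  have := fd 0%N N; rewrite add0n expr0 mulr1 /= => fw.
  have := hn_triangle (f N) w 0; rewrite !subr0 (hnB w); lra.
move=> i Ai; suff F0 : F i z = 0 by rewrite -(subrK (proj (W i) z) z) -coprojE F0 add0r; exact: proj_in.
apply: hn_eq0; apply/eqP; rewrite eq_le hn_ge0 andbT; apply/ler_addgt0Pr => e e0.
have e20 : 0 < e / 2 by lra.
have [N NP] := zP _ e20; have [N' NP'] := small _ e20.
pose m := maxn N N'.
rewrite add0r (_ : F i z = F i (f m) + F i (z - f m)); last by rewrite -FD addrC subrK.
apply: le_trans (hnD _ _) _.
have h1 : hn (F i (z - f m)) < e / 2.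
  by apply: le_lt_trans (hn_projF _ _) _; rewrite hnB; apply: NP; exact: leq_maxl.
suff h2 : hn (F i (f m)) < e / 2 by lra.
apply: le_lt_trans (NP' m (leq_maxr _ _)).
apply: (@le_trans _ _ (r ^+ m * Num.sqrt (q w))).
  apply: le_trans (qf m); rewrite ler_sqrt//.
  by rewrite /qsum (bigD1 i)//= lerDl; apply: sumr_ge0 => j _; exact: dot_ge0.
rewrite ler_wpM2r ?sqrtr_ge0// -[leLHS]mul1r ler_wpM2r ?exprn_ge0//.
by rewrite (@le_trans _ _ (4 * 1))//; [lra | rewrite ler_wpM2l// ME ler1n].
Qed.

End Descent.

Lemma ord_third n (i j : 'I_n) : (3 <= n)%N -> exists l : 'I_n, (l != i) && (l != j).
Proof.
move=> n3; have [e|/pred0Pn[l]] := boolP (pred0b [pred l | (l != i) && (l != j)]); last by exists l.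
exfalso; have : (#|[set: 'I_n]%SET| <= #|[set i; j]%SET|)%N.
  apply: subset_leq_card; apply/fintype.subsetP => l _.
  by have /pred0P/(_ l) := e; rewrite !inE/= => /negbT; rewrite negb_and !negbK.
by rewrite cardsT card_ord cards2 => /(leq_trans n3); case: (i != j).
Qed.

Section RootGap.
Variables (R : realType) (H : hilb R) (n : nat) (W : 'I_n * 'I_n -> set H) (eta : R).
Hypothesis n3 : (3 <= n)%N.
Hypothesis W_sub : forall p, subspace (W p).
Hypothesis W_comm : forall i j l m, i != j -> l != m -> j != l -> m != i ->
  forall v, proj (W (i, j)) (proj (W (l, m)) v) = proj (W (l, m)) (proj (W (i, j)) v).
Hypothesis W_nonneg : forall i j l z, i != j -> j != l -> i != l -> W (i, l) z ->
  0 <= dot (z - proj (W (i, j)) z) (z - proj (W (j, l)) z).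
Hypothesis W_orth : forall i j l u v, i != j -> j != l -> i != l ->
  W (i, j) u -> (forall z, W (i, l) z -> dot u z = 0) -> W (j, l) v ->
  `|dot u v| <= eta * (hn u * hn v).
Hypothesis eta_small : 0 <= eta <= (6 * n%:R ^+ 4)^-1.

Let A (p : 'I_n * 'I_n) := p.1 != p.2.
Local Notation F p v := (coproj (W p) v).
Local Notation x p v := (dot (F p v) (F p v)).

Let eta1 : eta <= 1.
Proof.
case/andP: eta_small => _ /le_trans; apply.
rewrite invf_le1; last by rewrite mulr_gt0// exprn_gt0// ltr0n (leq_trans _ n3).
have : 1 <= n%:R ^+ 4 :> R by rewrite exprn_ege1// ler1n (leq_trans _ n3).
by lra.
Qed.

Let n0 : (0 < n)%N. Proof. exact: leq_trans n3. Qed.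

Let commF i j l m v : i != j -> l != m -> j != l -> m != i ->
  dot (F (i, j) v) (F (l, m) v) = x (i, j) (F (l, m) v).
Proof.
move=> ij lm jl mi; rewrite -projF_dot// -[RHS]addr0.
set w := F (l, m) v; have {1}-> : F (i, j) v = F (i, j) w + F (i, j) (proj (W (l, m)) v).
  by rewrite -coprojD// [w]coprojE subrK.
rewrite dotDl; congr (_ + _).
have -> : F (i, j) (proj (W (l, m)) v) = proj (W (l, m)) (F (i, j) v).
  by rewrite !coprojE projB// W_comm.
by rewrite dotC [w]coprojE proj_orth//; exact: proj_in.
Qed.

(** The projections to W (i, j) and W (j, l) commute with that to W (i, l), so both projections of u
    stay orthogonal to W (i, l), and [W_orth] makes them nearly orthogonal to each other.
    Cauchy-Schwarz for u and their sum gives the first bound. *)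
Let pq i j l v : i != j -> j != l -> i != l ->
  let u := F (i, l) v in
  dot (proj (W (i, j)) u) (proj (W (i, j)) u) +
  dot (proj (W (j, l)) u) (proj (W (j, l)) u) <= (1 + eta) * dot u u /\
  `|dot (proj (W (i, j)) u) (proj (W (j, l)) u)| <= eta * dot u u.
Proof.
move=> ij jl il u; have /andP[e0 _] := eta_small.
have uperp z : W (i, l) z -> dot u z = 0 by move=> Wz; rewrite /u coprojE proj_orth.
set p := proj (W (i, j)) u; set q := proj (W (j, l)) u.
have pperp z : W (i, l) z -> dot p z = 0.
  move=> Wz; rewrite dot_proj// uperp// -(proj_id _ Wz)// W_comm// 1?eq_sym//.
  exact: proj_in.
have o : `|dot p q| <= eta * (hn p * hn q) by apply: (W_orth ij jl il) => //; exact: proj_in.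
have hp : hn p <= hn u by exact: hn_proj.
have hq : hn q <= hn u by exact: hn_proj.
have up : dot u p = dot p p by rewrite dotC dot_projl.
have uq : dot u q = dot q q by rewrite dotC dot_projl.
split; last first.
  apply: le_trans o _; rewrite ler_wpM2l// -[leRHS]hn_sqr expr2.
  by rewrite ler_pM ?hn_ge0.
rewrite -!hn_sqr; move: o up uq (hn_ge0 p) (hn_ge0 q) (hn_ge0 u).
have := CauchySchwarz u (p + q); rewrite dotDl !dotDr (dotC q p) => cs o up uq.
rewrite up uq -!hn_sqr in cs.
move: cs o; set a := hn p; set b := hn q; set c := hn u; set d := dot p q => cs o a0 b0 c0.
have d1 : 2 * d <= eta * (a ^+ 2 + b ^+ 2).
  have := ler_norm d; have : 2 * (a * b) <= a ^+ 2 + b ^+ 2 by have := sqr_ge0 (a - b); nra.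
  by nra.
have := sqr_ge0 c; have := sqr_ge0 a; have := sqr_ge0 b.
set S := a ^+ 2 + b ^+ 2 in d1 cs *; move=> b2 a2 c2.
have [S0|S0] := leP S 0; first by apply: le_trans S0 _; rewrite mulr_ge0// addr_ge0.
rewrite -(ler_pM2l S0); apply: (@le_trans _ _ (c ^+ 2 * (S + 2 * d))).
  by apply: le_trans _ (le_trans cs _); rewrite /S; nra.
by nra.
Qed.

(** Split v = u + z, z being the projection to W (i, l). The cross terms vanish and the part from z
    is nonnegative by [W_nonneg]. The part from u is |u|^2 - |p|^2 - |q|^2 + <p, q> for the two
    projections p and q of u, and each estimate of [pq] costs one eta. *)
Let comp_ge i j l v : i != j -> j != l -> i != l ->
  - (2 * eta) * x (i, l) v <= dot (F (i, j) v) (F (j, l) v).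
Proof.
move=> ij jl il; have [pq1 pq2] := pq v ij jl il.
set u := F (i, l) v in pq1 pq2 *; set z := proj (W (i, l)) v.
have vE : v = u + z by rewrite /u coprojE subrK.
have Wz : W (i, l) z by exact: proj_in.
have FE p : F p v = F p z + F p u by rewrite [in LHS]vE coprojD// addrC.
rewrite !FE dotDl !dotDr.
have uperp w : W (i, l) w -> dot u w = 0 by move=> Ww; rewrite /u coprojE proj_orth.
have FW a b w : i != b -> a != l -> a != b -> W (i, l) w -> W (i, l) (F (a, b) w).
  move=> ib al ab Ww; rewrite coprojE; apply: subB => //.
  by rewrite -(proj_id _ Ww)// W_comm// 1?eq_sym//; exact: proj_in.
have Fperp a b w : i != b -> a != l -> a != b -> W (i, l) w -> dot (F (a, b) u) w = 0.
  move=> ib al ab Ww; rewrite projF_dot// dotC -projF_dot// dotC.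
  by rewrite uperp//; exact: FW.
have -> : dot (F (i, j) z) (F (j, l) u) = 0 by rewrite dotC Fperp//; exact: FW.
have -> : dot (F (i, j) u) (F (j, l) z) = 0 by rewrite Fperp//; apply: FW.
have := W_nonneg ij jl il Wz; rewrite -!coprojE => h0; rewrite addr0 add0r.
suff : - (2 * eta) * dot u u <= dot (F (i, j) u) (F (j, l) u) by lra.
rewrite !coprojE dotBl !dotBr (dotC u (proj (W (j, l)) u)) !(dot_projl _ _ u)//.
by have := ler_norm (- dot (proj (W (i, j)) u) (proj (W (j, l)) u)); rewrite normrN; lra.
Qed.

(** The source of the gap: u = F (i, l) v cannot be mostly contained in both spaces, so the two
    products together return nearly all of |u|^2. This surplus pays for the opposite root, with
    which no relation is available. *)
Let gain i j l v : i != j -> j != l -> i != l ->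
  (1 - eta) * x (i, l) v <= dot (F (i, l) v) (F (i, j) v) + dot (F (i, l) v) (F (j, l) v).
Proof.
move=> ij jl il; have [pq1 _] := pq v ij jl il.
rewrite (dotC (F (i, l) v) (F (i, j) v)) (dotC _ (F (j, l) v)).
have ji : j != i by rewrite eq_sym.
have li : l != i by rewrite eq_sym.
have lj : l != j by rewrite eq_sym.
rewrite (commF v ij il ji li) (commF v jl il li lj); set u := F (i, l) v in pq1 *.
have xE p : x p u = dot u u - dot (proj (W p) u) (proj (W p) u).
  by rewrite (pythagoras (W_sub p) u) coprojE addrAC subrr add0r.
by rewrite !xE; lra.
Qed.

Local Notation X v := (qsum A W v).

Let X_ge p v : A p -> x p v <= X v.
Proof.
by move=> Ap; rewrite /qsum (bigD1 p)//= lerDl; apply: sumr_ge0 => q _; exact: dot_ge0.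
Qed.

Let X_ge0 v : 0 <= X v. Proof. by apply: sumr_ge0 => p _; exact: dot_ge0. Qed.

Let lower i j p v : i != j -> A p -> p != (j, i) ->
  - (2 * eta) * X v <= dot (F (i, j) v) (F p v).
Proof.
have /andP[e0 _] := eta_small.
have big r : A r -> - (2 * eta) * X v <= - (2 * eta) * x r v.
  by move=> Ar; rewrite !mulNr lerN2 ler_wpM2l ?mulr_ge0// X_ge.
have neg : - (2 * eta) * X v <= 0 by rewrite mulNr oppr_le0 !mulr_ge0.
case: p => l m ij; rewrite /A/= => lm; rewrite xpair_eqE negb_and => neq.
have [jl|jl] := eqVneq j l.
  rewrite -{}jl eqxx /= in lm neq *; apply: le_trans (big (i, m) _) _; first by rewrite /A/= eq_sym.
  by apply: comp_ge => //; rewrite eq_sym.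
have [mi|mi] := eqVneq m i.
  rewrite {}mi in lm *; apply: le_trans (big (l, j) _) _; first by rewrite /A/= eq_sym.
  by rewrite dotC; apply: comp_ge => //; rewrite eq_sym.
by apply: le_trans neg _; rewrite (commF v ij lm jl mi) dot_ge0.
Qed.

(** The coefficient 3 / 2 - eta is 1 from the diagonal term, 1 - eta from [gain] through a third
    index, and - 1 / 2 from the opposite root, where only <a, b> >= - (|a|^2 + |b|^2) / 2 is used.
    Every other term costs at most 2 eta X. *)
Let row_ge i j v : i != j ->
  (3 / 2 - eta) * x (i, j) v - x (j, i) v / 2 - n%:R ^+ 2 * (2 * eta * X v) <=
  \sum_(p | A p) dot (F (i, j) v) (F p v).
Proof.
move=> ij; have [l /andP[li lj]] := ord_third i j n3.
have /andP[e0 _] := eta_small.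
have il : i != l by rewrite eq_sym.
rewrite (bigD1 (i, j))//= (bigD1 (j, i))/=; last by rewrite /A/= eq_sym ij xpair_eqE negb_and eq_sym ij.
rewrite (bigD1 (i, l))/=; last first.
  by rewrite /A/= !xpair_eqE (negPf lj) (negPf ij) il andbF.
rewrite (bigD1 (l, j))/=; last first.
  by rewrite /A/= !xpair_eqE (negPf li) (negPf lj) ?andbF.
have op : - (x (i, j) v + x (j, i) v) / 2 <= dot (F (i, j) v) (F (j, i) v).
  have := dot_ge0 (F (i, j) v + F (j, i) v).
  by rewrite dotDl !dotDr (dotC (F (j, i) v) (F (i, j) v)); lra.
have g := gain v il lj ij.
set rest := \sum_(p | _) _.
suff : - (n%:R ^+ 2 * (2 * eta * X v)) <= rest by lra.
apply: (@le_trans _ _ (\sum_(p | [&& A p, p != (i, j), p != (j, i), p != (i, l) & p != (l, j)]) - (2 * eta) * X v)).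
  rewrite sumr_const mulNr mulNrn lerN2 -[leLHS]mulr_natl ler_wpM2r ?mulr_ge0//.
  rewrite -natrX ler_nat; apply: leq_trans (max_card _) _.
  by rewrite card_prod card_ord.
rewrite [leRHS](eq_bigl [pred p | [&& A p, p != (i, j), p != (j, i), p != (i, l) & p != (l, j)]]).
  by apply: ler_sum => p /and5P[Ap _ pji _ _]; exact: lower.
by move=> p /=; rewrite -!andbA.
Qed.

(** Summing [row_ge] over at most n^2 roots leaves (1 - eta - 2 eta n^4) X; for eta <= 1 / (6 n^4)
    the losses are at most 1 / 6 and 1 / 3. *)
Lemma root_gap v : 2^-1 * X v <= dot (Dsum A W v) (Dsum A W v).
Proof.
have /andP[e0 e1] := eta_small.
have -> : dot (Dsum A W v) (Dsum A W v) = \sum_(r | A r) \sum_(p | A p) dot (F r v) (F p v).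
  by rewrite {1}/Dsum dot_suml; apply: eq_bigr => r _; rewrite /Dsum dot_sumr.
apply: (@le_trans _ _ (\sum_(r | A r) ((3 / 2 - eta) * x r v - x (r.2, r.1) v / 2 -
    n%:R ^+ 2 * (2 * eta * X v)))); last first.
  by apply: ler_sum => -[i j] ij; exact: row_ge.
rewrite !sumrB -mulr_sumr -mulr_suml sumr_const -[Z in _ <= _ - Z]mulr_natl.
have -> : \sum_(r | A r) x (r.2, r.1) v = X v.
  rewrite /qsum [RHS](reindex_inj (h := fun p : 'I_n * 'I_n => (p.2, p.1))) /=; last first.
    by move=> [a b] [c d] [-> ->].
  by apply: eq_bigl => r; rewrite /A/= eq_sym.
rewrite -/(X v).
have cA : #|A|%:R <= n%:R ^+ 2 :> R.
  by rewrite -natrX ler_nat; apply: leq_trans (max_card _) _; rewrite card_prod card_ord.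
have X0 := X_ge0 v.
have n1 : 1 <= n%:R :> R by rewrite ler1n.
have n4 : 1 <= n%:R ^+ 4 :> R by rewrite exprn_ege1.
have : #|A|%:R * (n%:R ^+ 2 * (2 * eta * X v)) <= n%:R ^+ 4 * (2 * eta * X v).
  rewrite (_ : n%:R ^+ 4 * _ = n%:R ^+ 2 * (n%:R ^+ 2 * (2 * eta * X v))); last by ring.
  by rewrite ler_wpM2r// !mulr_ge0.
have en : eta * n%:R ^+ 4 <= 6^-1.
  by move: e1; rewrite invfM ler_pdivlMr// (lt_le_trans ltr01).
have : eta <= eta * n%:R ^+ 4 by rewrite ler_peMr.
set N4 := n%:R ^+ 4 in en *; set C := _ * (_ * _) => en' h.
have : N4 * (2 * eta * X v) <= 3^-1 * X v.
  by rewrite !mulrA ler_wpM2r//; lra.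
have : eta * X v <= 6^-1 * X v by rewrite ler_wpM2r//; lra.
by lra.
Qed.

End RootGap.

(** * Elementary matrices *)

Section Elementary.
Variable n : nat.
Local Notation G := (SL int n).
Implicit Types (i j l m c : 'I_n) (a b : int) (g h : G).

Definition elmx i j a : 'M[int]_n := 1%:M + a *: delta_mx i j.

Lemma det_elmx i j a : i != j -> \det (elmx i j a) = 1.
Proof.
have low (k l : 'I_n) : (l < k)%N -> \det (elmx k l a) = 1.
  move=> lk; rewrite det_trig.
    rewrite big1// => r _; rewrite !mxE eqxx; case: eqP => [->|_]; last by rewrite mulr0 addr0.
    by case: eqP => [e|]; [rewrite e ltnn in lk | rewrite mulr0 addr0].
  apply/is_trig_mxP => r s rs; rewrite !mxE.
  have -> : (r == s) = false by apply/negbTE; rewrite neq_ltn rs.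
  rewrite add0r; case: eqP => [e1|_]; last by rewrite mulr0.
  case: eqP => [e2|_]; last by rewrite mulr0.
  by move: rs; rewrite e1 e2 => /(ltn_trans lk); rewrite ltnn.
move=> ij; have [ij'|ji|/val_inj e] := ltngtP i j; last by rewrite e eqxx in ij.
  rewrite -det_tr -(low j i ij'); congr (\det _).
  by rewrite /elmx linearD linearZ/= tr_scalar_mx trmx_delta.
exact: low.
Qed.

(** For i = j the determinant is 1 + a, and the default value of [insubd] makes the result 1. *)
Definition el i j a : G := insubd (1%g : G) (elmx i j a).

Lemma el_val i j a : i != j -> val (el i j a) = elmx i j a.
Proof. by move=> ij; rewrite val_insubd det_elmx// eqxx. Qed.

Lemma SL_mulE g h : val (g * h)%g = val g *m val h. Proof. by []. Qed.
Lemma SL_oneE : val (1%g : G) = 1%:M. Proof. by []. Qed.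

Lemma elmx_mul i j a l m b : elmx i j a *m elmx l m b =
  1%:M + a *: delta_mx i j + b *: delta_mx l m + (a * b) *: (delta_mx i m *+ (j == l)).
Proof.
rewrite /elmx mulmxDl !mulmxDr !mul1mx mulmx1 -scalemxAl -scalemxAr scalerA.
rewrite mul_delta_mx_cond -!addrA; congr (_ + _).
by rewrite addrC -!addrA; congr (_ + _); rewrite addrC.
Qed.

Lemma el_add i j a b : i != j -> (el i j a * el i j b)%g = el i j (a + b).
Proof.
move=> ij; apply: val_inj; rewrite SL_mulE !el_val// elmx_mul.
by rewrite eq_sym (negPf ij) mulr0n scaler0 addr0 -addrA -scalerDl.
Qed.

Lemma el0 i j : i != j -> el i j 0 = 1%g.
Proof. by move=> ij; apply: val_inj; rewrite el_val// /elmx scale0r addr0. Qed.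

Lemma el_inv i j a : i != j -> (el i j a)^-1%g = el i j (- a).
Proof.
by move=> ij; apply: (mulgI (el i j a)); rewrite mulgV el_add// subrr el0.
Qed.

Lemma el_exp i j a k : i != j -> (el i j a ^+ k)%g = el i j (a *+ k).
Proof.
move=> ij; elim: k => [|k IH]; first by rewrite mulr0n el0.
by rewrite expgS IH el_add// mulrS.
Qed.

Lemma el_commute i j a l m b : i != j -> l != m -> j != l -> m != i ->
  commute (el i j a) (el l m b).
Proof.
move=> ij lm jl mi; apply: val_inj; rewrite !SL_mulE !el_val// !elmx_mul.
by rewrite (negPf jl) (negPf mi) !mulr0n !scaler0 !addr0 addrAC.
Qed.

Lemma el_heis i j l a b : i != j -> j != l -> i != l ->
  (el i j a ^ el j l b = el i l (a * b) * el i j a)%g.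
Proof.
move=> ij jl il; rewrite conjgE; apply: (mulgI (el j l b)); rewrite mulVKg.
apply: val_inj; rewrite !SL_mulE !el_val// !elmx_mul eqxx (eq_sym l i) (negPf il).
rewrite mulr0n scaler0 addr0 mulr1n {1}/elmx mulmxDl mul1mx -scalemxAl !mulmxDr mulmx1.
rewrite -!scalemxAr !mul_delta_mx_cond !(eq_sym l i) (negPf il) !mulr0n !scaler0 !addr0.
by rewrite -addrA (addrC (_ *: _) (_ *: _)) !addrA (addrAC _ _ (a *: _)) addrAC.
Qed.

Lemma el_heisV i j l a b : i != j -> j != l -> i != l ->
  (el j l b ^ el i j a = el i l (- (a * b)) * el j l b)%g.
Proof.
move=> ij jl il; rewrite conjgE; apply: (mulgI (el i j a)); rewrite mulVKg.
have := el_heis a b ij jl il; rewrite conjgE => /(congr1 (fun x => el j l b * x)%g).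
rewrite mulVKg => E.
have c1 : commute (el i l (- (a * b))) (el j l b) by apply: el_commute => //; rewrite eq_sym.
have c2 : commute (el i j a) (el i l (- (a * b))) by apply: el_commute => //; rewrite eq_sym.
by rewrite mulgA c2 -mulgA E mulgA c1 -mulgA (mulgA _ _ (el i j a)) el_add// addNr el0// mul1g.
Qed.

Lemma row_op i j a g r c : i != j ->
  val (el i j a * g)%g r c = val g r c + (r == i)%:R * (a * val g j c).
Proof.
move=> ij; rewrite SL_mulE el_val// /elmx mulmxDl mul1mx mxE -scalemxAl !mxE.
congr (_ + _); rewrite (bigD1 j)//= big1 => [|k kj]; last by rewrite !mxE (negPf kj) andbF mul0r.
by rewrite !mxE eqxx andbT addr0; case: (r == i); rewrite /= ?(mul0r, mul1r, mulr0).
Qed.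

Lemma col_op i j a g r c : i != j ->
  val (g * el i j a)%g r c = val g r c + (c == j)%:R * (val g r i * a).
Proof.
move=> ij; rewrite SL_mulE el_val// /elmx mulmxDr mulmx1 mxE -scalemxAr !mxE.
congr (_ + _); rewrite (bigD1 i)//= big1 => [|k kj]; last by rewrite !mxE (negPf kj) mulr0.
rewrite !mxE eqxx addr0 /=; case: (c == j); rewrite /= ?(mul0r, mul1r, mulr0)//.
by rewrite mulr1 mulrC.
Qed.

Lemma row_ops (s : seq 'I_n) c (u : 'I_n -> int) g r d : c \notin s -> uniq s ->
  val ((\prod_(l <- s) el l c (u l)) * g)%g r d =
  val g r d + (r \in s)%:R * (u r * val g c d).
Proof.
elim: s r => [|l s IH] r; first by rewrite big_nil mul1g mul0r addr0.
rewrite inE negb_or cons_uniq => /andP[cl cs] /andP[ls us].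
rewrite big_cons -mulgA row_op 1?eq_sym// !IH// (negPf cs) mul0r addr0 inE.
by have [->|rl] := eqVneq r l; rewrite ?(negPf ls) /= ?mul0r ?mul1r ?addr0.
Qed.

Lemma col_ops (s : seq 'I_n) c (u : 'I_n -> int) g r d : c \notin s -> uniq s ->
  val (g * \prod_(l <- s) el c l (u l))%g r d =
  val g r d + (d \in s)%:R * (val g r c * u d).
Proof.
elim: s g => [|l s IH] g; first by rewrite big_nil mulg1 mul0r addr0.
rewrite inE negb_or cons_uniq => /andP[cl cs] /andP[ls us].
rewrite big_cons mulgA IH// !col_op// (negPf cl) mul0r addr0 inE.
by have [->|rl] := eqVneq d l; rewrite ?(negPf ls) /= ?mul0r ?mul1r ?addr0 ?mulr0 ?addr0.
Qed.

Section Euclid.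
Variables (K : set G) (B : pred 'I_n) (p c : 'I_n).
Hypotheses (sgK : is_subgroup K) (Bp : B p).
Hypothesis KB : forall i j, i != j -> B i -> B j -> K (el i j 1).

Lemma subgroup_el i j a : K (el i j 1) -> i != j -> K (el i j a).
Proof.
have [K1 KM KV] := sgK.
move=> Kij ij; have pos (k : nat) : K (el i j k%:Z).
  elim: k => [|k IH]; first by rewrite el0.
  by rewrite -addn1 PoszD -el_add//; exact: KM.
case: a => k; first exact: pos.
by rewrite NegzE -el_inv//; apply: KV; exact: pos.
Qed.

(** The Euclidean algorithm on column [c], measured by the sum of absolute values over the rows in
    [B]. [K] may be any subgroup containing the row operations used, so it can carry invariants that
    these operations must respect. *)
Lemma euclid g : exists2 h, K h & forall i, B i -> i != p -> val (h * g)%g i c = 0.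
Proof.
have [K1 KM KV] := sgK.
have [N] := ubnP (\sum_(i | B i) `|val g i c|%N); elim: N g => // N IH g /ltnSE gN.
have step i j a : i != j -> B i -> B j -> (`|(val g i c + a * val g j c)%R| < `|val g i c|)%N ->
    exists2 h, K h & forall i, B i -> i != p -> val (h * g)%g i c = 0.
  move=> ij Bi Bj lt.
  have [|h Kh hP] := IH (el i j a * g)%g.
    apply: leq_trans gN; rewrite (bigD1 i)//= [in X in (_ <= X)%N](bigD1 i)//=.
    rewrite row_op// eqxx mul1r -addSn leq_add// eq_leq//.
    by apply: eq_bigr => k /andP[_ ki]; rewrite row_op// (negPf ki) mul0r addr0.
  exists (h * el i j a)%g; first by apply: KM => //; apply: subgroup_el => //; exact: KB.
  by move=> k Bk kp; rewrite -mulgA hP.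
have [/existsP[i /existsP[j /and5P[ij Bi Bj gi gj]]]|no] :=
    boolP [exists i, exists j, [&& i != j, B i, B j, val g i c != 0 & val g j c != 0]].
  wlog le : i j ij Bi Bj gi gj / (`|val g j c| <= `|val g i c|)%N.
    move=> W; case: (leqP `|val g j c| `|val g i c|) => [|/ltnW] le.
      exact: (W i j).
    by apply: (W j i) => //; rewrite eq_sym.
  apply: (step i j (if (0 <= val g i c) == (0 <= val g j c) then -1 else 1) ij Bi Bj).
  move: gi gj le; move: (val g i c : int) (val g j c : int) => x y.
  by case hx: (0 <= x); case hy: (0 <= y) => /=; lia.
have uniq0 i j : B i -> B j -> i != j -> val g i c != 0 -> val g j c = 0.
  move=> Bi Bj ij gi; apply/eqP; move: no; rewrite negb_exists => /forallP/(_ i).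
  by rewrite negb_exists => /forallP/(_ j); rewrite ij Bi Bj gi/= negbK.
have [/existsP[i /and3P[Bi ip gi]]|no'] := boolP [exists i, [&& B i, i != p & val g i c != 0]]; last first.
  exists 1%g => // i Bi ip; rewrite mul1g; apply/eqP.
  by move: no'; rewrite negb_exists => /forallP/(_ i); rewrite Bi ip negbK.
have pi : p != i by rewrite eq_sym.
(* The one surviving entry sits in row i: it is copied to row p and then subtracted from row i. *)
exists (el i p (-1) * el p i 1)%g.
  by apply: KM; apply: subgroup_el => //; exact: KB.
move=> k Bk kp; rewrite -mulgA row_op// !row_op// eqxx (negPf kp) mul0r addr0 !mul1r.
rewrite (uniq0 i p)// add0r; case: eqP => [->|/eqP ki]; first by rewrite mul1r mulN1r subrr.
by rewrite mul0r addr0 (uniq0 i k)// eq_sym.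
Qed.

End Euclid.

Section Generation.
Variable K : set G.
Hypothesis sgK : is_subgroup K.
Hypothesis K_el : forall i j, i != j -> K (el i j 1).

Let blk (m : nat) g := forall i j, (m <= i)%N || (m <= j)%N -> val g i j = (i == j)%:R.

Let Kop (h h' g : G) : K h -> K h' -> K (h * g * h')%g -> K g.
Proof.
have [K1 KM KV] := sgK => Kh Kh' Kg.
rewrite (_ : g = h^-1 * (h * g * h') * h'^-1)%g; last by rewrite !mulgA mulVg mul1g mulgK.
by apply: (KM); [apply: (KM)|]; rewrite ?Kg//; exact: KV.
Qed.

(** Induction on the size of the upper left block outside which [g] is the identity. [euclid] leaves
    one entry u in the last column of the block; the determinant forces u^2 = 1, two row operations
    put a 1 on the diagonal, and column operations clear the last row. *)
Lemma SL_gen g : K g.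
Proof.
have [K1 KM KV] := sgK.
suff main (m : nat) : forall g, blk m g -> K g.
  by apply: (main n) => i j /orP[|]; rewrite leqNgt ltn_ord.
elim: m => [|m IH] {}g bg.
  rewrite (_ : g = 1%g)//; apply/val_inj/matrixP => i j.
  by rewrite bg// SL_oneE mxE.
have [nm|mn] := leqP n m; first by apply: IH => i j /orP[|]; rewrite leqNgt (leq_trans (ltn_ord _) nm).
pose q := Ordinal mn.
have Kel i j a : i != j -> K (el i j a) by move=> ij; apply: subgroup_el => //; exact: K_el.
have [m0|m_gt0] := posnP m.
  (* a 1x1 block is the determinant *)
  apply: IH => i j; rewrite m0 !leq0n => _.
  have [iq|iq] := eqVneq i q; have [jq|jq] := eqVneq j q.
  - rewrite iq jq eqxx; have : \det (val g)^T = 1 by rewrite det_tr; exact: (eqP (valP g)).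
    rewrite det_trig => [|]; last first.
      apply/is_trig_mxP => r s rs; rewrite mxE bg; last by rewrite m0 (leq_trans _ rs) ?orbT.
      by rewrite -val_eqE/= eq_sym; move: rs; case: eqP => // ->; rewrite ltnn.
    rewrite (bigD1 q)//= mxE big1 ?mulr1// => r rq.
    rewrite mxE bg ?eqxx// m0 orbb lt0n; apply: contra rq => /eqP r0.
    by rewrite -val_eqE/= r0 m0.
  - by rewrite bg// m0 (_ : (0 < j)%N) ?orbT// lt0n; apply: contra jq => /eqP j0; rewrite -val_eqE/= j0 m0.
  - by rewrite bg// m0 (_ : (0 < i)%N)// lt0n; apply: contra iq => /eqP i0; rewrite -val_eqE/= i0 m0.
  - by rewrite bg// m0 (_ : (0 < i)%N)// lt0n; apply: contra iq => /eqP i0; rewrite -val_eqE/= i0 m0.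
pose p := Ordinal (leq_trans m_gt0 (ltnW mn)).
have pq : p != q by rewrite -val_eqE/= neq_ltn m_gt0.
have qp : q != p by rewrite eq_sym.
have blk_el i j a h : i != j -> (i <= m)%N -> (j <= m)%N -> blk m.+1 h -> blk m.+1 (el i j a * h)%g.
  move=> ij im jm bh r s rs; rewrite row_op// bh//.
  have [ri|_] := eqVneq r i; last by rewrite mul0r addr0.
  have ms : (m < s)%N by move: rs; rewrite ri ltnNge im.
  rewrite bh ?ms ?orbT//; have /negPf-> : j != s by rewrite -val_eqE/= neq_ltn (leq_ltn_trans jm ms).
  by rewrite mulr0 mulr0 addr0.
pose K' := [set h | K h /\ forall g, blk m.+1 g <-> blk m.+1 (h * g)%g].
have sgK' : is_subgroup K'.
  split; first by split=> // g'; rewrite mul1g.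
    move=> x y [Kx bx] [Ky bY]; split=> [|g']; first exact: KM.
    by rewrite -mulgA -bx -bY.
  by move=> x [Kx bx]; split=> [|g']; [exact: KV | rewrite (bx (x^-1 * g')%g) mulVKg].
have [|h [Kh bh] hz] := @euclid K' [pred i : 'I_n | (i <= m)%N] p q sgK' (leq0n _) _ g.
  move=> i j ij im jm; split=> [|g']; first exact: K_el.
  split; first exact: blk_el.
  by move=> /(blk_el i j (-1) _ ij im jm); rewrite -el_inv// mulKg.
have {bg} bg := (bh g).1 bg; apply: (Kop Kh K1); rewrite mulg1.
move: (h * g)%g bg hz => {h Kh bh}{}g bg gz.
have [u2 up] : val g p q * val g p q = 1 /\ True.
  split=> //; have := eqP (valP g); rewrite (expand_det_col _ q) (bigD1 p)//= big1 => [|i ip].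
    rewrite addr0 => /(congr1 absz)/eqP; rewrite abszM muln_eq1 => /andP[/eqP g1 _].
    by rewrite -expr2 -[LHS]gez0_abs ?sqr_ge0// abszX g1.
  have [im|im] := leqP i m; first by rewrite gz ?mul0r.
  by rewrite bg ?im// -val_eqE/= gtn_eqF ?mul0r.
set u := val g p q in u2.
apply: (Kop (h := (el p q (- u) * el q p u)%g) (h' := 1%g)) => //; first by apply: (KM); exact: Kel.
have : blk m.+1 (el p q (- u) * (el q p u * g))%g.
  by apply: (blk_el) => //; apply: (blk_el).
rewrite mulg1 -mulgA; set g2 := (_ * _)%g => b2.
have g2q i : val g2 i q = (i == q)%:R.
  have [im|im] := leqP i m; last by apply: b2; rewrite im.
  rewrite !row_op// eqxx mul1r -/u u2 (gz q)//= add0r !mulr1.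
  have [->|ip] := eqVneq i p; first by rewrite (negPf pq) mul1r addr0 addrN.
  by rewrite mul0r addr0 gz// add0r.
pose s := [seq j <- enum 'I_n | (nat_of_ord j < m)%N].
have qs : q \notin s by rewrite mem_filter ltnn.
have us : uniq s by rewrite filter_uniq// enum_uniq.
pose w := (\prod_(j <- s) el q j (- val g2 q j))%g.
have Kw : K w.
  rewrite /w big_seq; apply: (big_ind K) => // j.
  by rewrite mem_filter => /andP[jm _]; apply: Kel; rewrite -val_eqE/= gtn_eqF.
apply: (Kop K1 Kw); rewrite mul1g; apply: IH => i j ij.
rewrite /w col_ops// mem_filter mem_enum andbT g2q.
have [im|mi|im] := ltngtP i m.
- have mj : (m <= j)%N by move: ij; rewrite leqNgt im.
  have /negPf-> : i != q by rewrite -val_eqE/= ltn_eqF.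
  rewrite mul0r mulr0 addr0; have [jq|jq] := eqVneq j q.
    by rewrite jq g2q.
  rewrite b2// [X in _ || X]ltn_neqAle mj andbT orbC; apply/orP; left.
  by apply: contra jq => /eqP mj2; rewrite -val_eqE/= -mj2.
- have /negPf-> : i != q by rewrite -val_eqE/= gtn_eqF.
  by rewrite mul0r mulr0 addr0 b2 ?mi.
- have -> : i = q by exact: val_inj.
  rewrite eqxx mul1r; have [jm|mj|jm] := ltngtP j m.
  + by rewrite mul1r subrr -val_eqE/= gtn_eqF.
  + by rewrite mul0r addr0 b2 ?mj ?orbT.
  + by rewrite mul0r addr0 (_ : j = q) ?g2q //; exact: val_inj.
Qed.

End Generation.

End Elementary.

(** * Normal subgroups of finite index *)

Section Dietzmann.
Variables (G : groupType) (K : set G).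
Hypotheses (sgK : is_subgroup K) (nK : forall x y, K x -> K (x ^ y)%g).
Implicit Types (x y s t : G) (w : seq G).
Local Open Scope group_scope.

Definition eqmod x y := K (x^-1 * y).

Let K1 : K 1. Proof. by case: sgK. Qed.
Let KM x y : K x -> K y -> K (x * y). Proof. by case: sgK => _ + _; apply. Qed.
Let KV x : K x -> K x^-1. Proof. by case: sgK => _ _; apply. Qed.

Lemma eqmod_refl x : eqmod x x. Proof. by rewrite /eqmod mulVg. Qed.
Lemma eqmod_sym x y : eqmod x y -> eqmod y x.
Proof. by move=> /KV; rewrite /eqmod invgM invgK. Qed.
Lemma eqmod_trans y x z : eqmod x y -> eqmod y z -> eqmod x z.
Proof. by move=> xy yz; have := KM xy yz; rewrite mulgA mulgK. Qed.
Lemma eqmodM x x' y y' : eqmod x x' -> eqmod y y' -> eqmod (x * y) (x' * y').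
Proof.
move=> xx yy; have := KM (nK y xx) yy.
by rewrite /eqmod conjgE invgM !mulgA mulgK.
Qed.
Lemma eqmodJ x x' y : eqmod x x' -> eqmod (x ^ y) (x' ^ y).
Proof. by move=> xx; rewrite /eqmod -conjVg -conjMg; exact: nK. Qed.

Lemma eqmod_coset x y : eqmod x y ->
  [set x * h | h in K] = [set y * h | h in K].
Proof.
move=> xy; apply/seteqP; split=> _ [h Kh <-].
  by exists (y^-1 * x * h); rewrite ?mulgA ?mulgV ?mul1g//; apply: KM => //; exact: eqmod_sym.
by exists (x^-1 * y * h); rewrite ?mulgA ?mulgV ?mul1g//; exact: KM.
Qed.

Variables (S : seq G) (q : nat).
Hypothesis q_gt0 : (0 < q)%N.
Hypothesis Sq : forall s, s \in S -> K (s ^+ q).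
Hypothesis SJ : forall s t, s \in S -> t \in S -> exists2 s', s' \in S & eqmod (s ^ t) s'.
Hypothesis Sgen : forall x, exists2 w, {subset w <= S} & eqmod x (\prod_(s <- w) s).

Let conj_word s w : s \in S -> {subset w <= S} ->
  exists w', [/\ {subset w' <= S}, size w' = size w &
    eqmod ((\prod_(t <- w) t) * s) (s * \prod_(t <- w') t)].
Proof.
move=> sS; elim: w => [|a w IH] wS.
  by exists [::]; split => //; rewrite !big_nil mul1g mulg1; exact: eqmod_refl.
have [w' [w'S w'w e]] := IH (fun t tw => wS t (mem_behead (s := a :: w) tw)).
have [a' a'S e'] := SJ (wS a (mem_head _ _)) sS.
exists (a' :: w'); split => [t||]; last 2 first.
- by rewrite /= w'w.
- rewrite !big_cons; apply: eqmod_trans (_ : eqmod _ (a * (s * \prod_(t <- w') t))) _.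
    by rewrite -mulgA; apply: eqmodM e; exact: eqmod_refl.
  rewrite mulgA (conjgC a s) -mulgA; apply: eqmodM; first exact: eqmod_refl.
  by apply: eqmodM => //; exact: eqmod_refl.
by rewrite inE => /orP[/eqP ->|/w'S].
Qed.

Let pull s m w : s \in S -> {subset w <= S} -> (m <= count_mem s w)%N ->
  exists w', [/\ {subset w' <= S}, (size w' + m = size w)%N &
    eqmod (\prod_(t <- w) t) (s ^+ m * \prod_(t <- w') t)].
Proof.
move=> sS; elim: m w => [|m IH] w wS cw.
  by exists w; split; rewrite ?addn0// expg0 mul1g; exact: eqmod_refl.
have sw : s \in w by rewrite -has_pred1 has_count (leq_trans _ cw).
have [u [v [ew su]]] : exists u v, w = u ++ s :: v /\ count_mem s u = 0%N.
  elim: w sw {wS cw} => // a w IHw; rewrite inE; have [<- _|sa /= sw] := eqVneq s a.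
    by exists [::], w.
  have [u [v [-> su]]] := IHw sw; exists (a :: u), v.
  by rewrite /= su eq_sym (negPf sa).
have uS : {subset u <= S} by move=> t tu; apply: wS; rewrite ew mem_cat tu.
have vS : {subset v <= S} by move=> t tv; apply: wS; rewrite ew mem_cat inE tv !orbT.
have [u' [u'S u'u e]] := conj_word sS uS.
have [||w' [w'S w'w e']] := IH (u' ++ v).
- by move=> t; rewrite mem_cat => /orP[/u'S|/vS].
- by move: cw; rewrite ew !count_cat su /= eqxx add0n add1n ltnS => /leq_trans; apply; exact: leq_addl.
exists w'; split => //; first by rewrite addnS w'w ew !size_cat u'u /= addnS.
rewrite ew big_cat big_cons /= mulgA; apply: eqmod_trans (_ : eqmod _ (s * \prod_(t <- u' ++ v) t)) _.
  by rewrite big_cat mulgA; apply: eqmodM => //; exact: eqmod_refl.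
by rewrite expgS -mulgA; apply: eqmodM => //; exact: eqmod_refl.
Qed.

Let sum_count w : {subset w <= S} -> (size w <= \sum_(s <- S) count_mem s w)%N.
Proof.
elim: w => // a w IH wS; rewrite /= big_split/= -add1n leq_add ?IH//.
  rewrite (perm_big _ (perm_to_rem (wS a (mem_head _ _)))) big_cons eqxx.
  exact: leq_addr.
by move=> t tw; apply: wS; rewrite inE tw orbT.
Qed.

(** A word longer than |S| q contains some letter at least q times. Its copies are collected in
    front at the price of conjugating other letters, which stay in [S] modulo [K]; there q of them
    vanish, as s^q lies in [K]. *)
Let short w : {subset w <= S} ->
  exists w', [/\ {subset w' <= S}, (size w' <= size S * q)%N &
    eqmod (\prod_(t <- w) t) (\prod_(t <- w') t)].
Proof.
have [m] := ubnP (size w); elim: m w => // m IH w /ltnSE wm wS.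
have [wL|Lw] := leqP (size w) (size S * q).
  by exists w; split => //; exact: eqmod_refl.
have /hasP[s sS sw] : has (fun s => q <= count_mem s w)%N S.
  apply: contraLR Lw => /hasPn no; rewrite -leqNgt.
  apply: leq_trans (sum_count wS) _; rewrite -[size S]sum1_size big_distrl/=.
  rewrite big_seq [leqRHS]big_seq; apply: leq_sum => s /no; rewrite -ltnNge mul1n.
  exact: ltnW.
have [w1 [w1S w1w e]] := pull sS wS sw.
have [|w' [w'S w'L e']] := IH w1 _ w1S.
  by apply: leq_trans wm; rewrite -w1w -addn1 leq_add2l.
exists w'; split => //; apply: eqmod_trans e _; rewrite -[X in eqmod _ X]mul1g.
by apply: eqmodM => //; rewrite /eqmod mulg1; apply: KV; exact: Sq.
Qed.

(** Dietzmann's lemma relative to [K]: by [short], words of length at most |S| q represent every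
    coset. *)
Lemma dietzmann : finite_index K.
Proof.
pose P := fix P m := if m is m'.+1 then
  [set p.1 * p.2 | p in [set` 1 :: S] `*` P m'] else [set 1].
have finP m : finite_set (P m).
  by elim: m => [|m IH] /=; [exact: finite_set1|apply: finite_image; apply: finite_setX => //; exact: finite_seq].
have wP m w : {subset w <= S} -> (size w <= m)%N -> P m (\prod_(t <- w) t).
  elim: m w => [|m IH] w wS; first by rewrite leqn0 size_eq0 => /eqP ->; rewrite big_nil.
  case: w wS => [|a w] wS wm.
    exists (1, 1); rewrite /= ?big_nil ?mul1g//; split; rewrite /= ?mem_head//.
    by have := IH [::]; rewrite big_nil; apply.
  exists (a, \prod_(t <- w) t); rewrite /= ?big_cons//; split.
    by rewrite /= inE wS ?orbT// mem_head.
  by apply: IH => // t tw; apply: wS; rewrite inE tw orbT.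
apply: (@sub_finite_set _ _ [set [set x * h | h in K] | x in P (size S * q)%N]).
  move=> _ [x _ <-]; have [w wS e] := Sgen x; have [w' [w'S w'L e']] := short wS.
  exists (\prod_(t <- w') t); first exact: wP.
  by apply/eqmod_coset/eqmod_sym; exact: eqmod_trans e e'.
exact: finite_image.
Qed.

End Dietzmann.

Lemma intr_Zp_eq0 (q : nat) (x : int) : (1 < q)%N ->
  x%:~R = 0 :> 'Z_q -> exists y : int, x = y * q%:Z.
Proof.
move=> q1; have q0 : q%:Z != 0 by case: q q1.
rewrite [in x%:~R](divz_eq x q%:Z) intrD intrM.
have -> : q%:Z%:~R = 0 :> 'Z_q by rewrite -pmulrn pchar_Zp.
rewrite mulr0 add0r => e; exists (x %/ q%:Z)%Z.
rewrite [LHS](divz_eq x q%:Z); move: e; rewrite -[(x %% q%:Z)%Z]gez0_abs ?modz_ge0//.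
rewrite -pmulrn => /(congr1 val); rewrite /= val_Zp_nat// modn_small => [->|].
  by rewrite addr0.
by rewrite -ltz_nat gez0_abs ?modz_ge0// ltz_mod.
Qed.

(** * Congruence elements modulo a normal subgroup *)

Section Congruence.
Variables (n q : nat).
Hypotheses (n3 : (3 <= n)%N) (q1 : (1 < q)%N).
Local Notation G := (SL int n).
Implicit Types (g h k x y : G) (i j c : 'I_n).

Definition redmx g : 'M['Z_q]_n := map_mx intr (val g).

Lemma redmxM g h : redmx (g * h)%g = redmx g *m redmx h.
Proof. by rewrite /redmx SL_mulE map_mxM. Qed.
Lemma redmx1 : redmx 1%g = 1%:M.
Proof. by rewrite /redmx SL_oneE map_mx1. Qed.

Definition congr_sub : set G := [set g | redmx g = 1%:M].

Lemma redmx_eq g h : redmx g = redmx h -> congr_sub (g * h^-1)%g.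
Proof. by move=> e; rewrite /congr_sub/= redmxM e -redmxM mulgV redmx1. Qed.

Lemma congr_subV g : congr_sub g -> congr_sub g^-1%g.
Proof.
by move=> e; have := redmxM g (g^-1)%g; rewrite mulgV redmx1 e mul1mx => e'; rewrite /congr_sub/= -e'.
Qed.
Lemma congr_subM g h : congr_sub g -> congr_sub h -> congr_sub (g * h)%g.
Proof. by rewrite /congr_sub/= redmxM => -> ->; rewrite mul1mx. Qed.
Lemma congr_subJ g h : congr_sub g -> congr_sub (g ^ h)%g.
Proof.
rewrite /congr_sub/= conjgE !redmxM => ->.
by rewrite mul1mx -redmxM mulVg redmx1.
Qed.

Lemma congr_entry g i j : congr_sub g -> exists y : int, val g i j = (i == j)%:R + y * q%:Z.
Proof.
move=> /matrixP/(_ i j); rewrite !mxE => e.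
have [|y yE] := @intr_Zp_eq0 q (val g i j - (i == j)%:R) q1.
  by rewrite intrB e; case: (i == j); rewrite subrr.
by exists y; rewrite -yE addrC subrK.
Qed.

Lemma congr_el i j a : i != j -> congr_sub (el i j (a * q%:Z)).
Proof.
move=> ij; apply/matrixP => r s; rewrite !mxE el_val// !mxE intrD !intrM.
have -> : q%:Z%:~R = 0 :> 'Z_q by rewrite -pmulrn pchar_Zp.
by rewrite mulr0 mul0r addr0; case: (r == s).
Qed.

Variable K : set G.
Hypotheses (sgK : is_subgroup K) (nK : forall x y, K x -> K (x ^ y)%g).
Hypothesis KG : K `<=` congr_sub.
Hypothesis K_el : forall i j a, i != j -> K (el i j (a * q%:Z)).

Let KM x y : K x -> K y -> K (x * y)%g. Proof. by case: sgK => _ + _; apply. Qed.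
Local Notation "x ~~ y" := (eqmod K x y) (at level 70).
Let rf x : x ~~ x. Proof. exact: eqmod_refl. Qed.

Let central g := forall h, (g * h)%g ~~ (h * g)%g.

Let central_eqmod g g' : g ~~ g' -> central g' -> central g.
Proof.
move=> gg cg h; apply: (eqmod_trans sgK) (eqmodM sgK nK gg (rf h)) _.
by apply: (eqmod_trans sgK) (cg h) _; apply: (eqmodM sgK nK) => //; exact: eqmod_sym.
Qed.

Let eqmod_prod (s : seq 'I_n) (u v : 'I_n -> G) : (forall l, l \in s -> u l ~~ v l) ->
  (\prod_(l <- s) u l)%g ~~ (\prod_(l <- s) v l)%g.
Proof.
elim: s => [|a s IH] uv; first by rewrite !big_nil.
rewrite !big_cons; apply: (eqmodM sgK nK); first by apply: uv; rewrite mem_head.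
by apply: IH => l ls; apply: uv; rewrite inE ls orbT.
Qed.

Let el_eqmod i j (a b : int) : i != j -> el i j (a + b * q%:Z) ~~ el i j a.
Proof.
move=> ij; rewrite /eqmod el_inv// el_add//.
by rewrite (_ : _ + a = - b * q%:Z); [exact: K_el | ring].
Qed.

(** Since row c is trivial, g el_ic(1) = (prod_l el_lc(g_li)) g holds exactly, and as g_li is the
    Kronecker delta modulo q the product is el_ic(1) modulo [K]. The transposed identity handles
    el_ci(1), and commutators of the two kinds give the other generators. *)
Let block_central c g : congr_sub g ->
  (forall i, val g i c = (i == c)%:R) -> (forall i, val g c i = (c == i)%:R) -> central g.
Proof.
move=> Gg gc gr.
pose s := [seq l <- enum 'I_n | l != c].
have cs : c \notin s by rewrite mem_filter eqxx.
have us : uniq s by rewrite filter_uniq// enum_uniq.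
have mems l : (l \in s) = (l != c) by rewrite mem_filter mem_enum andbT.
pose Z := [set h | (g * h)%g ~~ (h * g)%g].
have sgZ : is_subgroup Z.
  split; first by rewrite /Z/= mulg1 mul1g.
    move=> x y zx zy; rewrite /Z/= mulgA.
    apply: (eqmod_trans sgK) (eqmodM sgK nK zx (rf y)) _; rewrite -!mulgA.
    exact: (eqmodM sgK nK).
  move=> x zx; have := eqmodM sgK nK (eqmodM sgK nK (rf x^-1%g) zx) (rf x^-1%g).
  by rewrite !mulgA mulVg mul1g mulgK => /(eqmod_sym sgK).
have Zc i : i != c -> Z (el i c 1).
  move=> ic.
  have e1 : (g * el i c 1 = (\prod_(l <- s) el l c (val g l i)) * g)%g.
    apply/val_inj/matrixP => r d; rewrite row_ops// col_op// mems mulr1 gr.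
    rewrite [d == c]eq_sym; have [->|rc] := eqVneq r c; last by rewrite mul1r mulrC.
    by rewrite !gr (eq_sym c i) (negPf ic) mulr0 mul0r.
  have e2 : el i c 1 = (\prod_(l <- s) el l c (l == i)%:R)%g.
    rewrite -[RHS]mulg1; apply/val_inj/matrixP => r d; rewrite row_ops// SL_oneE el_val// !mxE mems.
    have [->|rc] := eqVneq r c; first by rewrite (eq_sym c i) (negPf ic) /= mul0r mulr0.
    by rewrite mul1r [c == d]eq_sym; case: (r == i); case: (d == c).
  rewrite /Z/= e1 [in X in _ ~~ X]e2; apply: (eqmodM sgK nK) => //.
  apply: eqmod_prod => l; rewrite mems => lc.
  by have [y ->] := congr_entry l i Gg; exact: el_eqmod.
have Zr i : i != c -> Z (el c i 1).
  move=> ic; have ci : c != i by rewrite eq_sym.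
  have e1 : (el c i 1 * g = g * \prod_(l <- s) el c l (val g i l))%g.
    apply/val_inj/matrixP => r d; rewrite col_ops// row_op// mems mul1r gc.
    have [->|dc] := eqVneq d c; last by rewrite mul1r.
    by rewrite !gc (negPf ic) mulr0 mul0r.
  have e2 : el c i 1 = (\prod_(l <- s) el c l (l == i)%:R)%g.
    rewrite -[RHS]mul1g; apply/val_inj/matrixP => r d; rewrite col_ops// SL_oneE el_val// !mxE mems.
    have [->|dc] := eqVneq d c; first by rewrite (negPf ci) andbF mul0r mulr0.
    by rewrite mul1r; case: (r == c); case: (d == i); rewrite ?(mulr0, mul0r, mulr1).
  rewrite /Z/= e1 [in X in X ~~ _]e2; apply: (eqmodM sgK nK) => //.
  apply: (eqmod_sym sgK); apply: eqmod_prod => l; rewrite mems => lc.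
  by have [y ->] := congr_entry i l Gg; rewrite eq_sym; apply: el_eqmod; rewrite eq_sym.
have [_ ZM ZV] := sgZ.
apply: (SL_gen sgZ) => i j ij.
have [ic|ic] := eqVneq i c; first by rewrite ic; apply: Zr; rewrite -ic eq_sym.
have [->|jc] := eqVneq j c; first exact: Zc.
have cj : c != j by rewrite eq_sym.
have := el_heis 1 1 ic cj ij; rewrite mulr1 conjgE => /(congr1 (fun x => x * (el i c 1)^-1)%g).
rewrite mulgK => <-; apply: (ZM); last exact/ZV/Zc.
by apply: (ZM); [exact/ZV/Zr | apply: (ZM); [exact: Zc|exact: Zr]].
Qed.

(** Row c is cleared by column operations whose coefficients are divisible by q and which therefore
    lie in [K]. *)
Let col_central c g : congr_sub g -> (forall i, val g i c = (i == c)%:R) -> central g.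
Proof.
move=> Gg gc.
pose s := [seq l <- enum 'I_n | l != c].
have cs : c \notin s by rewrite mem_filter eqxx.
have us : uniq s by rewrite filter_uniq// enum_uniq.
have mems l : (l \in s) = (l != c) by rewrite mem_filter mem_enum andbT.
pose w := (\prod_(l <- s) el c l (- val g c l))%g.
have Kw : K w.
  rewrite /w big_seq; apply: (big_ind K) => [|x y|l]; [by case: sgK|exact: KM|].
  rewrite mems => lc; have [y ->] := congr_entry c l Gg.
  by rewrite eq_sym (negPf lc) add0r -mulNr; apply: K_el; rewrite eq_sym.
apply: (@central_eqmod g (g * w)%g); first by rewrite /eqmod mulKg.
apply: (@block_central c) => [|i|i]; first by apply: congr_subM => //; exact: KG.
  by rewrite col_ops// mems eqxx mul0r addr0 gc.
rewrite col_ops// mems gc eqxx mul1r.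
have [->|ic] := eqVneq i c; first by rewrite ?eqxx mul0r addr0 gc ?eqxx.
by rewrite mul1r subrr.
Qed.

Lemma congr_central g h : congr_sub g -> (g * h)%g ~~ (h * g)%g.
Proof.
move=> Gg; move: h; rewrite -/(central g).
pose c := Ordinal n3; pose a := Ordinal (ltnW n3 : (1 < n)%N); pose b := Ordinal (ltnW (ltnW n3) : (0 < n)%N).
have ac : a != c by []. have bc : b != c by []. have ba : b != a by [].
pose St := [set h : G | forall i, val h i c = (i == c)%:R /\ val h c i = (c == i)%:R].
have mulc h k i : (forall j, val k j c = (j == c)%:R) -> val (h * k)%g i c = val h i c.
  move=> kc; rewrite SL_mulE mxE (bigD1 c)//= kc eqxx mulr1 big1 ?addr0// => j jc.
  by rewrite kc (negPf jc) mulr0.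
have mulr_ h k i : (forall j, val h c j = (c == j)%:R) -> val (h * k)%g c i = val k c i.
  move=> hc; rewrite SL_mulE mxE (bigD1 c)//= hc eqxx mul1r big1 ?addr0// => j jc.
  by rewrite hc eq_sym (negPf jc) mul0r.
have sgSt : is_subgroup St.
  split=> [i|x y Sx Sy i|x Sx i].
  - by rewrite SL_oneE !mxE.
  - by rewrite mulc => [|j]; [rewrite mulr_ => [|j]; [split; [case: (Sx i)|case: (Sy i)]|case: (Sx j)]|case: (Sy j)].
  - split; first by rewrite -(mulc x^-1%g x) ?mulVg ?SL_oneE ?mxE// => j; case: (Sx j).
    by rewrite -(mulr_ x x^-1%g) ?mulgV ?SL_oneE ?mxE// => j; case: (Sx j).
(* Conjugation by a matrix whose row and column c are trivial acts on column c by row operations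
   alone. Afterwards only the entries at a and c can be nonzero. *)
have [|h Sth hP] := @euclid n St [pred i | i != c] a c sgSt ac _ g.
  move=> i j ij /= ic jc k; rewrite el_val// !mxE.
  rewrite [c == j]eq_sym (negPf jc) andbF mulr0 addr0.
  by rewrite [c == i]eq_sym (negPf ic) mulr0 addr0.
pose g1 := (h * g * h^-1)%g.
have Gg1 : congr_sub g1.
  by rewrite /g1 -[h in (h * g)%g]invgK -mulgA -conjgE; exact: congr_subJ.
have [St1 StM StV] := sgSt.
have g1c i : val g1 i c = val (h * g)%g i c by apply: mulc => j; case: (StV _ Sth j).
suff cg1 : central g1.
  apply: (@central_eqmod g g1 _ (cg1)); apply: (eqmod_sym sgK).
  apply: (eqmod_trans sgK (y := h^-1 * (g1 * h))%g); last by rewrite /g1 mulgVK mulKg.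
  apply: (eqmod_trans sgK (y := h^-1 * (h * g1))%g); first by rewrite mulKg.
  by apply: (eqmodM sgK nK) => //; apply: (eqmod_sym sgK); exact: cg1.
have g0 i : i != c -> i != a -> val g1 i c = 0 by move=> ic ia; rewrite g1c hP.
move: g1 Gg1 g0 {g1c hP Gg} => {}g Gg g0.
set d := val g a c; set e := val g c c.
have [al [be bez]] : exists al be : int, al * d + be * e = 1.
  exists (cofactor (val g) a c), (cofactor (val g) c c).
  have := eqP (valP g); rewrite (expand_det_col _ c) (bigD1 a)//= (bigD1 c)//= big1 => [|i /andP[ia ic]].
    by rewrite addr0 !(mulrC (cofactor _ _ _)).
  by rewrite g0// mul0r.
have [d' dE] := congr_entry a c Gg; have [e' eE] := congr_entry c c Gg.
rewrite -/d (negPf ac) add0r in dE; have {}eE : e = 1 + e' * q%:Z by rewrite /e eE eqxx.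
have xE : 1 - e = - e' * q%:Z by rewrite eE; ring.
have ca : c != a by []. have cb : c != b by []. have ab : a != b by [].
have K_el' i j (x y z : int) : i != j -> x = y * (z * q%:Z) -> K (el i j x).
  by move=> ij ->; rewrite mulrA; exact: K_el.
(* As al d + be e = 1, [k1] puts 1 - e into row b of column c. Adding row b to row c by [el c b 1]
   makes the diagonal entry 1, with which [k2] clears d and 1 - e; undoing the addition then changes
   nothing in this column. Both [k1] and [k2] lie in [K] because d and 1 - e are multiples of q. *)
pose k1 := (el b a ((1 - e) * al) * el b c ((1 - e) * be))%g.
pose k2 := (el a c (- d) * el b c (e - 1))%g.
have Kk1 : K k1.
  apply: KM.
    by apply: (@K_el' _ _ _ al (- e')) => //; rewrite xE; ring.
  by apply: (@K_el' _ _ _ be (- e')) => //; rewrite xE; ring.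
have Kk2 : K k2.
  apply: KM.
    by apply: (@K_el' _ _ _ 1 (- d')) => //; rewrite dE; ring.
  by apply: (@K_el' _ _ _ 1 e') => //; rewrite eE; ring.
have Kk : K (k2 ^ el c b 1 * k1)%g by apply: KM => //; exact: nK.
apply: (@central_eqmod g (k2 ^ el c b 1 * k1 * g)%g).
  by rewrite /eqmod -conjgE; exact: nK.
apply: (@col_central c) => [|i]; first by apply: congr_subM => //; exact: KG.
rewrite /k2 /k1 conjgE el_inv// -!mulgA !row_op//.
rewrite -/d -/e !eqxx !(negPf ac, negPf bc, negPf ba, negPf ca, negPf cb, negPf ab).
rewrite !(mul0r, mul1r, addr0, add0r) (g0 b)//.
have -> : (1 - e) * al * d = (1 - e) - (1 - e) * be * e.
  by rewrite -mulrA (_ : al * d = 1 - be * e); [ring | rewrite -bez addrK].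
have [f0 t1] : false%:R = 0 :> int /\ true%:R = 1 :> int by [].
have [->|ic] := eqVneq i c; first by rewrite (negPf cb) (negPf ca) -/e f0 t1; ring.
have [->|ia] := eqVneq i a; first by rewrite (negPf ab) -/d f0 t1; ring.
have [->|ib] := eqVneq i b; first by rewrite (g0 b)// f0 t1; ring.
by rewrite (g0 i)// f0; ring.
Qed.

End Congruence.

(** Congruence elements are central modulo [L], the congruence part of [K], so a conjugate of
    el_ij(1) modulo [L] depends only on the conjugator modulo q. These conjugates are finite in
    number, have q-th powers in [L] and generate, so [dietzmann] applies. *)
Lemma SL_finite_index (n q : nat) (K : set (SL int n)) : (3 <= n)%N -> (0 < q)%N ->
  is_subgroup K -> (forall x y, K x -> K (x ^ y)%g) ->
  (forall i j : 'I_n, i != j -> K (el i j q%:Z)) -> finite_index K.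
Proof.
move=> n3 q0 sgK nK Kel.
(* ['Z_q] is the ring of integers modulo q only for q > 1. *)
wlog q1 : q q0 Kel / (1 < q)%N.
  move=> W; apply: (W (q * 2)%N) => [|i j ij|]; [by rewrite muln_gt0 q0| |lia].
  rewrite muln2 -addnn PoszD -el_add//; have [_ KM _] := sgK.
  by apply: KM; exact: Kel.
pose L := K `&` congr_sub (n := n) q.
have [K1 KM KV] := sgK.
have sgL : is_subgroup L.
  split=> [|x y [Kx cx] [Ky cy]|x [Kx cx]].
  - by split => //; rewrite /congr_sub/= redmx1.
  - by split; [exact: KM | exact: congr_subM].
  - by split; [exact: KV | exact: congr_subV].
have nL x y : L x -> L (x ^ y)%g by move=> [Kx cx]; split; [exact: nK | exact: congr_subJ].
have L_el i j a : i != j -> L (el i j (a * q%:Z)).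
  move=> ij; split; last exact: congr_el.
  have pos (k : nat) : K (el i j (k%:Z * q%:Z)).
    elim: k => [|k IH]; first by rewrite mul0r el0.
    by rewrite -addn1 PoszD mulrDl mul1r -el_add//; apply: KM => //; exact: Kel.
  case: a => k; first exact: pos.
  by rewrite NegzE mulNr -el_inv//; exact: KV.
have Lq i j : i != j -> L (el i j (1 *+ q)).
  by move=> ij; rewrite pmulrn intz -[Posz q]mul1r; exact: L_el.
have cL g h : congr_sub q g -> eqmod L (g * h)%g (h * g)%g.
  by move=> cg; apply: congr_central cg => //; move=> x [].
pose sec (r : 'M['Z_q]_n) := xget 1%g [set g | redmx q g = r].
have secP g : redmx q (sec (redmx q g)) = redmx q g.
  by rewrite /sec; case: xgetP => [h _ //|no]; case: (no g).
pose e (p : 'I_n * 'I_n) := if p.1 != p.2 then el p.1 p.2 1 else 1%g.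
pose S := [seq (e x.1 ^ sec x.2)%g | x <- enum {: ('I_n * 'I_n) * 'M['Z_q]_n}].
have eS p g : exists2 s, s \in S & eqmod L (e p ^ g)%g s.
  exists (e p ^ sec (redmx q g))%g.
    by apply/mapP; exists (p, redmx q g) => //; rewrite mem_enum.
  have cg : congr_sub q (g * (sec (redmx q g))^-1)%g by apply: redmx_eq; rewrite secP.
  rewrite -[X in (e p ^ X)%g](mulgVK (sec (redmx q g))) conjgM; apply: eqmodJ => //.
  move: (g * _)%g cg => h ch; have := cL h (e p) ch => /(eqmod_sym sgL) hc.
  rewrite conjgE; apply: (eqmod_trans sgL) (eqmodM sgL nL (eqmod_refl sgL h^-1%g) hc) _.
  by rewrite mulKg; exact: eqmod_refl.
have finL : finite_index L.
  apply: (@dietzmann _ L sgL nL S q) => //.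
  - move=> _ /mapP[[p r] _ ->] /=; rewrite -conjXg; apply: nL; rewrite /e.
    case: ifP => pp; last by rewrite expg1n; case: sgL.
    by rewrite el_exp//; exact: Lq.
  - by move=> _ t /mapP[[p r] _ ->] _ /=; rewrite -conjgM; exact: eS.
  pose Z := [set x : SL int n | exists2 w, {subset w <= S} & eqmod L x (\prod_(s <- w) s)%g].
  have ZM x y : Z x -> Z y -> Z (x * y)%g.
    move=> [w wS xw] [w' w'S yw]; exists (w ++ w').
      by move=> t; rewrite mem_cat => /orP[/wS|/w'S].
    by rewrite big_cat; exact: eqmodM.
  have ZS s : s \in S -> Z s.
    move=> sS; exists [:: s]; last by rewrite big_seq1; exact: eqmod_refl.
    by move=> t; rewrite inE => /eqP ->.
  have Z1 : Z 1%g by exists [::] => //; rewrite big_nil; exact: eqmod_refl.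
  have Ze x y : eqmod L x y -> Z y -> Z x.
    by move=> xy [w wS yw]; exists w => //; exact: (eqmod_trans sgL) xy yw.
  have ZVS s : s \in S -> Z s^-1%g.
    move=> sS; apply: (Ze _ (s ^+ q.-1)%g).
      rewrite /eqmod invgK -expgS prednK//; move: sS => /mapP[[p r] _ ->] /=.
      rewrite -conjXg; apply: nL; rewrite /e.
      case: ifP => pp; last by rewrite expg1n; case: sgL.
      by rewrite el_exp//; exact: Lq.
    by elim: (q.-1) => [|m IH]; rewrite ?expg0// expgS; apply: ZM => //; exact: ZS.
  have sgZ : is_subgroup Z.
    split => // x [w wS xw]; apply: (Ze _ (\prod_(s <- w) s)^-1%g).
      rewrite /eqmod invgK; have := nL _ x^-1%g (eqmod_sym sgL xw).
      by rewrite conjgE invgK !mulgA mulgK.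
    elim: w wS {xw} => [|s w IH] wS; first by rewrite big_nil invg1.
    rewrite big_cons invgM; apply: ZM; first by apply: IH => t tw; apply: wS; rewrite inE tw orbT.
    by apply: ZVS; apply: wS; rewrite mem_head.
  move=> x; apply: (SL_gen sgZ) => i j ij; have [s sS] := eS (i, j) 1%g.
  by rewrite conjg1 /e/= ij => /Ze; apply; exact: ZS.
have cosets : finite_set [set [set x * h | h in K]%g | x in [set: SL int n]].
  apply: sub_finite_set (finite_image (fun A : set (SL int n) =>
    [set y | exists2 x, A x & eqmod K x y]) finL).
  move=> _ [x _ <-]; exists [set x * h | h in L]%g; first by exists x.
  apply/seteqP; split=> y.
    move=> [_ [h [Kh _] <-] xy]; exists (x^-1 * y)%g; last by rewrite mulVKg.
    have := KM _ _ Kh xy; by rewrite invgM !mulgA mulgV mul1g.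
  move=> [h Kh <-]; exists x; last by rewrite /eqmod mulKg.
  by exists 1%g; [case: sgL | rewrite mulg1].
exact: cosets.
Qed.

(** * Almost invariant vectors *)

Lemma near_inf (R : realType) (X : Type) (F : X -> R) (b e : R) (x : X) :
  (forall x, b <= F x) -> 0 < e -> exists x0, forall x, F x0 <= F x + e.
Proof.
move=> bF e0; have hF : has_inf (range F).
  by split; [exists (F x); exists x | exists b => _ [y _ <-]].
have [_ [x0 _ <-] lt0] := inf_adherent e0 hF.
exists x0 => y; apply: (le_trans (ltW lt0)); rewrite lerD2r.
by apply: ge_inf; [case: hF|exists y].
Qed.

(** Averaging over m < N the sum over all [p], so that one m serves every p at once. *)
Lemma pick_small (R : realType) (I : finType) (A : pred I) (x : I -> nat -> R) (N : nat) (B : R) :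
  (0 < N)%N -> (forall p m, A p -> 0 <= x p m) -> 0 <= B ->
  (forall p, A p -> \sum_(m < N) x p m <= B) ->
  exists m : nat, forall p, A p -> x p m <= #|I|%:R * B / N%:R.
Proof.
move=> N0 x0 B0 xB.
have S : \sum_(m < N) \sum_(p | A p) x p m <= #|I|%:R * B.
  rewrite exchange_big /=; apply: (@le_trans _ _ (\sum_(p : I | A p) B)); first exact: ler_sum.
  by rewrite sumr_const -[B *+ _]mulr_natl ler_wpM2r// ler_nat; exact: max_card.
have N0' : (0 : R) < N%:R by rewrite ltr0n.
have [m mS] : exists m : 'I_N, \sum_(p | A p) x p m <= #|I|%:R * B / N%:R.
  apply: contrapT => /forallNP no; move: S; apply/negP; rewrite -ltNge.
  apply: (@le_lt_trans _ _ (\sum_(m < N) (#|I|%:R * B / N%:R))).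
    by rewrite sumr_const card_ord -[(_ / _) *+ _]mulr_natr divfK// pnatr_eq0 -lt0n.
  have i0 : 'I_N by exists 0%N.
  rewrite [ltLHS](bigD1 i0)//= [ltRHS](bigD1 i0)//=; apply: ltr_leD.
    by rewrite ltNge; apply/negP; exact: no.
  by apply: ler_sum => i _; rewrite leNgt; apply/negP => /ltW; exact: no.
exists m => p Ap; apply: le_trans mS; rewrite (bigD1 p)//= lerDl.
by apply: sumr_ge0 => q /andP[Aq _]; exact: x0.
Qed.

Lemma bessel_arith (R : realDomainType) (x y z t b eps : R) :
  b - eps - z <= t -> t <= eps -> x <= b + 2 * eps -> x = z + y -> y <= 4 * eps.
Proof. by lra. Qed.

Lemma nsq_proj (R : realType) (H : hilb R) (W : set H) (sW : subspace W) v :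
  dot (proj W v) (proj W v) <= dot v v.
Proof. by rewrite [leRHS](pythagoras sW) lerDl dot_ge0. Qed.

Section Conjugators.
Variable n : nat.
Implicit Types (i j r c l : 'I_n).

Lemma el_expn i j (m : nat) : i != j -> (el i j 1 ^+ m)%g = el i j m%:Z.
Proof. by move=> ij; rewrite el_exp// natz. Qed.

Lemma conj_col (s : seq 'I_n) r c j m : uniq s -> c \notin s -> r != c -> r != j ->
  (el r j 1 ^ (\prod_(l <- s) el l c m) = (if j \in s then el r c m else 1) * el r j 1)%g.
Proof.
move=> + + rc rj; elim: s => [|l s IH] /=; first by rewrite big_nil conjg1 mul1g.
rewrite inE negb_or big_cons conjgM => /andP[ls us] /andP[cl cs].
have [jl|jl] := eqVneq j l.
  subst l; have jc : j != c by rewrite eq_sym.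
  rewrite el_heis// mul1r conjMg IH// (negPf ls) mul1g inE eqxx /=; congr (_ * _)%g.
  elim: s {us ls IH} cs => [|l s IH]; first by rewrite big_nil conjg1.
  rewrite inE negb_or big_cons conjgM => /andP[cl' cs].
  rewrite (@commute_conj _ _ (el l c m)) ?IH//; apply: el_commute => //; by rewrite eq_sym.
by rewrite (@commute_conj _ _ (el l c m)) ?IH ?inE ?(negPf jl)//; apply: el_commute; rewrite // eq_sym.
Qed.

Lemma conj_row (s : seq 'I_n) r i j m : uniq s -> r \notin s -> i != j -> j != r ->
  (el i j 1 ^ (\prod_(l <- s) el r l (- m)) = (if i \in s then el r j m else 1) * el i j 1)%g.
Proof.
move=> + + ij jr; elim: s => [|l s IH] /=; first by rewrite big_nil conjg1 mul1g.
rewrite inE negb_or big_cons conjgM => /andP[ls us] /andP[rl rs].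
have [il|il] := eqVneq i l.
  subst l; rewrite el_heisV//; last by rewrite eq_sym.
  rewrite mulr1 opprK conjMg IH// (negPf ls) mul1g inE eqxx /=; congr (_ * _)%g.
  elim: s {us ls IH} rs => [|l s IH]; first by rewrite big_nil conjg1.
  rewrite inE negb_or big_cons conjgM => /andP[rl' rs].
  rewrite (@commute_conj _ _ (el r l (- m))) ?IH//; apply: el_commute => //; by rewrite eq_sym.
by rewrite (@commute_conj _ _ (el r l (- m))) ?IH ?inE ?(negPf il)//; apply: el_commute; rewrite // eq_sym.
Qed.

End Conjugators.

Section TorsionVector.
Variables (R : realType) (n : nat) (H : hilb R) (pi : hrep (SL int n) H).
Hypothesis n3 : (3 <= n)%N.
Variables (v : H) (b eps : R) (N : nat).
Local Notation k := (N`!).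
Local Notation P x := (proj (tors pi k x)).
Local Notation E i j := (P (el i j 1)).
Local Notation nsq u := (dot u u).
Hypotheses (N0 : (0 < N)%N) (eps0 : 0 < eps)
  (NE : (n ^ 2)%:R * nsq v / N%:R <= eps).
Hypothesis lower : forall g (i j : 'I_n), i != j -> b - eps <= nsq (E i j (pi g v)).
Implicit Types (i j r c l : 'I_n) (g : SL int n).

Let k0 : (0 < k)%N. Proof. exact: fact_gt0. Qed.
Let kdvd m : (0 < m < N)%N -> (m %| k)%N.
Proof. by case/andP=> m0 mN; rewrite dvdn_fact// m0 ltnW. Qed.
Let sub x := tors_sub pi k x.

Lemma nsq_conj x g u : nsq (P (x ^ g)%g u) = nsq (P x (pi g u)).
Proof. by rewrite projJ// hact_dot. Qed.

Let NE1 : nsq v / N%:R <= eps.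
Proof.
apply: le_trans NE; rewrite -mulrA ler_peMl//; first by rewrite divr_ge0// dot_ge0.
by rewrite ler1n expn_gt0; lia.
Qed.

Let nsq_orbit g : nsq (pi g v) = nsq v. Proof. exact: hact_dot. Qed.

(** The part common to el_rj(1) and el_rc(1) has squared norm at most b, being a projection of the
    vector controlled by hypothesis. For a suitable m the excess over it for el_rj(1) el_rc(1)^m is
    at most n |v|^2 / N <= eps for every j, and translating by [h] turns el_rj(1) into that
    element. *)
Lemma spread_col r c g0 : r != c -> nsq (E r c (pi g0 v)) <= b ->
  exists g, forall j, j != r -> nsq (E r j (pi g v)) <= b + eps.
Proof.
move=> rc bb; set u := pi g0 v in bb.
pose C j := E r j (E r c u).
pose x j (m : nat) := nsq (P (el r j 1 * el r c 1 ^+ m)%g u) - nsq (C j).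
pose A j := (j != r) && (j != c).
have cm j : j != r -> commute (el r j 1) (el r c 1).
  by move=> jr; apply: el_commute; rewrite // eq_sym.
have [m mx] : exists m : nat, forall j, A j -> x j m <= #|'I_n|%:R * nsq v / N%:R.
  apply: pick_small => //.
  - by move=> j m /andP[jr _]; have [+ _] := tors_bessel pi u (cm _ jr) kdvd; apply.
  - exact: dot_ge0.
  - move=> j /andP[jr _]; rewrite -(nsq_orbit g0).
    by have [_ +] := tors_bessel pi u (cm _ jr) kdvd; apply.
pose h := (\prod_(l <- enum A) el l c m%:Z)%g.
exists (h * g0)%g => j jr; rewrite hactM -/u -nsq_conj.
have cA : c \notin enum A by rewrite mem_enum -[_ \in _]/(A c) /A eqxx andbF.
rewrite conj_col ?enum_uniq// 1?eq_sym// mem_enum -[_ \in _]/(A j).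
have nC : nsq (C j) <= b.
  by apply: le_trans bb; exact: nsq_proj (sub _) _.
case: ifPn => Aj.
  rewrite -el_expn// -(commuteX _ (cm _ jr)).
  have := mx _ Aj; rewrite /x card_ord => xm.
  have : n%:R * nsq v / N%:R <= eps.
    apply: le_trans NE; rewrite ler_wpM2r ?invr_ge0// ler_wpM2r ?dot_ge0//.
    by rewrite ler_nat -[leqLHS]expn1 leq_pexp2l// (leq_trans _ n3).
  move=> le_eps; rewrite -[leLHS](subrK (nsq (C j))) addrC lerD//.
  exact: le_trans xm le_eps.
move: Aj; rewrite /A jr /= negbK => /eqP ->; rewrite mul1g.
by apply: (le_trans bb); rewrite lerDl ltW.
Qed.

(** Each root (i, j) inherits the bound from (r, j) in its column. Column r is not reached, since
    (r, r) is no root. *)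
Lemma spread_row r g0 : (forall j, j != r -> nsq (E r j (pi g0 v)) <= b + eps) ->
  exists g, forall i j, i != j -> j != r -> nsq (E i j (pi g v)) <= b + 2 * eps.
Proof.
move=> bb; set u := pi g0 v in bb.
pose C (p : 'I_n * 'I_n) := E p.1 p.2 (E r p.2 u).
pose x p (m : nat) := nsq (P (el p.1 p.2 1 * el r p.2 1 ^+ m)%g u) - nsq (C p).
pose A (p : 'I_n * 'I_n) := [&& p.1 != r, p.2 != r & p.1 != p.2].
have cm i j : i != j -> j != r -> commute (el i j 1) (el r j 1).
  by move=> ij jr; apply: el_commute; rewrite // eq_sym.
have [m mx] : exists m : nat, forall p, A p -> x p m <= #|{: 'I_n * 'I_n}|%:R * nsq v / N%:R.
  apply: pick_small => //.
  - by move=> p m /and3P[_ jr ij]; have [+ _] := tors_bessel pi u (cm _ _ ij jr) kdvd; apply.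
  - exact: dot_ge0.
  - move=> p /and3P[_ jr ij]; rewrite -(nsq_orbit g0).
    by have [_ +] := tors_bessel pi u (cm _ _ ij jr) kdvd; apply.
pose h := (\prod_(l <- enum (predC1 r)) el r l (- m%:Z))%g.
exists (h * g0)%g => i j ij jr; rewrite hactM -/u -nsq_conj.
have rA : r \notin enum (predC1 r) by rewrite mem_enum inE /= eqxx.
have rj : r != j by rewrite eq_sym.
rewrite conj_row ?enum_uniq// mem_enum inE /=.
case: ifPn => [ir|]; last first.
  rewrite negbK mul1g => /eqP ->; apply: (le_trans (bb _ jr)).
  by move: eps0; lra.
have nC : nsq (C (i, j)) <= b + eps.
  by apply: le_trans (bb _ jr); exact: nsq_proj (sub _) _.
rewrite -el_expn// -(commuteX _ (cm _ _ ij jr)).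
have Aij : A (i, j) by rewrite /A /= ir jr ij.
have := mx _ Aij; rewrite /x /= card_prod card_ord => xm.
have -> : b + 2 * eps = (b + eps) + eps by lra.
rewrite -[leLHS](subrK (nsq (C (i, j)))) addrC lerD//.
by apply: le_trans xm _; rewrite mulnn.
Qed.

Section Near.
Variables (r : 'I_n) (u : H) (g : SL int n).
Hypothesis uE : u = pi g v.
Hypothesis good : forall i j, i != j -> j != r -> nsq (E i j u) <= b + 2 * eps.

(* By Bessel, [P (x * y ^+ m) u] cannot be large for all [m < N] unless its common part
   [P x (P y u)] is almost as large. *)
Lemma bessel_pair x y : commute x y -> (forall m, b - eps <= nsq (P (x * y ^+ m)%g u)) ->
  nsq (P x u) <= b + 2 * eps -> nsq (P x u - P y (P x u)) <= 4 * eps.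
Proof.
move=> xy low up; have [_ +] := tors_bessel pi u xy kdvd.
set C := nsq (P x (P y u)) => S.
have : N%:R * (b - eps - C) <= nsq v.
  rewrite uE nsq_orbit in S; apply: le_trans S.
  have -> : N%:R * (b - eps - C) = \sum_(m < N) (b - eps - C).
    by rewrite sumr_const card_ord mulr_natl.
  apply: ler_sum => m _.
  by rewrite lerD2r -uE; exact: low.
rewrite mulrC -ler_pdivlMr ?ltr0n// => lowC.
have := pythagoras (sub y) (P x u).
rewrite -(tors_projC pi k u xy) -/C => pyt.
exact: bessel_arith lowC NE1 up pyt.
Qed.

(** The element el_ij(1) el_il(1)^m is a conjugate of el_ij(1), so [lower] applies to it for every
    m. Only (i, j) has to be good; l = r is allowed. *)
Lemma near_row i j l : i != j -> i != l -> j != r ->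
  nsq (E i j u - E i l (E i j u)) <= 4 * eps.
Proof.
move=> ij il jr; have [jl|jl] := eqVneq j l.
  by subst l; rewrite (proj_id (sub _) (projP (sub _) u).1) subrr dot0l mulr_ge0// ltW.
apply: bessel_pair; [|move=> m|exact: good].
  by apply: el_commute; rewrite // eq_sym.
have -> : (el i j 1 * el i l 1 ^+ m = el i j 1 ^ el j l m%:Z)%g.
  rewrite el_heis// mul1r el_expn//; apply: el_commute => //; by rewrite eq_sym.
by rewrite nsq_conj uE -hactM; exact: lower.
Qed.

Lemma near_col i j l : i != j -> l != j -> j != r ->
  nsq (E i j u - E l j (E i j u)) <= 4 * eps.
Proof.
move=> ij lj jr; have [il|il] := eqVneq i l.
  by subst l; rewrite (proj_id (sub _) (projP (sub _) u).1) subrr dot0l mulr_ge0// ltW.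
have li : l != i by rewrite eq_sym.
apply: bessel_pair; [|move=> m|exact: good].
  by apply: el_commute; rewrite // eq_sym.
have -> : (el i j 1 * el l j 1 ^+ m = el i j 1 ^ el l i (- m%:Z))%g.
  rewrite el_heisV// mulr1 opprK el_expn//; apply: el_commute => //; by rewrite eq_sym.
by rewrite nsq_conj uE -hactM; exact: lower.
Qed.

Let d : R := 2 * Num.sqrt eps.
Let hn_le (w : H) : nsq w <= 4 * eps -> hn w <= d.
Proof.
move=> w4; have e : Num.sqrt eps ^+ 2 = eps by rewrite sqr_sqrtr// ltW.
rewrite -(@ler_pXn2r _ 2)// ?nnegrE ?sqrtr_ge0//; last by rewrite mulr_ge0// sqrtr_ge0.
by rewrite hn_sqr exprMn e; apply: le_trans w4 _; lra.
Qed.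

Let adj x y : commute x y -> nsq (P x u - P y (P x u)) <= 4 * eps ->
  nsq (P y u - P x (P y u)) <= 4 * eps -> hn (P x u - P y u) <= 2 * d.
Proof.
move=> xy /hn_le d1 /hn_le d2; apply: (le_trans (hn_triangle (P x (P y u)) _ _)).
rewrite {1}(tors_projC pi k u xy) (hnB (P x (P y u))).
by apply: le_trans (lerD d1 d2) _; rewrite mulrDl mul1r.
Qed.

Let move_near x (z z' : H) (a a' : R) : hn (z - P x z) <= a -> hn (z' - z) <= a' ->
  hn (z' - P x z') <= a' + a.
Proof.
move=> za zc; apply: le_trans (proj_dist (sub x) z' (projP (sub x) z).1) _.
by apply: (le_trans (hn_triangle z _ _)); exact: lerD.
Qed.

(* Any root is reached from [(r, c)] through at most two adjacent good roots. *)
Lemma near_all c i j : r != c -> i != j ->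
  hn (E r c u - E i j (E r c u)) <= 5 * d.
Proof.
move=> rc ij; have cr : c != r by rewrite eq_sym.
have d0 : 0 <= d by rewrite mulr_ge0// sqrtr_ge0.
have adj_row i' j' l' : i' != j' -> i' != l' -> j' != r -> l' != r ->
    hn (E i' j' u - E i' l' u) <= 2 * d.
  move=> ij' il' jr lr; apply: adj; [|exact: near_row|exact: near_row].
  by apply: el_commute; rewrite // eq_sym.
have adj_col i' j' l' : i' != j' -> l' != j' -> j' != r ->
    hn (E i' j' u - E l' j' u) <= 2 * d.
  move=> ij' lj' jr; apply: adj; [|exact: near_col|exact: near_col].
  by apply: el_commute; rewrite // eq_sym.
have le1 x : x <= d -> x <= 5 * d by move=> xd; move: d0; lra.
have le3 x : x <= 2 * d + d -> x <= 5 * d by move=> xd; move: d0; lra.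
have [ir|ir] := eqVneq i r; first by subst i; apply/le1/hn_le; exact: near_row.
have ri : r != i by rewrite eq_sym.
have [jc|jc] := eqVneq j c; first by subst j; apply/le1/hn_le; exact: near_col.
have [ic|ic] := eqVneq i c; last first.
  by apply/le3/(move_near (hn_le _) (adj_col _ _ i _ _ _)) => //; exact: near_row.
subst i; have [jr|jr] := eqVneq j r; last first.
  have rj : r != j by rewrite eq_sym.
  by apply/le3/(move_near (hn_le _) (adj_row _ _ j _ _ _ _)) => //; exact: near_col.
subst j; have [l /andP[lr lc]] := ord_third r c n3.
have rl : r != l by rewrite eq_sym.
have cl : c != l by rewrite eq_sym.
have -> : 5 * d = (2 * d + 2 * d) + d by lra.
apply: (move_near (z := E c l u)); first by apply/hn_le/near_row.
by apply: (le_trans (hn_triangle (E r l u) _ _)); apply: lerD; [exact: adj_row|exact: adj_col].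
Qed.

End Near.

(** The descent starts at w = E r c u: by [near_all] each of at most n^2 terms of [qsum] is bounded
    by the square of 10 sqrt eps, while |w|^2 >= b - eps by [lower]. *)
Lemma torsion_vector_aux r c g0 : r != c -> nsq (E r c (pi g0 v)) <= b ->
  16 * ((n * n).+1%:R) ^+ 2 * ((n ^ 2)%:R * (100 * eps)) < b - eps ->
  (Num.sqrt N%:R)^-1 <= (6 * n%:R ^+ 4 : R)^-1 ->
  exists2 z, z != 0 & forall i j, i != j -> tors pi k (el i j 1) z.
Proof.
move=> rc bb small Nbig.
have [g1 b1] := spread_col rc bb; have [g b2] := spread_row b1.
set u := pi g v in b2; pose w := E r c u.
have cr : c != r by rewrite eq_sym.
pose W (p : 'I_n * 'I_n) := tors pi k (el p.1 p.2 1).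
have gap := @root_gap R H n W (Num.sqrt N%:R)^-1 n3.
have [z z0 Wz] : exists2 z, z != 0 & forall p : 'I_n * 'I_n, p.1 != p.2 -> W p z.
  apply: (@descent R H _ (fun p : 'I_n * 'I_n => p.1 != p.2) W _ (n * n).+1%:R _ _ w).
  - by move=> p; exact: tors_sub.
  - by rewrite card_prod card_ord.
  - apply: gap.
    + by move=> p; exact: tors_sub.
    + by move=> i j l m ij lm jl mi x; apply: tors_projC; exact: el_commute.
    + move=> i j l x ij jl il; rewrite /W /= => Wx; apply: (heis_nonneg (c := el i l 1)) => //.
      * by rewrite el_heis// mulr1.
      * by apply: el_commute; rewrite // eq_sym.
      * by apply: el_commute; rewrite // eq_sym.
    + move=> i j l x y ij jl il; rewrite /W /= => Wx Wxz Wy.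
      have xyc : (el i j 1 ^ el j l 1 = el i l 1 * el i j 1)%g by rewrite el_heis// mulr1.
      have cx : commute (el i l 1) (el i j 1) by apply: el_commute; rewrite // eq_sym.
      have cy : commute (el i l 1) (el j l 1) by apply: el_commute; rewrite // eq_sym.
      have o := heis_orth k0 xyc cx cy kdvd Wx Wxz Wy.
      have sN : 0 < Num.sqrt (N%:R : R) by rewrite sqrtr_gt0 ltr0n.
      rewrite mulrC ler_pdivlMr// -(ler_pM2r sN) -mulrA -expr2 sqr_sqrtr ?ler0n//.
      by rewrite mulrC; apply: le_trans o _; rewrite -mulrA mulrC.
    + by rewrite invr_ge0 sqrtr_ge0.
  - have lw : b - eps <= dot w w by exact: lower.
    apply: lt_le_trans lw; apply: le_lt_trans small; rewrite ler_wpM2l ?mulr_ge0 ?exprn_ge0//.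
    apply: (@le_trans _ _ (\sum_(p : 'I_n * 'I_n | p.1 != p.2) 100 * eps)).
      apply: ler_sum => -[i j] /= ij; rewrite coprojE -hn_sqr.
      have h := near_all (erefl u) b2 rc ij.
      have -> : 100 * eps = (5 * (2 * Num.sqrt eps)) ^+ 2.
        by rewrite !exprMn sqr_sqrtr ?ltW//; lra.
      by rewrite lerXn2r ?nnegrE ?sqrtr_ge0 ?mulr_ge0 ?sqrtr_ge0.
    rewrite sumr_const -[(100 * eps) *+ _]mulr_natl ler_wpM2r//; first by rewrite mulr_ge0// ltW.
    rewrite ler_nat.
    by apply: leq_trans (max_card _) _; rewrite card_prod card_ord mulnn.
by exists z => // i j ij; exact: (Wz (i, j)).
Qed.
End TorsionVector.

Lemma torsion_vector (R : realType) (n : nat) (H : hilb R) (pi : hrep (SL int n) H) (v : H) (d : R) :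
  (3 <= n)%N -> 0 < d ->
  (forall h (i j : 'I_n), i != j -> exists2 w, pi (el i j 1 ^ h)%g w = w &
    d ^+ 2 * dot w w < dot v w ^+ 2) ->
  exists k, (0 < k)%N /\ exists2 z, z != 0 & forall i j : 'I_n, i != j -> tors pi k (el i j 1) z.
Proof.
move=> n3 d0 hyp; have d2 : 0 < d ^+ 2 by rewrite exprn_gt0.
(* K - 1 is the factor of eps in the descent condition; with eps = d^2 / (2 K + 2) that condition
   holds as soon as b >= d^2. *)
pose K : R := 16 * ((n * n).+1%:R) ^+ 2 * ((n ^ 2)%:R * 100) + 1.
have K0 : 0 < K by rewrite ltr_wpDl// !mulr_ge0// exprn_ge0.
pose eps := d ^+ 2 / (2 * K + 2).
have K2 : 0 < 2 * K + 2 by move: K0; lra.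
have e0 : 0 < eps by rewrite divr_gt0.
have [N1 N1P] : exists N1 : nat, (n ^ 2)%:R * dot v v / eps < N1%:R.
  by exists (Num.Def.archi_bound ((n ^ 2)%:R * dot v v / eps)); apply: archi_boundP; apply: divr_ge0; [apply: mulr_ge0 => //; exact: dot_ge0|exact: ltW].
(* The first summand makes the Bessel loss at most eps, the second makes 1 / sqrt N at most the 1 /
   (6 n^4) that [root_gap] requires. *)
pose N := (N1 + (6 * n ^ 4) ^ 2).+1.
have N0 : (0 < N)%N by [].
have N0' : (0 : R) < N%:R by rewrite ltr0n.
have NE : (n ^ 2)%:R * dot v v / N%:R <= eps.
  rewrite ler_pdivrMr// [eps * _]mulrC -ler_pdivrMr//; apply: ltW; apply: (lt_le_trans N1P).
  by rewrite ler_nat /N; lia.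
have Nbig : (Num.sqrt N%:R)^-1 <= (6 * n%:R ^+ 4 : R)^-1.
  have n0 : (0 : R) < 6 * n%:R ^+ 4 by rewrite mulr_gt0// exprn_gt0// ltr0n; lia.
  rewrite lef_pV2 ?posrE ?sqrtr_gt0//.
  rewrite -(@ler_pXn2r _ 2)// ?nnegrE ?sqrtr_ge0//.
  rewrite sqr_sqrtr; last exact: ltW.
  by rewrite -natrX -natrM -natrX ler_nat; exact: leqW (leq_addl _ _).
pose P i j := proj (tors pi N`! (el i j 1 : SL int n)).
pose X := {p : 'I_n * 'I_n & p.1 != p.2}.
pose F (x : X * SL int n) := dot (P (tag x.1).1 (tag x.1).2 (pi x.2 v)) (P (tag x.1).1 (tag x.1).2 (pi x.2 v)).
have low x : d ^+ 2 <= F x.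
  case: x => [[[i j] /= ij] g]; rewrite /F /=.
  have [w wfix dw] := hyp g i j ij.
  have sT x := tors_sub pi N`! x.
  have Tw : tors pi N`! (el i j 1 ^ g)%g w.
    move=> e ee; exists 0%N => m; rewrite expn0 muln1.
    suff -> : pi ((el i j 1 ^ g) ^+ m)%g w = w by rewrite subrr /hn dot0l sqrtr0 ltW.
    elim: m => [|m IH]; first by rewrite expg0 hact1.
    by rewrite expgS hactM IH.
  have w0 : 0 < dot w w.
    rewrite lt_neqAle dot_ge0 andbT eq_sym; apply/negP => /eqP w0.
    by move: dw; rewrite w0 mulr0 (dot_eq0 w0) dot0r expr0n ltxx.
  rewrite -(hact_dot pi g^-1%g) -/(P i j) -projJ -(ler_pM2r w0).
  apply: (le_trans (ltW dw)); rewrite -(dot_in (sT (el i j 1 ^ g)%g) v Tw).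
  exact: CauchySchwarz.
have ir : 'I_n by exists 0%N; lia.
have [jr /andP[jr0 _]] := ord_third ir ir n3.
have rj : ir != jr by rewrite eq_sym.
have x0 : X * SL int n by split; [exists (ir, jr)|exact: 1%g].
(* A near minimum over all roots and all translates together, so that the lower bound is available
   for every root on the whole orbit. *)
have [[[[r c] /= rc] g0] min] := near_inf x0 low e0.
exists N`!; split; first exact: fact_gt0.
apply: (@torsion_vector_aux R n H pi n3 v (F (existT _ (r, c) rc, g0)) eps N N0 e0 NE _ r c g0 rc) => //.
  by move=> g i j ij; rewrite lerBlDr; exact: (min (existT _ (i, j) ij, g)).
apply: (@lt_le_trans _ _ (d ^+ 2 - eps)); last by rewrite lerD2r.
have dE : d ^+ 2 = eps * (2 * K + 2) by rewrite /eps divfK// gt_eqF.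
rewrite dE; have -> : 16 * (n * n).+1%:R ^+ 2 * ((n ^ 2)%:R * (100 * eps)) = eps * (K - 1).
  by rewrite /K addrK; ring.
have : 0 < eps * K by rewrite mulr_gt0.
by move: e0; lra.
Qed.

(** * Steinberg relations *)

Section Words.
Variable T : groupType.

Inductive words (S : set T) : set T :=
| words1 : words S 1%g
| wordsM g x : S g -> words S x -> words S (g * x)%g.

Lemma words_gen (S : set T) g : S g -> words S g.
Proof. by move=> Sg; rewrite -[g]mulg1; apply: wordsM => //; exact: words1. Qed.

Lemma words_mul (S : set T) x y : words S x -> words S y -> words S (x * y)%g.
Proof.
move=> wx wy; elim: wx => [|g x' Sg _ IH]; first by rewrite mul1g.
by rewrite -mulgA; exact: wordsM.
Qed.

Lemma words_sub (S S' : set T) : S `<=` words S' -> words S `<=` words S'.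
Proof.
move=> SS x; elim=> [|g x' Sg _ IH]; first exact: words1.
by apply: words_mul => //; exact: SS.
Qed.

Lemma words_inv (S : set T) x : (forall g, S g -> words S g^-1%g) -> words S x -> words S x^-1%g.
Proof.
move=> SV; elim=> [|g x' Sg _ IH]; first by rewrite invg1; exact: words1.
by rewrite invgM; apply: words_mul => //; exact: SV.
Qed.

Lemma words_conj (S : set T) h x : (forall g, S g -> words S (g ^ h)%g) ->
  words S x -> words S (x ^ h)%g.
Proof.
move=> Sh; elim=> [|g x' Sg _ IH]; first by rewrite conj1g; exact: words1.
by rewrite conjMg; apply: words_mul => //; exact: Sh.
Qed.

Lemma words_comm (S : set T) h x : (forall g, S g -> commute h g) -> words S x -> commute h x.
Proof.
move=> Sh; elim=> [|g x' Sg _ IH]; first exact: commute1.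
by apply: commuteM => //; exact: Sh.
Qed.

Lemma words_push (S : set T) g x : (forall s, S s -> exists2 s', words S s' & (g * s = s' * g)%g) ->
  words S x -> exists2 x', words S x' & (g * x = x' * g)%g.
Proof.
move=> Sg; elim=> [|s x' Ss _ [y wy yE]]; first by exists 1%g; [exact: words1|rewrite mulg1 mul1g].
have [s' ws' sE] := Sg _ Ss; exists (s' * y)%g; first exact: words_mul.
by rewrite mulgA sE -mulgA yE mulgA.
Qed.

Lemma words_push2 (S S' : set T) g x :
  (forall g s, S g -> S' s -> exists2 s', words S' s' & (g * s = s' * g)%g) ->
  words S g -> words S' x -> exists2 x', words S' x' & (g * x = x' * g)%g.
Proof.
move=> SS wg; elim: wg x => [|h g' Sh _ IH] x wx; first by exists x => //; rewrite mulg1 mul1g.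
have [y wy yE] := IH _ wx.
have [z wz zE] := @words_push S' h y (fun s => SS h s Sh) wy.
by exists z => //; rewrite -mulgA yE mulgA zE mulgA.
Qed.

Section Commuting.
Variables (I : eqType) (F : I -> rat -> T) (D : set rat).
Definition fam (P : set I) : set T := [set x | exists i a, [/\ P i, D a & x = F i a]].
Hypothesis FM : forall i a b, D a -> D b -> exists2 c, D c & (F i a * F i b = F i c)%g.
Hypothesis F1 : forall i, exists2 c, D c & F i c = 1%g.
Hypothesis FC : forall i j a b, i != j -> D a -> D b -> commute (F i a) (F j b).

Lemma words_pull (P : set I) i x : words (fam P) x ->
  exists a x', [/\ D a, words (fam [set j | P j /\ j != i]) x' & x = (F i a * x')%g].
Proof.
elim=> [|_ x' [j [b [Pj Db ->]]] _ [a [y [Da wy ->]]]].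
  have [c Dc c1] := F1 i; exists c, 1%g; split => //; first exact: words1.
  by rewrite c1 mul1g.
have [ji|ji] := eqVneq j i.
  subst j; have [c Dc cE] := FM i Db Da; exists c, y; split => //.
  by rewrite mulgA cE.
exists a, (F j b * y)%g; split => //; last by rewrite !mulgA (FC _ Db Da).
by apply: wordsM => //; exists j, b.
Qed.

(** In a commuting family a word collapses to one factor per index, so its length no longer enters
    the bound. *)
Lemma words_fam_bound (R : realType) (N : T -> R) (eps : R) (s : seq I) x :
  (forall x y, N (x * y)%g <= N x + N y) -> N 1%g <= 0 ->
  (forall i a, D a -> N (F i a) <= eps) ->
  words (fam [set` s]) x -> N x <= (size s)%:R * eps.
Proof.
move=> NM N1 Ne; elim: s x => [|i s IH] x wx.
  suff -> : x = 1%g by rewrite mul0r.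
  by case: wx => // g y [j [a []]].
have [a [y [Da wy ->]]] := words_pull i wx.
apply: (le_trans (NM _ _)); rewrite /= -natr1 mulrDl mul1r addrC lerD//; last exact: Ne.
apply: IH; apply: words_sub wy => g [j [b [[jis ji] Db ->]]]; apply: words_gen.
by exists j, b; split => //; move: jis; rewrite /= inE (negPf ji).
Qed.

End Commuting.
End Words.

Section Steinberg.
Variables (n : nat) (n3 : (3 <= n)%N) (T : groupType) (e : 'I_n -> 'I_n -> rat -> T) (R J : set rat).
Hypotheses (R1 : R 1) (RD : forall a b, R a -> R b -> R (a + b))
  (RN : forall a, R a -> R (- a)) (RM : forall a b, R a -> R b -> R (a * b)).
Hypotheses (JR : J `<=` R) (JD : forall a b, J a -> J b -> J (a + b))
  (JM : forall a b, R a -> J b -> J (a * b)).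
Hypotheses (JV : forall s, J s -> R (1 + s)^-1) (J1 : forall s, J s -> 1 + s != 0).
Hypothesis eD : forall i j a b, i != j -> R a -> R b -> e i j (a + b) = (e i j a * e i j b)%g.
Hypothesis eC : forall i j l m a b, i != j -> l != m -> j != l -> m != i -> R a -> R b ->
  commute (e i j a) (e l m b).
Hypothesis eH : forall i j l a b, i != j -> j != l -> i != l -> R a -> R b ->
  (e i j a ^ e j l b = e i l (a * b) * e i j a)%g.
Implicit Types (i j l m : 'I_n) (a b z : rat).

Let R0 : R 0. Proof. by rewrite -(subrr 1); apply: RD => //; exact: RN. Qed.

Local Ltac Rin := repeat match goal with
  | |- R (_ + _) => apply: RD
  | |- R (_ * _) => apply: RM
  | |- R (- _) => apply: RN
  | |- R 0 => exact: R0
  | |- R 1 => exact: R1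
  | |- R _ => first [assumption | apply: JR; assumption | apply: JV; assumption]
  end.

Lemma st0 i j : i != j -> e i j 0 = 1%g.
Proof. by move=> ij; apply: (mulgI (e i j 0)); rewrite -eD// addr0 mulg1. Qed.

Lemma stV i j a : i != j -> R a -> (e i j a)^-1%g = e i j (- a).
Proof.
move=> ij Ra; apply: (mulgI (e i j a)); rewrite mulgV -eD//; last by Rin.
by rewrite subrr st0.
Qed.

Lemma stDA i j a b w : i != j -> R a -> R b ->
  (e i j a * (e i j b * w) = e i j (a + b) * w)%g.
Proof. by move=> ij Ra Rb; rewrite mulgA -eD. Qed.

Lemma stCA i j l m a b w : i != j -> l != m -> j != l -> m != i -> R a -> R b ->
  (e i j a * (e l m b * w) = e l m b * (e i j a * w))%g.
Proof. by move=> *; rewrite mulgA eC// mulgA. Qed.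

Lemma swap i j l a b : i != j -> j != l -> i != l -> R a -> R b ->
  (e i j a * e j l b = e j l b * (e i l (a * b) * e i j a))%g.
Proof. by move=> ij jl il Ra Rb; rewrite -eH// conjgE mulVKg. Qed.

Lemma swapV i j l a b : i != j -> j != l -> i != l -> R a -> R b ->
  (e j l b * e i j a = e i j a * (e i l (- (a * b)) * e j l b))%g.
Proof.
move=> ij jl il Ra Rb; have ji : j != i by rewrite eq_sym.
have li : l != i by rewrite eq_sym.
have lj : l != j by rewrite eq_sym.
rewrite stCA//; [|by Rin]; rewrite swap// stCA//; [|by Rin].
by rewrite stDA//; [rewrite addNr st0// mul1g|Rin|Rin].
Qed.

Lemma stHV i j l a b : i != j -> j != l -> i != l -> R a -> R b ->
  (e j l b ^ e i j a = e i l (- (a * b)) * e j l b)%g.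
Proof. by move=> *; rewrite conjgE swapV// mulKg. Qed.

(* [locked], since otherwise rewriting with [mulgA] unfolds it. *)
Definition hst i j y z : T := locked
  (e j i (- (z / (1 + y * z))) * (e i j y * (e j i z * e i j (- (y / (1 + y * z))))))%g.

Lemma hstE i j y z : hst i j y z =
  (e j i (- (z / (1 + y * z))) * (e i j y * (e j i z * e i j (- (y / (1 + y * z))))))%g.
Proof. by rewrite /hst -lock. Qed.

Definition ok y z := [/\ R y, R z, J (y * z), R (1 + y * z)^-1 & 1 + y * z != 0].

Lemma okP y z : R y -> R z -> J (y * z) -> ok y z.
Proof. by move=> Ry Rz Jyz; split => //; [exact: JV | exact: J1]. Qed.

(** In SL_2 an upper times a lower unipotent matrix, with t = 1 + y z invertible, is lower times
    diag(t, 1 / t) times upper; [hst] is by definition the middle factor. *)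
Lemma flip i j y z : i != j -> ok y z -> (e i j y * e j i z =
  e j i (z / (1 + y * z)) * (hst i j y z * e i j (y / (1 + y * z))))%g.
Proof.
move=> ij [Ry Rz Jyz RV t0]; have ji : j != i by rewrite eq_sym.
rewrite hstE -!mulgA stDA//; [|by Rin|by Rin].
rewrite addrN st0// mul1g -eD//; [|by Rin|by Rin].
by rewrite addNr st0// mulg1.
Qed.

Definition tw i j t l : rat := if l == i then t else if l == j then t^-1 else 1.

(* [hst i j y z] acts on the root subgroups as the diagonal matrix with entries
   [t] and [t^-1], [t = 1 + y * z], at the places [i] and [j]. *)
Lemma st_torus i j l m y z a : i != j -> l != m -> ok y z -> R a ->
  (e l m a ^ hst i j y z = e l m (a * tw i j (1 + y * z) m / tw i j (1 + y * z) l))%g.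
Proof.
move=> ij lm [Ry Rz Jyz RV t0] Ra; have ji : j != i by rewrite eq_sym.
rewrite /tw hstE; set t := 1 + y * z in RV t0 *.
have Rt : R t by rewrite /t; Rin.
have tE : t = 1 + y * z by [].
have hJ (g : T) : (g ^ (e j i (- (z / t)) * (e i j y * (e j i z * e i j (- (y / t))))) =
    (((g ^ e j i (- (z / t))) ^ e i j y) ^ e j i z) ^ e i j (- (y / t)))%g by rewrite !conjgM.
have cfix i' j' l' m' x b : i' != j' -> l' != m' -> j' != l' -> m' != i' -> R x -> R b ->
    (e l' m' b ^ e i' j' x = e l' m' b)%g.
  by move=> *; apply: commute_conj; apply: eC => //; rewrite eq_sym.
(* The root elements at (i, l') and (j, l') form a column vector on which the four factors of [hst]
   act as 2 by 2 matrices with diagonal product. *)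
have col l' b c : l' != i -> l' != j -> R b -> R c ->
    ((e i l' b * e j l' c) ^ (e j i (- (z / t)) * (e i j y * (e j i z * e i j (- (y / t)))))
     = e i l' (b / t) * e j l' (c * t))%g.
  move=> li lj Rb Rc; have il : i != l' by rewrite eq_sym.
  have jl : j != l' by rewrite eq_sym.
  have up b' c' y' : R b' -> R c' -> R y' ->
      ((e i l' b' * e j l' c') ^ e i j y' = e i l' (b' - y' * c') * e j l' c')%g.
    move=> Rb' Rc' Ry'; rewrite conjMg cfix// stHV// stDA//; by Rin.
  have lo b' c' z' : R b' -> R c' -> R z' ->
      ((e i l' b' * e j l' c') ^ e j i z' = e i l' b' * e j l' (c' - z' * b'))%g.
    move=> Rb' Rc' Rz'; rewrite conjMg (cfix j i j l')// stHV// -mulgA stCA//; [|by Rin].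
    by rewrite -eD// 1?addrC//; Rin.
  rewrite hJ lo//; [|by Rin]; rewrite up//; [|by Rin].
  rewrite lo//; [|by Rin|by Rin]; rewrite up//; [|by Rin|by Rin|by Rin].
  by congr (e _ _ _ * e _ _ _)%g; rewrite tE; field; rewrite -tE.
have row l' b c : l' != i -> l' != j -> R b -> R c ->
    ((e l' i b * e l' j c) ^ (e j i (- (z / t)) * (e i j y * (e j i z * e i j (- (y / t)))))
     = e l' i (b * t) * e l' j (c / t))%g.
  move=> li lj Rb Rc; have il : i != l' by rewrite eq_sym.
  have jl : j != l' by rewrite eq_sym.
  have up b' c' y' : R b' -> R c' -> R y' ->
      ((e l' i b' * e l' j c') ^ e i j y' = e l' i b' * e l' j (c' + b' * y'))%g.
    move=> Rb' Rc' Ry'; rewrite conjMg (cfix i j l' j)// eH// -mulgA stCA//; [|by Rin].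
    by rewrite -eD// 1?addrC//; Rin.
  have lo b' c' z' : R b' -> R c' -> R z' ->
      ((e l' i b' * e l' j c') ^ e j i z' = e l' i (b' + c' * z') * e l' j c')%g.
    move=> Rb' Rc' Rz'; rewrite conjMg (cfix j i l' i)// eH// stDA//; by Rin.
  rewrite hJ lo//; [|by Rin]; rewrite up//; [|by Rin].
  rewrite lo//; [|by Rin|by Rin]; rewrite up//; [|by Rin|by Rin|by Rin].
  by congr (e _ _ _ * e _ _ _)%g; rewrite tE; field; rewrite -tE.
have coli l' b : l' != i -> l' != j -> R b ->
    (e i l' b ^ (e j i (- (z / t)) * (e i j y * (e j i z * e i j (- (y / t)))))
     = e i l' (b / t))%g.
  by move=> li lj Rb; have := col l' b 0 li lj Rb R0; rewrite mul0r !st0 ?mulg1 1?eq_sym.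
have colj l' c : l' != i -> l' != j -> R c ->
    (e j l' c ^ (e j i (- (z / t)) * (e i j y * (e j i z * e i j (- (y / t)))))
     = e j l' (c * t))%g.
  by move=> li lj Rc; have := col l' 0 c li lj R0 Rc; rewrite mul0r !st0 ?mul1g 1?eq_sym.
have rowi l' b : l' != i -> l' != j -> R b ->
    (e l' i b ^ (e j i (- (z / t)) * (e i j y * (e j i z * e i j (- (y / t)))))
     = e l' i (b * t))%g.
  by move=> li lj Rb; have := row l' b 0 li lj Rb R0; rewrite mul0r !st0 ?mulg1.
have rowj l' c : l' != i -> l' != j -> R c ->
    (e l' j c ^ (e j i (- (z / t)) * (e i j y * (e j i z * e i j (- (y / t)))))
     = e l' j (c / t))%g.
  by move=> li lj Rc; have := row l' 0 c li lj R0 Rc; rewrite mul0r !st0 ?mul1g.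
set h := (_ * _)%g in hJ col row coli colj rowi rowj *.
have [p /andP[pi pj]] := ord_third i j n3.
have ip : i != p by rewrite eq_sym.
have jp : j != p by rewrite eq_sym.
have [li|li] := eqVneq l i.
  subst l; have [mj|mj] := eqVneq m j.
    subst m; rewrite (negPf ji).
    (* The roots (i, j) and (j, i) belong to the same rank one group as [hst]; they are reached as
       commutators through the third index p. *)
    have -> : e i j a = (e i p a ^ e p j 1 * (e i p a)^-1)%g by rewrite eH// mulr1 mulgK.
    rewrite conjMg conjVg conjJg coli// rowj// mul1r eH//; [|by Rin].
    by rewrite mulgK mulrAC.
  have mi : m != i by rewrite eq_sym.
  by rewrite (negPf mi) mulr1 coli.
have [mi|mi] := eqVneq m i.
  subst m; have [lj|lj] := eqVneq l j.
    subst l.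
    have -> : e j i a = (e j p a ^ e p i 1 * (e j p a)^-1)%g by rewrite eH// mulr1 mulgK.
    rewrite conjMg conjVg conjJg colj// rowi// mul1r eH//; [|by Rin].
    by rewrite mulgK invrK.
  by rewrite divr1 rowi.
have [lj|lj] := eqVneq l j.
  subst l; have mj : m != j by rewrite eq_sym.
  by rewrite (negPf mj) mulr1 invrK colj.
have [mj|mj] := eqVneq m j; first by subst m; rewrite divr1 rowj.
by rewrite mulr1 divr1 hJ !cfix//; (try by rewrite eq_sym); Rin.
Qed.

Lemma tw_ok i j y z l : ok y z -> [/\ tw i j (1 + y * z) l != 0,
  R (tw i j (1 + y * z) l) & R (tw i j (1 + y * z) l)^-1].
Proof.
move=> [Ry Rz Jyz RV t0]; rewrite /tw; case: ifP => _; first by split => //; Rin.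
by case: ifP => _; rewrite ?invrK ?invr1; split => //; rewrite ?invr_eq0 ?oner_eq0//; Rin.
Qed.

Lemma mvh i j l m y z a : i != j -> l != m -> ok y z -> R a ->
  (e l m a * hst i j y z =
   hst i j y z * e l m (a * tw i j (1 + y * z) m / tw i j (1 + y * z) l))%g.
Proof. by move=> ij lm yz Ra; rewrite conjgC st_torus. Qed.

Lemma mvh_l i j l m y z a : i != j -> l != m -> ok y z -> R a ->
  (hst i j y z * e l m a =
   e l m (a * tw i j (1 + y * z) l / tw i j (1 + y * z) m) * hst i j y z)%g.
Proof.
move=> ij lm yz Ra; have [l0 Rl RVl] := tw_ok i j l yz; have [m0 Rm RVm] := tw_ok i j m yz.
rewrite mvh//; [|by Rin]; congr (_ * e _ _ _)%g.
by field; rewrite l0.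
Qed.

(** Move e_ij(y + y') across e_ji(z) in one step and in two. Both results are in Gauss form with the
    same unipotent factors, which cancel. *)
Lemma hst_addl i j y y' z : i != j -> ok y z -> ok y' (z / (1 + y * z)) ->
  ok (y + y') z ->
  hst i j (y + y') z = (hst i j y' (z / (1 + y * z)) * hst i j y z)%g.
Proof.
move=> ij yz yz' yz''; have ji : j != i by rewrite eq_sym.
have [Ry Rz Jyz RV t0] := yz; have [Ry' Rz' Jyz' RV' t0'] := yz'.
have [_ _ _ RV'' t0''] := yz''.
have := flip ij yz''; rewrite addrC eD// -mulgA flip// mulgA flip// -!mulgA.
rewrite (mulgA (e i j _) (hst i j y z)) (mvh ij ij yz); [|by Rin].
rewrite -mulgA /tw eqxx (negPf ji) eqxx -eD//; [|by Rin|by Rin].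
set t := 1 + y * z in RV t0 *; set t' := 1 + y' * (z / t) in RV' t0' *.
have tt : 1 + (y' + y) * z = t * t' by rewrite /t' /t; field.
rewrite tt (_ : z / t / t' = z / (t * t')); last by field; rewrite t0'.
rewrite (_ : _ + _ = (y' + y) / (t * t')); last first.
  rewrite /t' /t; field; rewrite -/t t0 /=.
  by move: t0''; rewrite (_ : 1 + (y + y') * z = t + y' * z)// /t; ring.
by move/mulgI; rewrite mulgA => /mulIg.
Qed.

Lemma hst_addr i j y z z' : i != j -> ok y z -> ok (y / (1 + y * z)) z' ->
  ok y (z + z') ->
  hst i j y (z + z') = (hst i j y z * hst i j (y / (1 + y * z)) z')%g.
Proof.
move=> ij yz yz' yz''; have ji : j != i by rewrite eq_sym.
have [Ry Rz Jyz RV t0] := yz; have [Ry' Rz' Jyz' RV' t0'] := yz'.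
have [_ _ _ RV'' t0''] := yz''.
have := flip ij yz''; rewrite eD// mulgA flip// -!mulgA flip//.
rewrite (mulgA (hst i j y z) (e j i _)) (mvh_l ij ji yz); [|by Rin].
rewrite -!mulgA stDA//; [|by Rin|]; last first.
  by have [_ Rj _] := tw_ok i j j yz; have [_ _ RVi] := tw_ok i j i yz; Rin.
rewrite /tw eqxx (negPf ji) eqxx.
set t := 1 + y * z in RV t0 *; set t' := 1 + y / t * z' in RV' t0' *.
have tt : 1 + y * (z + z') = t * t' by rewrite /t' /t; field.
rewrite tt (_ : y / t / t' = y / (t * t')); last by field; rewrite t0'.
rewrite (_ : _ + _ = (z + z') / (t * t')); last first.
  rewrite /t' /t; field; rewrite -/t t0 /=.
  by move: t0''; rewrite (_ : 1 + y * (z + z') = t + y * z')// /t; ring.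
by move/mulgI; rewrite mulgA => /mulIg.
Qed.

(* In Steinberg symbols: [<xy, z> = <x, yz><y, xz>] with independent indices; compare
   the two ways of writing [e i j (x * y) * e j i z], using
   [e i j (x * y) = [e i l x, e l j y]]. *)
Lemma DennisStein i j l x y z : i != j -> j != l -> i != l -> R x -> R y -> R z ->
  J (x * y * z) ->
  hst i j (x * y) z = (hst i l x (y * z) * hst l j y (x * z))%g.
Proof.
move=> ij jl il Rx Ry Rz Jxyz.
have ji : j != i by rewrite eq_sym.
have lj : l != j by rewrite eq_sym.
have li : l != i by rewrite eq_sym.
have ok0 : ok (x * y) z by apply: okP => //; Rin.
have ok1 : ok x (y * z) by apply: okP => //; [Rin | rewrite mulrA].
have ok2 : ok y (x * z) by apply: okP => //; [Rin | rewrite mulrA (mulrC y)].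
have [_ _ _ RV t0] := ok0.
have := flip ij ok0; have := flip il ok1; have := flip lj ok2.
have mv1 := mvh_l il _ ok1; have mv2 := mvh_l lj _ ok2; have mv3 := mvh lj _ ok2.
move: mv1 mv2 mv3.
have -> : 1 + x * (y * z) = 1 + x * y * z by ring.
have -> : 1 + y * (x * z) = 1 + x * y * z by ring.
set t := 1 + x * y * z in RV t0 *; set h1 := hst i l _ _; set h2 := hst l j _ _.
move=> mv1 mv2 mv3 f2 f1 f0.
have P2 a b : R a -> R b -> (e i l a * (e l j b * e j i z) =
    e j i z * (e j l (- (z * a)) * (e i l a * (e l i (b * z) * e l j b))))%g.
  by move=> Ra Rb; rewrite swap// mulgA swapV// -!mulgA.
have comm : e i j (x * y) = (e i l x * (e l j y * (e i l (- x) * e l j (- y))))%g.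
  rewrite mulgA (swap (a := x) (b := y) il lj ij)// -!mulgA.
  rewrite stDA//; [|by Rin]; rewrite addrN st0// mul1g stCA//; [|by Rin].
  by rewrite -eD//; [rewrite addrN st0// mulg1|by Rin].
have Rxt : R (x / t) by Rin.
have Ryt : R (y / t) by Rin.
have Rzt : R (z / t) by Rin.
have Rxz : R (x * z) by Rin.
have Ryz : R (y * z) by Rin.
have RNx : R (- x) by Rin.
have RNy : R (- y) by Rin.
have m1 : (e i l (x / t) * h2 = h2 * e i l x)%g.
  rewrite mv3//; congr (_ * e _ _ _)%g; rewrite /tw (negPf il) (negPf ij) eqxx.
  by field.
have m2 : (h1 * e j l (x * z / t) = e j l (x * z) * h1)%g.
  rewrite mv1//; [|by Rin]; congr (e _ _ _ * _)%g.
  by rewrite /tw (negPf ji) (negPf jl) (negPf li) eqxx; field.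
have m3 : (h2 * e l i (- (y * z)) = e l i (- (y * z * t)) * h2)%g.
  rewrite mv2//; [|by Rin]; congr (e _ _ _ * _)%g.
  by rewrite /tw eqxx (negPf il) (negPf ij); field.
have m4 : (h1 * e l i (- (y * z * t)) = e l i (- (y * z / t)) * h1)%g.
  have Rt : R t by rewrite /t; Rin.
  rewrite mv1//; [|by Rin]; congr (e _ _ _ * _)%g.
  by rewrite /tw (negPf li) eqxx eqxx; field.
(* The word left once e_ji(z) stands in front. The pairs (i, l) and (l, j) are flipped separately,
   giving [h1] and [h2]; of the unipotent factors only one at each end survives. *)
have main : (e j l (- (x * z)) * (e i l x * (e l i (y * z) * (e l j y *
    (e j l (x * z) * (e i l (- x) * (e l i (- (y * z)) * e l j (- y))))))) =
    e j i (- (x * y * z * z / t)) * (h1 * (h2 * e i j (x * y / t))))%g.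
  rewrite (mulgA (e i l x)) f1 (mulgA (e l j y)) f2 -!mulgA.
  rewrite (mulgA (h1)) -(mulgA h1) (stCA _ (a := x / t))//; [|by Rin].
  rewrite (mulgA (e i l (x / t)) h2) m1 -!mulgA.
  rewrite (mulgA h1 (e j l _)) m2 -!mulgA.
  rewrite (mulgA (e i l x)) (swap il lj ij)// -!mulgA.
  rewrite stDA//; rewrite addrN st0// mul1g.
  rewrite (mulgA (e i j _)) (swapV li ij lj)//; [|by Rin|by Rin].
  rewrite -!mulgA (eC (a := x * (y / t)) (b := - y) ij lj jl ji)//; [|by Rin].
  rewrite stDA//; [|by Rin].
  rewrite (stCA _ (i := l) (j := j) (a := y / t))//; [|by Rin].
  rewrite stDA//; [|by Rin].
  have -> : y / t + (- (- (y * z) * (x * (y / t))) - y) = 0.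
    by rewrite /t; field.
  rewrite st0// mul1g (mulgA h2) m3 -!mulgA (mulgA h1) m4 -!mulgA.
  rewrite (mulgA (e l i (y * z / t)) (e j l _)) (swapV jl li ji)//; [|by Rin].
  rewrite -!mulgA stDA//; [|by Rin]; rewrite addNr st0// mul1g.
  rewrite stDA//; [|by Rin|by Rin]; rewrite addrN st0// mul1g.
  congr (e _ _ _ * (_ * (_ * e _ _ _)))%g; last by rewrite mulrA.
  by rewrite /t; field.
move: f0; rewrite comm -!mulgA P2//.
rewrite (mulgA (e l j y)) (swap lj ji li)// -!mulgA.
rewrite (mulgA (e i l x)) (swapV ji il jl)// -!mulgA.
rewrite mulrN opprK (mulrC z x) (mulNr y).
rewrite main stDA//; [|by Rin].
rewrite (_ : z + _ = z / t); last by rewrite /t; field.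
by move/mulgI; rewrite mulgA => /mulIg ->.
Qed.

Definition eta i j s := hst i j 1 s.

Lemma ok_eta s : J s -> ok 1 s.
Proof. by move=> Js; apply: okP => //; [Rin | rewrite mul1r]. Qed.

Lemma hst_etar i j l y z : i != j -> j != l -> i != l -> R y -> R z -> J (y * z) ->
  hst i j y z = (hst i l y z * eta l j (y * z))%g.
Proof.
by move=> ij jl il Ry Rz Jyz; have := @DennisStein i j l y 1 z; rewrite !mulr1 mul1r; apply.
Qed.

Lemma hst0l i j z : i != j -> R z -> hst i j 0 z = 1%g.
Proof.
move=> ij Rz; have ji : j != i by rewrite eq_sym.
rewrite hstE !mul0r addr0 divr1 oppr0 !st0// mul1g mulg1 -eD//; last by Rin.
by rewrite addNr st0.
Qed.

Lemma hst0r i j y : i != j -> R y -> hst i j y 0 = 1%g.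
Proof.
move=> ij Ry; have ji : j != i by rewrite eq_sym.
rewrite hstE !mulr0 addr0 mul0r divr1 oppr0 !st0// !mul1g -eD//; last by Rin.
by rewrite addrN st0.
Qed.

Lemma eta_mid i j l s : i != j -> j != l -> i != l -> J s ->
  eta i j s = (eta i l s * eta l j s)%g.
Proof.
by move=> ij jl il Js; rewrite /eta (hst_etar ij jl il)// ?mul1r//; Rin.
Qed.

Lemma hst_conj i j l m y z y0 z0 : i != j -> l != m -> ok y z -> ok y0 z0 ->
  let t := 1 + y0 * z0 in
  (hst i j y z ^ hst l m y0 z0 = hst i j (y * tw l m t j / tw l m t i)
                                        (z * tw l m t i / tw l m t j))%g.
Proof.
move=> ij lm [Ry Rz Jyz RV t0] ok0 t; have ji : j != i by rewrite eq_sym.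
have [i0 Ri RVi] := tw_ok l m i ok0; have [j0 Rj RVj] := tw_ok l m j ok0.
have ok0' := ok0; move: ok0'; rewrite [hst i j y z]hstE.
set h := hst l m y0 z0 => ok0'; rewrite hstE !conjMg !st_torus//; [|by Rin|by Rin].
rewrite -/t; move: i0 j0; rewrite -/t; move: (tw l m t i) (tw l m t j) => a b a0 b0.
have -> : 1 + y * b / a * (z * a / b) = 1 + y * z by field; rewrite b0 a0.
by congr (e _ _ _ * (e _ _ _ * (e _ _ _ * e _ _ _)))%g; field; rewrite ?a0 ?b0 t0.
Qed.

(** The defect of [hst] from depending on y z alone. It commutes with every e, since both factors
    act as the same diagonal matrix, and by [hst_etar] it does not depend on the second index. *)
Let f i j y z : T := (hst i j y z * (eta i j (y * z))^-1)%g.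

Let f_e i j y z l m a : i != j -> l != m -> ok y z -> R a -> commute (f i j y z) (e l m a).
Proof.
move=> ij lm yz Ra; have [_ _ Jyz _ _] := yz.
have : (e l m a ^ f i j y z = e l m a)%g.
  rewrite /f conjgM st_torus//; apply: (canLR (conjgK _)).
  by rewrite /eta st_torus ?mul1r//; exact: ok_eta.
by move=> /conjg_fixP/commgP/commute_sym.
Qed.

Let f_h i j y z l m y' z' : i != j -> l != m -> ok y z -> ok y' z' ->
  commute (f i j y z) (hst l m y' z').
Proof.
move=> ij lm yz [Ry Rz Jyz RV t0]; have ml : m != l by rewrite eq_sym.
by rewrite hstE; do !apply: commuteM; apply: f_e => //; Rin.
Qed.

Let f_row i j l y z : i != j -> j != l -> i != l -> R y -> R z -> J (y * z) ->
  f i j y z = f i l y z.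
Proof.
move=> ij jl il Ry Rz Jyz; rewrite /f (hst_etar ij jl il)// (eta_mid ij jl il)//.
by rewrite invgM -!mulgA mulVKg.
Qed.

(** The quotient ((1 + z)^k - 1) / z as a geometric sum, free of division by z. *)
Fixpoint ym z (k : nat) : rat := if k is k'.+1 then ym z k' + (1 + z) ^+ k' else 0.

Lemma ymE z k : 1 + ym z k * z = (1 + z) ^+ k.
Proof.
elim: k => [|k IH]; first by rewrite mul0r addr0.
by rewrite [ym _ _]/= mulrDl addrA IH exprS mulrDl mul1r (mulrC z).
Qed.

Lemma R_exp t k : R t -> R (t ^+ k).
Proof. by move=> Rt; elim: k => [|k IH] //; rewrite exprS; Rin. Qed.

Lemma R_ym z k : R z -> R (ym z k).
Proof.
move=> Rz; elim: k => [|k IH]; first exact: R0.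
by rewrite [ym _ _]/=; apply: RD => //; apply: R_exp; Rin.
Qed.

(** Induction with y + t in place of y, where t = 1 + y z and s = y z. By [hst_addl] the left side
    is hst(t, z / t) eta(s); by [hst_addr] the right side is eta(z) hst(1 / (1 + z), s (1 + z)).
    Each is eta(z) eta(s) up to a central defect, so the two defects have to be compared. *)
Lemma hst_ym i j z k : i != j -> J z -> hst i j (ym z k) z = eta i j (ym z k * z).
Proof.
move=> ij Jz; have ji : j != i by rewrite eq_sym.
have [l /andP[li lj]] := ord_third i j n3.
have il : i != l by rewrite eq_sym.
have jl : j != l by rewrite eq_sym.
have Rz : R z by exact: JR.
elim: k => [|k IH].
  by rewrite [ym z 0]/= mul0r hst0l// /eta hst0r.
set y := ym z k; set t := (1 + z) ^+ k; set s := y * z.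
have tE : 1 + y * z = t by exact: ymE.
have Ry : R y by exact: R_ym.
have Js : J s by exact: JM.
have Rt : R t by apply: R_exp; Rin.
have RVt : R t^-1 by rewrite -tE; exact: JV.
have t0 : t != 0 by rewrite -tE; exact: J1.
have RVz : R (1 + z)^-1 by Rin.
have z0 : 1 + z != 0 by exact: J1.
have okyz : ok y z by exact: okP.
have okt : ok t (z / t) by apply: okP; [|Rin|rewrite mulrC divfK].
have okr : ok (1 + z)^-1 (s * (1 + z)).
  by apply: okP; [Rin|Rin|rewrite mulrC mulfK].
have oky' : ok (y + t) z by apply: okP => //; [Rin | exact: JM (RD Ry Rt) Jz].
rewrite [ym _ _]/= -/y -/t.
rewrite hst_addl//; [|by rewrite tE].
rewrite IH tE -/s.
have -> : (y + t) * z = z + s * (1 + z) by rewrite -tE /s; ring.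
have oks : ok 1 s by exact: ok_eta.
have okz : ok 1 z by exact: ok_eta.
have -> : eta i j (z + s * (1 + z)) = (eta i j z * hst i j (1 + z)^-1 (s * (1 + z)))%g.
  rewrite /eta hst_addr ?mul1r//; apply: ok_eta; apply: JD => //.
  by rewrite mulrC; apply: JM => //; Rin.
(* the two central defects agree: both measure the commutator of
   [eta i l s] and [eta i j z] *)
have c1 : hst i j t (z / t) = (f i j t (z / t) * eta i j z)%g.
  by rewrite /f (_ : t * (z / t) = z) ?mulgVK// mulrC divfK.
have c2 : hst i j (1 + z)^-1 (s * (1 + z)) = (f i j (1 + z)^-1 (s * (1 + z)) * eta i j s)%g.
  by rewrite /f (_ : (1 + z)^-1 * _ = s) ?mulgVK// mulrC mulfK.
have c2' : hst i l (1 + z)^-1 (s * (1 + z)) = (f i j (1 + z)^-1 (s * (1 + z)) * eta i l s)%g.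
  have [Ra Rb Jab _ _] := okr; rewrite (@f_row i j l)//.
  by rewrite /f (_ : (1 + z)^-1 * _ = s) ?mulgVK// mulrC mulfK.
have k1 : (hst i j t (z / t) ^ eta i l s = eta i j z)%g.
  rewrite hst_conj//= mul1r tE /tw eqxx (negPf ji) (negPf jl).
  by rewrite mulr1 divff// divr1 divfK.
have k2 : (eta i l s ^ eta i j z = hst i l (1 + z)^-1 (s * (1 + z)))%g.
  by rewrite hst_conj//= /tw eqxx (negPf li) (negPf lj) !mul1r invr1 mulr1.
set c := f i j t (z / t) in c1; set d := f i j _ (s * (1 + z)) in c2 c2'.
have dz : commute d (eta i j z) by exact: f_h.
clearbody c d; have cd : c = d.
  move: k1 k2; rewrite c1 c2' !conjgE => /(congr1 (fun x : T => eta i l s * x)%g).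
  rewrite mulVKg => e1 /(congr1 (fun x : T => eta i j z * x)%g); rewrite mulVKg.
  rewrite -e1 [in RHS]mulgA -dz.
  by rewrite -!mulgA => /mulIg.
rewrite c1 c2 cd -!mulgA.
by rewrite [in RHS]mulgA -dz -!mulgA.
Qed.

Section MultiplicativeEta.
Hypothesis J0 : J 0.
Hypothesis hE : forall i j y z, i != j -> R y -> J z -> hst i j y z = eta i j (y * z).

Let JRM a b : J a -> R b -> J (a * b). Proof. by move=> Ja Rb; rewrite mulrC; exact: JM. Qed.
Let JN a : J a -> J (- a). Proof. by move=> Ja; rewrite -mulN1r; apply: JM => //; exact: RN. Qed.

Local Ltac RJin := repeat match goal with
  | |- R (_ + _) => apply: RD
  | |- R (_ * _) => apply: RM
  | |- R (- _) => apply: RN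
  | |- R 1 => exact: R1
  | |- R _ => first [assumption | apply: JV; assumption | apply: JR]
  | |- J (_ + _) => apply: JD
  | |- J (- _) => apply: JN
  | |- J 0 => exact: J0
  | |- J _ => first [assumption | apply: JM; [by RJin|by RJin] | apply: JRM; [by RJin|by RJin]]
  end.

Lemma etaM i j s s' : i != j -> J s -> J s' ->
  (eta i j s * eta i j s' = eta i j (s + s' + s * s'))%g.
Proof.
move=> ij Js Js'; have t0 := J1 Js; have RV := JV Js.
have -> : eta i j s' = hst i j (1 / (1 + 1 * s)) (s' * (1 + s)).
  rewrite !mul1r hE//; [|by RJin]; congr eta; by field.
have -> : s + s' + s * s' = s + s' * (1 + s) by ring.
rewrite /eta -hst_addr//; apply: okP => //; rewrite ?mul1r; RJin.
Qed.

Lemma eta0 i j : i != j -> eta i j 0 = 1%g.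
Proof. by move=> ij; exact: (hst0r). Qed.

Let inv s : rat := - s / (1 + s).

Lemma eta_inv i j s : i != j -> J s -> (eta i j s)^-1%g = eta i j (inv s).
Proof.
move=> ij Js; have t0 := J1 Js; have RV := JV Js.
apply: (mulgI (eta i j s)); rewrite mulgV etaM//; last by rewrite /inv; RJin.
by rewrite -[LHS](eta0 ij); congr eta; rewrite /inv; field.
Qed.

(** Conjugation by a torus element multiplies y and divides z by the same unit; the product y z, and
    with it the element, is unchanged. *)
Lemma etaC i j l m s s' : i != j -> l != m -> J s -> J s' ->
  commute (eta i j s) (eta l m s').
Proof.
move=> ij lm Js Js'.
have ok1 : ok 1 s by apply: okP; rewrite ?mul1r//; RJin.
have ok2 : ok 1 s' by apply: okP; rewrite ?mul1r//; RJin.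
apply/commgP/conjg_fixP.
have /= := hst_conj ij lm ok1 ok2.
rewrite /eta => ->; have [i0 Ri RVi] := tw_ok l m i ok2.
have [j0 Rj RVj] := tw_ok l m j ok2.
rewrite hE//; [|by RJin|by RJin]; rewrite /eta; congr hst.
by move: i0 j0; move: (tw _ _ _ i) (tw _ _ _ j) => p q p0 q0; field; rewrite ?p0 ?q0.
Qed.

(** Root elements only with indices below m, but torus elements for all indices, so that level 0 is
    the commuting torus. *)
Definition gens (m : nat) : set T := [set x |
  (exists i j a, [/\ i != j, (i < m)%N, (j < m)%N, J a & x = e i j a]) \/
  (exists i j s, [/\ i != j, J s & x = eta i j s])].

Lemma gens_eta (m : nat) i j s : i != j -> J s -> gens m (eta i j s).
Proof. by move=> ij Js; right; exists i, j, s. Qed.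

Definition colg m := fam (fun j a => e j m a) J [set j | (j < m)%N].
Definition rowg m := fam (fun j a => e m j a) J [set j | (j < m)%N].

Let ltne i m : (i < m)%N -> i != m. Proof. by move=> im; rewrite -val_eqE /= ltn_eqF. Qed.

Lemma push_col m g s : gens m g -> colg m s -> exists2 s', words (colg m) s' & (g * s = s' * g)%g.
Proof.
move=> [[i [j [a [ij im jm Ja ->]]]]|[i [j [s0 [ij Js ->]]]]] [l [b [/= lm Jb ->]]].
  have ne := ltne lm; have nei := ltne im.
  have [lj|lj] := eqVneq j l.
    subst l; exists (e j m b * e i m (a * b))%g.
      apply: wordsM; first by exists j, b.
      by apply: words_gen; exists i, (a * b); split => //; RJin.
    by rewrite swap// -?mulgA//; RJin.
  exists (e l m b); first by apply: words_gen; exists l, b.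
  by apply: eC => //; [rewrite eq_sym|RJin|RJin].
have ok1 : ok 1 s0 by apply: okP; rewrite ?mul1r//; RJin.
have := mvh_l ij (ltne lm) ok1 (JR Jb).
rewrite -/(eta i j s0) => ->.
have [_ Rl _] := tw_ok i j l ok1; have [_ _ RVm] := tw_ok i j m ok1.
eexists; last by [].
by apply: words_gen; eexists l, _; split; [| |reflexivity] => //; RJin.
Qed.

Lemma push_row m g s : gens m g -> rowg m s -> exists2 s', words (rowg m) s' & (g * s = s' * g)%g.
Proof.
move=> [[i [j [a [ij im jm Ja ->]]]]|[i [j [s0 [ij Js ->]]]]] [l [b [/= lm Jb ->]]];
  have ne : m != l by rewrite eq_sym; exact: ltne.
  have nei := ltne im; have nej : m != j by rewrite eq_sym; exact: ltne.
  have [li|li] := eqVneq i l.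
    subst l; exists (e m i b * e m j (- (b * a)))%g.
      apply: wordsM; first by exists i, b.
      by apply: words_gen; exists j, (- (b * a)); split => //; RJin.
    by rewrite swapV// -?mulgA//; RJin.
  exists (e m l b); first by apply: words_gen; exists l, b.
  by apply: eC => //; [rewrite eq_sym|rewrite eq_sym|RJin|RJin].
have ok1 : ok 1 s0 by apply: okP; rewrite ?mul1r//; RJin.
have := mvh_l ij ne ok1 (JR Jb).
rewrite -/(eta i j s0) => ->.
have [_ _ RVl] := tw_ok i j l ok1; have [_ Rm _] := tw_ok i j m ok1.
eexists; last by [].
by apply: words_gen; eexists l, _; split; [| |reflexivity] => //; RJin.
Qed.

Let eFM F' : (forall a b, R a -> R b -> F' (a + b) = (F' a * F' b)%g :> T) ->
  forall a b, J a -> J b -> exists2 c, J c & (F' a * F' b = F' c)%g.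
Proof. by move=> H a b Ja Jb; exists (a + b); [RJin|rewrite H//; RJin]. Qed.

(* Gauss elimination, one row and column at a time: the generator [e m i a] crosses a
   column word by [flip] in the one factor with index [i]. *)
Lemma words_step m x : words (gens m.+1) x -> exists c r w,
  [/\ words (colg m) c, words (rowg m) r, words (gens m) w & x = (c * (r * w))%g].
Proof.
elim=> [|g {}x Gg _ [c [r [w [wc wr ww ->]]]]].
  by exists 1%g, 1%g, 1%g; split; [exact: words1|exact: words1|exact: words1|rewrite !mulg1].
have old h : gens m h -> exists c' r' w',
    [/\ words (colg m) c', words (rowg m) r', words (gens m) w' &
      (h * (c * (r * w)) = c' * (r' * w'))%g].
  move=> Gh; have [c' wc' cE] := words_push (fun s => push_col Gh) wc.
  have [r' wr' rE] := words_push (fun s => push_row Gh) wr.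
  exists c', r', (h * w)%g; split => //; first exact: wordsM.
  by rewrite mulgA cE -mulgA (mulgA h r) rE -!mulgA.
case: Gg => [[i [j [a [ij im jm Ja ->]]]]|[i [j [s0 [ij Js ->]]]]]; last first.
  by apply: old; exact: gens_eta.
have [jE|jne] := eqVneq j m.
  subst j; exists (e i m a * c)%g, r, w; split => //; last by rewrite mulgA.
  apply: wordsM => //; exists i, a; split => //=; rewrite ltn_neqAle val_eqE ij /=.
  by rewrite -ltnS.
have {}jm : (j < m)%N by rewrite ltn_neqAle val_eqE jne -ltnS.
have [iE|ine] := eqVneq i m; last first.
  have {}im : (i < m)%N by rewrite ltn_neqAle val_eqE ine -ltnS.
  by apply: old; left; exists i, j, a.
subst i; move: j a ij jm Ja {im jne} => i a mi im Ja; have im' : i != m by rewrite eq_sym.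
have [x0 [c0 [Jx wc0 cE]]] : exists x0 c0, [/\ J x0,
    words (fam (fun j a => e j m a) J [set j | (j < m)%N /\ j != i]) c0 & c = (e i m x0 * c0)%g].
  pose F j b := if j == m then 1%g else e j m b.
  have famE P : P `<=` [set j | (j < m)%N] ->
      fam (fun j a => e j m a) J P = fam F J P.
    move=> Pm; apply/seteqP; split => h [j [b [Pj Jb ->]]]; exists j, b; split => //;
      by rewrite /F (negPf (ltne (Pm _ Pj))).
  have FM j b b' : J b -> J b' -> exists2 b'', J b'' & (F j b * F j b' = F j b'')%g.
    move=> Jb Jb'; rewrite /F; case: eqVneq => [_|jm]; first by exists b; rewrite ?mulg1.
    by apply: (eFM (F' := e j m)) => // *; apply: eD.
  have F1 j : exists2 b, J b & F j b = 1%g.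
    by exists 0 => //; rewrite /F; case: eqVneq => // jm; exact: st0.
  have FC j l b b' : j != l -> J b -> J b' -> commute (F j b) (F l b').
    move=> jl Jb Jb'; rewrite /F; case: eqVneq => [_|jm].
      by apply: commute_sym; exact: commute1.
    case: eqVneq => [_|lm]; first exact: commute1.
    by apply: eC => //; [rewrite eq_sym|rewrite eq_sym|RJin|RJin].
  have wc' : words (fam F J [set j | (j < m)%N]) c by move: wc; rewrite /colg famE.
  have [a' [c0 [Ja' wc0 cE]]] := words_pull FM F1 FC i wc'.
  exists a', c0; split => //; first by rewrite famE// => j [].
  by move: cE; rewrite /F (negPf im').
(* Crossing the column factors other than the i-th produces only root elements with both indices
   below m, which belong to the lower level. *)
have pass d : J d -> forall y, words (fam (fun j a => e j m a) J [set j | (j < m)%N /\ j != i]) y ->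
    exists2 v, words (gens m) v & (e m i d * y = y * (v * e m i d))%g.
  move=> Jd y; elim=> [|_ y' [j [b [[jm ji] Jb ->]]] wy' [v wv vE]].
    by exists 1%g; [exact: words1|rewrite mulg1 !mul1g].
  have jm' := ltne jm.
  exists (e j i (- (b * d)) * v)%g.
    by apply: wordsM => //; left; exists j, i, (- (b * d)); split => //; RJin.
  have cy : commute (e j i (- (b * d))) y'.
    apply: words_comm wy' => _ [l [b' [[lm li] Jb' ->]]]; apply: eC => //.
    - exact: ltne.
    - by rewrite eq_sym.
    - by rewrite eq_sym.
    - by RJin.
    - by RJin.
  rewrite mulgA (swapV jm' mi ji)//; [|by RJin|by RJin].
  by rewrite -!mulgA vE !mulgA -(mulgA (e j m b)) cy !mulgA.
have ok1 : ok a x0 by apply: okP => //; RJin.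
have := flip mi ok1; have [_ _ Jax RV t0] := ok1.
rewrite hE//; last by RJin.
set t := 1 + a * x0 in RV t0 *; move=> flE.
have [v wv vE] := pass (a / t) ltac:(by RJin) _ wc0.
have wr1 : words (rowg m) (e m i (a / t) * r)%g by apply: wordsM => //; exists i, (a / t); split => //; RJin.
have [r2 wr2 rE] := @words_push2 T (gens m) (rowg m) v _ (fun g s => @push_row m g s) wv wr1.
have Gh : gens m (eta m i (a * x0)) by exact: gens_eta.
have wc0' : words (colg m) c0.
  by apply: words_sub wc0 => _ [j [b [[jm _] Jb ->]]]; apply: words_gen; exists j, b.
have [c1 wc1 c1E] := words_push (fun s => push_col Gh) wc0'.
have [r3 wr3 r3E] := words_push (fun s => push_row Gh) wr2.
exists (e i m (x0 / t) * c1)%g, r3, (eta m i (a * x0) * (v * w))%g; split => //.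
- by apply: wordsM => //; exists i, (x0 / t); split => //; RJin.
- by apply: wordsM => //; exact: words_mul.
rewrite cE -(mulgA (e i m x0)) (mulgA (e m i a)) flE -!mulgA; congr (_ * _)%g.
rewrite (mulgA (e m i (a / t))) vE -!mulgA (mulgA (eta _ _ _) c0) c1E -!mulgA.
congr (_ * _)%g; rewrite (mulgA (e m i _) r) (mulgA v) rE -!mulgA.
by rewrite (mulgA (eta _ _ _) r2) r3E -!mulgA.
Qed.

(** Each [words_step] splits off a column and a row, commuting families of at most n factors each: 2
    n eps per level. At level 0 every torus element is a product of elements eta_lp with p fixed,
    which costs n eps. *)
Lemma words_bound (K : realType) (N : T -> K) (eps : K) (m : nat) x :
  (forall x y, N (x * y)%g <= N x + N y) -> N 1%g <= 0 -> 0 <= eps ->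
  (forall g, gens n g -> N g <= eps) -> (m <= n)%N ->
  words (gens m) x -> N x <= n%:R * eps + m%:R * ((n%:R * eps) *+ 2).
Proof.
move=> NM N1 e0 Ne.
have Nej i j a : i != j -> J a -> N (e i j a) <= eps.
  by move=> ij Ja; apply: Ne; left; exists i, j, a.
elim: m x => [|m IH] x mn wx.
  rewrite mul0r addr0; have p : 'I_n by exists 0%N; lia.
  pose F l s := if l == p then 1%g else eta l p s.
  have sz : n = size (enum 'I_n) by rewrite size_enum_ord.
  rewrite {1}sz; apply: (@words_fam_bound T _ F J) => //.
  - move=> j b b' Jb Jb'; rewrite /F; case: eqVneq => [_|jp]; first by exists b; rewrite ?mulg1.
    by exists (b + b' + b * b'); [RJin|rewrite etaM].
  - by move=> j; exists 0 => //; rewrite /F; case: eqVneq => // jp; exact: eta0.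
  - move=> j l b b' jl Jb Jb'; rewrite /F; case: eqVneq => [_|jp].
      by apply: commute_sym; exact: commute1.
    case: eqVneq => [_|lp]; first exact: commute1.
    exact: etaC.
  - move=> l s Js; rewrite /F; case: eqVneq => [_|lp]; first exact: le_trans e0.
    by apply: Ne; exact: gens_eta.
  apply: words_sub wx => _ [[i [j [a []]]]|[i [j [s [ij Js ->]]]]] //.
  have Fg l s' : J s' -> words (fam F J [set` enum 'I_n]) (F l s').
    by move=> Js'; apply: words_gen; exists l, s'; split => //=; rewrite mem_enum.
  have Fp l s' : l != p -> eta l p s' = F l s' by rewrite /F => /negPf->.
  have Ji : J (inv s) by rewrite /inv; have RV := JV Js; RJin.
  have mid (a b c : 'I_n) := @eta_mid a b c s.
  (* By [eta_mid], eta_ab(s) behaves like a difference of terms attached to a and b, so exchanging a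
     and b inverts it. *)
  have flp (a b : 'I_n) : a != b -> eta a b s = (eta b a s)^-1%g.
    move=> ab; have ba : b != a by rewrite eq_sym.
    have [l /andP[la lb]] := ord_third a b n3.
    have al : a != l by rewrite eq_sym.
    have bl : b != l by rewrite eq_sym.
    have e1 := mid a b l ab bl al Js; have e2 := mid a l b al lb ab Js.
    have e3 := mid l a b la ab lb Js.
    apply: (mulIg (eta b a s)); rewrite mulVg.
    by apply: (mulgI (eta l a s)); rewrite mulg1 mulgA -(mid l b a)// (mid l a b)// 1?eq_sym //.
  have [ip|ip] := eqVneq i p.
    subst i; have jp : j != p by rewrite eq_sym.
    by rewrite flp// eta_inv// Fp//; exact: Fg.
  have [jp|jp] := eqVneq j p; first by subst j; rewrite Fp//; exact: Fg.
  have pj : p != j by rewrite eq_sym.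
  rewrite (mid i j p)// (flp p j)// eta_inv// !Fp//.
  by apply: words_mul; apply: Fg.
pose M : 'I_n := Ordinal mn.
have [c [r [w [wc wr ww ->]]]] := @words_step M x wx.
have sz : n = size (enum 'I_n) by rewrite size_enum_ord.
have Nc : N c <= n%:R * eps.
  pose F j b := if j == M then 1%g else e j M b.
  rewrite {1}sz; apply: (@words_fam_bound T _ F J) => //.
  - move=> j b b' Jb Jb'; rewrite /F; case: eqVneq => [_|jm]; first by exists b; rewrite ?mulg1.
    by apply: (eFM (F' := e j M)) => // *; apply: eD.
  - move=> j; exists 0 => //; rewrite /F; case: eqVneq => // jm.
    exact: st0.
  - move=> j l b b' jl Jb Jb'; rewrite /F; case: eqVneq => [_|jm].
      by apply: commute_sym; exact: commute1.
    case: eqVneq => [_|lm]; first exact: commute1.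
    by apply: eC => //; [rewrite eq_sym|rewrite eq_sym|RJin|RJin].
  - by move=> l s Js; rewrite /F; case: eqVneq => [_|lp]; [exact: le_trans e0|exact: Nej].
  apply: words_sub wc => _ [j [b [jm Jb ->]]]; apply: words_gen; exists j, b.
  by split => //=; rewrite ?mem_enum// /F (negPf (ltne jm)).
have Nr : N r <= n%:R * eps.
  pose F j b := if j == M then 1%g else e M j b.
  rewrite {1}sz; apply: (@words_fam_bound T _ F J) => //.
  - move=> j b b' Jb Jb'; rewrite /F; case: eqVneq => [_|jm]; first by exists b; rewrite ?mulg1.
    by apply: (eFM (F' := e M j)) => // *; apply: eD => //; rewrite eq_sym.
  - move=> j; exists 0 => //; rewrite /F; case: eqVneq => // jm.
    by apply: st0; rewrite eq_sym.
  - move=> j l b b' jl Jb Jb'; rewrite /F; case: eqVneq => [_|jm].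
      by apply: commute_sym; exact: commute1.
    case: eqVneq => [_|lm]; first exact: commute1.
    by apply: eC => //; rewrite 1?eq_sym//; RJin.
  - move=> l s Js; rewrite /F; case: eqVneq => [_|lp]; first exact: le_trans e0.
    by apply: Nej; rewrite // eq_sym.
  apply: words_sub wr => _ [j [b [jm Jb ->]]]; apply: words_gen; exists j, b.
  by split => //=; rewrite ?mem_enum// /F (negPf (ltne jm)).
have Nw := IH w (ltnW mn) ww.
apply: (le_trans (NM _ _)); have := NM r w.
move: Nc Nr Nw; rewrite -natr1 mulrDl mul1r.
move: (n%:R * eps) (m%:R * _) => A B; lra.
Qed.

Lemma words_symm x : words (gens n) x -> words (gens n) x^-1%g.
Proof.
apply: words_inv => _ [[i [j [a [ij im jm Ja ->]]]]|[i [j [s [ij Js ->]]]]]; apply: words_gen.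
  left; exists i, j, (- a); split => //; first by RJin.
  by rewrite stV//; RJin.
by rewrite eta_inv//; apply: gens_eta => //; rewrite /inv; have RV := JV Js; RJin.
Qed.

(** Here b ranges over all of [R]. Conjugation changes a torus element by e_lm of an element of [J],
    its weights being 1 modulo [J]. For the opposite root the product - b a lies in [J], so [flip]
    applies. *)
Lemma words_normal l m b x : l != m -> R b -> words (gens n) x ->
  words (gens n) (x ^ e l m b)%g.
Proof.
move=> lm Rb; have ml : m != l by rewrite eq_sym.
have Ge i j a : i != j -> J a -> gens n (e i j a).
  by move=> ij Ja; left; exists i, j, a; split => //; exact: ltn_ord.
apply: words_conj => _ [[i [j [a [ij im jm Ja ->]]]]|[i [j [s [ij Js ->]]]]]; last first.
  have ok1 : ok 1 s by apply: okP; rewrite ?mul1r//; RJin.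
  have [l0 Rl RVl] := tw_ok i j l ok1; have [m0 Rm RVm] := tw_ok i j m ok1.
  have tJ k : J (tw i j (1 + 1 * s) k - 1).
    rewrite /tw mul1r; case: ifP => _; first by rewrite addrAC subrr add0r.
    case: ifP => _; last by rewrite subrr.
    have := JV Js => RV; have t0 := J1 Js.
    by rewrite (_ : _ - 1 = - s * (1 + s)^-1); [RJin|field].
  rewrite conjgE stV// mulgA (conjgC (e l m (- b))) /eta st_torus//; last by RJin.
  rewrite -mulgA -eD//; [|by RJin].
  apply: wordsM; first exact: gens_eta.
  apply: words_gen; apply: Ge => //.
  have := tJ m; have := tJ l; move: l0 RVl Rm Rl; move: (tw _ _ _ l) (tw _ _ _ m) => p q p0 RVp Rq Rp Jp Jq.
  rewrite (_ : _ + b = b * p^-1 * ((p - 1) - (q - 1))); last by field.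
  by apply: JM; [RJin|apply: JD => //; exact: JN].
have [jl|jl] := eqVneq j l.
  subst l; have [im'|im'] := eqVneq i m.
    subst m.
    have ok1 : ok (- b) a by apply: okP; RJin.
    have := flip lm ok1; have [_ _ Jab RV t0] := ok1.
    rewrite hE//; [|by RJin] => flE.
    rewrite conjgE stV// mulgA flE -!mulgA -eD//; [|by RJin].
    apply: wordsM; first by apply: Ge => //; RJin.
    apply: wordsM; first by apply: gens_eta => //; RJin.
    apply: words_gen; apply: Ge => //.
    by rewrite (_ : _ + b = - b * b * a / (1 + - b * a)); [RJin|field].
  rewrite eH//; [|by RJin]; apply: wordsM; first by apply: Ge => //; RJin.
  by apply: words_gen; exact: Ge.
have [mi|mi] := eqVneq m i.
  subst m; rewrite stHV//; [|by rewrite eq_sym|by RJin].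
  apply: wordsM; last by apply: words_gen; exact: Ge.
  by apply: Ge; [rewrite eq_sym|RJin].
rewrite commute_conj; last by apply: commute_sym; apply: eC => //; RJin.
by apply: words_gen; exact: Ge.
Qed.

End MultiplicativeEta.

End Steinberg.

(** * k-adic limits *)

Section PartialIsometries.
Variables (R : realType) (H : hilb R) (Z : set H).

(** Isometries of [Z], encoded as permutations of the whole space that are the identity off [Z]:
    they form a group in which equality may be tested on [Z]. *)
Record ziso := ZIso {
  zf :> H -> H;
  zg : H -> H;
  zfK : cancel zf zg;
  zgK : cancel zg zf;
  zf_off : forall x, ~ Z x -> zf x = x;
  zf_in : forall x, Z x -> Z (zf x);
  zg_in : forall x, Z x -> Z (zg x);
  zf_iso : forall x y, Z x -> Z y -> hn (zf x - zf y) = hn (x - y)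
}.
HB.instance Definition _ := gen_eqMixin ziso.
HB.instance Definition _ := gen_choiceMixin ziso.

Lemma ziso_eq (a b : ziso) : (forall x, Z x -> a x = b x) -> a = b.
Proof.
move=> ab; have fE : zf a = zf b.
  apply/funext => x; have [/ab//|nZ] := pselect (Z x).
  by rewrite !zf_off.
have gE : zg a = zg b.
  by apply/funext => x; rewrite -[LHS](zfK b) -fE zgK.
case: a b {ab} fE gE => f g p1 p2 p3 p4 p5 p6 [f' g' q1 q2 q3 q4 q5 q6] /= fE gE.
by subst f' g'; f_equal; exact: Prop_irrelevance.
Qed.

Definition ziso1 : ziso.
Proof. by exists id id. Defined.

Definition zisoM (a b : ziso) : ziso.
Proof.
exists (a \o b) (zg b \o zg a).
- by move=> x /=; rewrite zfK zfK.
- by move=> x /=; rewrite zgK zgK.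
- by move=> x nZ /=; rewrite !zf_off// zf_off.
- by move=> x Zx /=; do 2 apply: zf_in.
- by move=> x Zx /=; do 2 apply: zg_in.
- by move=> x y Zx Zy /=; rewrite !zf_iso//; apply: zf_in.
Defined.

Definition zisoV (a : ziso) : ziso.
Proof.
exists (zg a) (zf a).
- exact: zgK.
- exact: zfK.
- by move=> x nZ; rewrite -{1}(zf_off a nZ) zfK.
- exact: zg_in.
- exact: zf_in.
- by move=> x y Zx Zy; rewrite -(zf_iso a) ?zgK//; exact: zg_in.
Defined.

Fact zisoMA : associative zisoM. Proof. by move=> a b c; apply: ziso_eq. Qed.
Fact ziso1M : left_id ziso1 zisoM. Proof. by move=> a; apply: ziso_eq. Qed.
Fact zisoM1 : right_id ziso1 zisoM. Proof. by move=> a; apply: ziso_eq. Qed.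
Fact zisoVM : left_inverse ziso1 zisoV zisoM.
Proof. by move=> a; apply: ziso_eq => x _ /=; rewrite zfK. Qed.
Fact zisoMV : right_inverse ziso1 zisoV zisoM.
Proof. by move=> a; apply: ziso_eq => x _ /=; rewrite zgK. Qed.
HB.instance Definition _ := isGroup.Build ziso zisoMA ziso1M zisoM1 zisoVM zisoMV.

Lemma zisoME (a b : ziso) x : (a * b)%g x = a (b x). Proof. by []. Qed.
Lemma ziso1E x : (1%g : ziso) x = x. Proof. by []. Qed.

End PartialIsometries.

Section KadicRationals.
Variable k : nat.
Hypothesis k2 : (1 < k)%N.
Implicit Types r x y z : rat.

Definition Rk : set rat := [set r | exists (p : int) (d : nat),
  [/\ (0 < d)%N, coprime k d & r * d%:R = p%:~R]].
Definition Jk (a : nat) : set rat := [set r | exists2 x, Rk x & r = k%:R ^+ a * x].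

Lemma Rk_int (c : int) : Rk c%:~R.
Proof. by exists c, 1%N; split; rewrite ?coprimen1 ?mulr1. Qed.

Lemma Rk1 : Rk 1. Proof. exact: (Rk_int 1). Qed.
Lemma Rk0 : Rk 0. Proof. exact: (Rk_int 0). Qed.

Lemma RkD x y : Rk x -> Rk y -> Rk (x + y).
Proof.
move=> [p [d [d0 kd xE]]] [q [d' [d'0 kd' yE]]].
exists (p * d'%:Z + q * d%:Z), (d * d')%N; split; first by rewrite muln_gt0 d0.
  by rewrite coprimeMr kd.
rewrite natrM rmorphD !rmorphM /= -xE -yE !pmulrn; ring.
Qed.

Lemma RkN x : Rk x -> Rk (- x).
Proof.
move=> [p [d [d0 kd xE]]]; exists (- p), d; split => //.
by rewrite mulNr xE rmorphN.
Qed.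

Lemma RkM x y : Rk x -> Rk y -> Rk (x * y).
Proof.
move=> [p [d [d0 kd xE]]] [q [d' [d'0 kd' yE]]].
exists (p * q), (d * d')%N; split; first by rewrite muln_gt0 d0.
  by rewrite coprimeMr kd.
rewrite natrM rmorphM /= -xE -yE; ring.
Qed.

Lemma Rk_expk a : Rk (k%:R ^+ a). Proof. by rewrite -natrX; exact: (Rk_int (k ^ a)%N). Qed.

Lemma Jk_sub a : Jk a `<=` Rk.
Proof. by move=> _ [x Rx ->]; apply: RkM => //; exact: Rk_expk. Qed.

Lemma Jk0 a : Jk a 0. Proof. by exists 0; [exact: Rk0|rewrite mulr0]. Qed.

Lemma JkD a x y : Jk a x -> Jk a y -> Jk a (x + y).
Proof. by move=> [x' Rx ->] [y' Ry ->]; exists (x' + y'); [exact: RkD|rewrite mulrDr]. Qed.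

Lemma JkM a x y : Rk x -> Jk a y -> Jk a (x * y).
Proof. by move=> Rx [y' Ry ->]; exists (x * y'); [exact: RkM|rewrite mulrCA]. Qed.

Lemma JkMr a x y : Jk a x -> Rk y -> Jk a (x * y).
Proof. by move=> Jx Ry; rewrite mulrC; exact: JkM. Qed.

Lemma JkN a x : Jk a x -> Jk a (- x).
Proof. by move=> Jx; rewrite -mulN1r; apply: JkM => //; apply: RkN; exact: Rk1. Qed.

Lemma JkB a x y : Jk a x -> Jk a y -> Jk a (x - y).
Proof. by move=> Jx Jy; apply: JkD => //; exact: JkN. Qed.

Lemma Jk_le a b : (a <= b)%N -> Jk b `<=` Jk a.
Proof.
move=> ab _ [x Rx ->]; exists (k%:R ^+ (b - a) * x).
  by apply: RkM => //; exact: Rk_expk.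
by rewrite mulrA -exprD subnKC.
Qed.

Lemma Jk_unit a s : (0 < a)%N -> Jk a s -> Rk (1 + s)^-1 /\ 1 + s != 0.
Proof.
move=> a0 [x [p [d [d0 kd xE]]] sE].
have d0' : (d%:R : rat) != 0 by rewrite pnatr_eq0 -lt0n.
pose m : int := d%:Z + (k ^ a)%:Z * p.
have mE : (1 + s) * d%:R = m%:~R.
  by rewrite sE mulrDl mul1r -mulrA xE /m rmorphD rmorphM /= -natrX !pmulrn.
have cop : coprimez k%:Z m.
  have -> : m = ((k ^ a.-1)%:Z * p) * k%:Z + d%:Z.
    by rewrite /m -{1}(prednK a0) expnS PoszM; ring.
  by rewrite /coprimez gcdzMDl.
have m0 : m != 0.
  by apply/eqP => m0; move: cop; rewrite m0 /coprimez gcdz0 /= => /eqP; lia.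
have t0 : 1 + s != 0.
  by apply/eqP => t0; move: mE; rewrite t0 mul0r => /esym/eqP; rewrite intr_eq0 (negPf m0).
split => //; exists (sgz m * d%:Z), `|m|%N; split.
- by rewrite absz_gt0.
- by move: cop; rewrite coprimezE.
- have mE' : (`|m|%N%:R : rat) = (sgz m)%:~R * m%:~R.
    by rewrite -intrM -abszEsg pmulrn.
  by rewrite mE' -mE rmorphM /= pmulrn; field.
Qed.

Lemma Jk_int a (c : int) : Jk a c%:~R -> ((k ^ a)%:Z %| c)%Z.
Proof.
move=> [x [p [d [d0 kd xE]]] cE].
have : (k ^ a)%:Z * p = c * d%:Z.
  apply: (@intr_inj rat); rewrite !rmorphM /= cE -xE -natrX; ring.
move=> E; have : ((k ^ a)%:Z %| c * d%:Z)%Z by rewrite -E dvdz_mulr.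
by rewrite Gauss_dvdzl// coprimezE /= coprimeXl.
Qed.

(** If u k^s + w d = 1, the integer p w approximates r = p / d. *)
Lemma Rk_dense s r : Rk r -> exists c : int, Jk s (c%:~R - r).
Proof.
move=> [p [d [d0 kd rE]]].
have d0' : (d%:R : rat) != 0 by rewrite pnatr_eq0 -lt0n.
have cop : coprimez (k ^ s)%:Z d%:Z by rewrite coprimezE /= coprimeXl.
have [[u w] /= uw] := coprimezP _ _ cop.
exists (p * w); exists (- (p * u)%:~R / d%:R); last first.
  have -> : r = p%:~R / d%:R by rewrite -rE mulfK.
  have -> : (k%:R ^+ s : rat) = (k ^ s)%:Z%:~R by rewrite -natrX.
  have wE : (w%:~R : rat) = (1 - u%:~R * (k ^ s)%:Z%:~R) / d%:R.
    have := congr1 (intr : int -> rat) uw; rewrite rmorphD !rmorphM /= rmorph1 => uwE.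
    by apply: (canRL (mulfK d0')); apply/eqP; rewrite eq_sym subr_eq addrC pmulrn uwE.
  by rewrite !rmorphM /= wE; field.
exists (- (p * u)), d; split => //; by rewrite divfK// rmorphN.
Qed.

Lemma Rk_dense_nat r : Rk r -> exists u : nat, Jk 1 (u%:R - r).
Proof.
move=> /(Rk_dense 1)[c cr].
have k0 : k%:Z != 0 by case: k k2.
exists `|(c %% k%:Z)%Z|%N.
have -> : (`|(c %% k%:Z)%Z|%N%:R : rat) - r = (c%:~R - r) - k%:R * (c %/ k%:Z)%Z%:~R.
  rewrite pmulrn gez0_abs ?modz_ge0// /modz rmorphB rmorphM /= -pmulrn; ring.
apply: JkB => //; exists (c %/ k%:Z)%Z%:~R; first exact: Rk_int.
by rewrite expr1.
Qed.

Lemma Rk_exp x m : Rk x -> Rk (x ^+ m).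
Proof. by move=> Rx; elim: m => [|m IH]; [exact: Rk1|rewrite exprS; exact: RkM]. Qed.

Lemma Rk_ym z m : Rk z -> Rk (ym z m).
Proof.
move=> Rz; elim: m => [|m IH]; first exact: Rk0.
by rewrite [ym _ _]/=; apply: RkD => //; apply: Rk_exp; apply: RkD => //; exact: Rk1.
Qed.

Lemma ymD z m l : ym z (m + l) = ym z m + (1 + z) ^+ m * ym z l.
Proof.
elim: l => [|l IH]; first by rewrite addn0 /= mulr0 addr0.
by rewrite addnS [ym _ _.+1]/= IH [ym _ l.+1]/= mulrDr addrA -exprD.
Qed.

Lemma ymM z m l : ym z (l * m) = ym z l * ym (ym z l * z) m.
Proof.
elim: m => [|m IH]; first by rewrite muln0 /= mulr0.
by rewrite mulnS addnC ymD IH [ym _ m.+1]/= ymE mulrDr -exprM (mulrC _ (ym z l)).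
Qed.

Lemma exp_cong a z m : Jk a z -> Jk a ((1 + z) ^+ m - 1).
Proof.
move=> Jz; rewrite -ymE addrAC subrr add0r; apply: JkM => //.
by apply: Rk_ym; exact: Jk_sub Jz.
Qed.

Lemma ym_cong a z m : Jk a z -> Jk a (ym z m - m%:R).
Proof.
move=> Jz; elim: m => [|m IH]; first by rewrite subrr; exact: Jk0.
rewrite [ym _ _]/= -natr1 opprD addrACA; apply: JkD => //; exact: exp_cong.
Qed.

(** One more factor k in the exponent multiplies Y = ym z (k^s u) by ym (Y z) k, which is k modulo
    k^2 since z is divisible by k^2. For z divisible by k only, the error would be of the order of k
    itself; hence the levels a > 1 below. *)
Lemma ym_expk z s u : Jk 2 z -> Jk s.+1 (ym z (k ^ s * u) - (k ^ s * u)%:R).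
Proof.
move=> Jz; elim: s => [|s IH].
  by rewrite mul1n; apply: Jk_le (ym_cong u Jz).
rewrite expnS -mulnA mulnC ymM; set Y := ym z _ in IH *.
have RY : Rk Y by apply: Rk_ym; exact: Jk_sub Jz.
have [b Rb bE] := ym_cong k (JkM RY Jz).
have [c Rc cE] := IH; move/eqP: bE; rewrite subr_eq => /eqP ->.
move/eqP: cE; rewrite subr_eq => /eqP ->; rewrite !natrM !natrX.
exists (c + b * k%:R * c + b * u%:R).
  by do ![apply: RkD|apply: RkM] => //; exact: (Rk_int _%:Z).
by rewrite !exprS; ring.
Qed.

(* [(1 + z) ^ m = 1 + ym z m * z], so this is the density of the powers of
   [1 + z] in the k-adic neighbourhood [1 + z R] of 1 *)
Lemma ym_dense z y s : Jk 2 z -> Rk y -> exists m, Jk s (ym z m - y).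
Proof.
move=> Jz Ry; elim: s => [|s [m [x Rx mE]]].
  exists 0%N; exists (- y); first exact: RkN.
  by rewrite /= mul1r sub0r.
(* Approximation digit by digit: the error k^s x is removed modulo k^(s+1) by adding k^s u to the
   exponent, u being congruent to - x modulo k. *)
have [u [v Rv uE]] := Rk_dense_nat (RkN Rx).
exists (m + k ^ s * u)%N; rewrite ymD.
have [b Rb bE] := ym_expk s u Jz.
have [c Rc cE] := exp_cong m (Jk_le (isT : (1 <= 2)%N) Jz).
move/eqP: bE; rewrite subr_eq => /eqP ->.
move/eqP: cE; rewrite subr_eq => /eqP ->.
rewrite natrM natrX; have -> : ym z m = k%:R ^+ s * x + y by rewrite -mE subrK.
have -> : u%:R = k%:R * v - x by rewrite -[LHS](subrK (- x)) uE expr1.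
exists (v + b + c * (k%:R * b + k%:R * v - x)).
  by do ![apply: RkD|apply: RkM|apply: RkN] => //; exact: (Rk_int _%:Z).
by rewrite expr1 exprS; ring.
Qed.

End KadicRationals.

Lemma tors_dvd (R : realType) (G : groupType) (H : hilb R) (pi : hrep G H) (k l : nat) x z :
  tors pi k x z -> tors pi (l * k) x z.
Proof.
move=> tz e e0; have [s S] := tz _ e0; exists s => j.
by rewrite expnMn mulnA; exact: S.
Qed.

Lemma le_eps (R : realType) (x y : R) : (forall e, 0 < e -> x <= y + e) -> x <= y.
Proof. by move=> h; apply/ler_addgt0Pr. Qed.

(** * The invariant space and the limits of one-parameter groups *)

Section SLTorsion.
Variables (R : realType) (n : nat) (n3 : (3 <= n)%N) (H : hilb R) (pi : hrep (SL int n) H).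
Variable k : nat.
Local Notation G := (SL int n).
Implicit Types (i j l m : 'I_n) (z u v w : H) (g : G).

Definition slZ : set H := [set z | forall i j, i != j -> tors pi k (el i j 1) z].
Local Notation Z := slZ.

Lemma slZ_el z i j a : Z z -> i != j -> tors pi k (el i j a) z.
Proof.
move=> Zz ij; case: a => a.
  have -> : el i j a = (el i j 1 ^+ a)%g by rewrite el_exp// natz.
  exact: tors_exp (Zz _ _ ij).
have -> : el i j (Negz a) = ((el i j 1 ^+ a.+1)^-1)%g.
  by rewrite el_exp// el_inv// NegzE natz.
by apply: tors_inv; exact: tors_exp (Zz _ _ ij).
Qed.

Lemma slZ_conj_noopp z i j l m a : Z z -> i != j -> l != m -> ~~ ((l == j) && (m == i)) ->
  tors pi k (el l m 1 ^ el i j a)%g z.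
Proof.
move=> Zz ij lm; have [lj|lj] := eqVneq l j.
  subst l => /= mi; rewrite el_heisV//; last by rewrite eq_sym.
  apply: tors_mul; [|apply: slZ_el => //; by rewrite eq_sym|exact: slZ_el].
  by apply: el_commute; rewrite // eq_sym.
move=> _; have [mi|mi] := eqVneq m i.
  subst m; rewrite el_heis//.
  apply: tors_mul; [|exact: slZ_el|exact: slZ_el].
  by apply: el_commute; rewrite // eq_sym.
rewrite commute_conj; first exact: slZ_el.
by apply: el_commute; rewrite // eq_sym.
Qed.

(** For opposite roots, [el j i 1] is the commutator of [el j p 1] and [el p i 1]. Their conjugates
    are covered by [slZ_conj_noopp], and [tors_heis] passes to the commutator. *)
Lemma slZ_conj z i j l m a : Z z -> i != j -> l != m -> tors pi k (el l m 1 ^ el i j a)%g z.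
Proof.
move=> Zz ij lm; have [/andP[/eqP lj /eqP mi]|no] := boolP ((l == j) && (m == i)); last first.
  exact: slZ_conj_noopp.
subst l m; have [p /andP[pi' pj]] := ord_third i j n3.
have ip : i != p by rewrite eq_sym.
have jp : j != p by rewrite eq_sym.
have ji : j != i by rewrite eq_sym.
have c1 : commute (el j i 1) (el j p 1) by apply: el_commute; rewrite // eq_sym.
have c2 : commute (el j i 1) (el p i 1) by apply: el_commute; rewrite // eq_sym.
apply: (@tors_heis R _ H pi k (el j p 1 ^ el i j a)%g (el p i 1 ^ el i j a)%g).
- by rewrite -conjJg -conjMg el_heis ?mulr1// eq_sym.
- by apply/commgP/conjg_fixP; rewrite -conjJg (commute_conj c1).
- by apply/commgP/conjg_fixP; rewrite -conjJg (commute_conj c2).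
- by apply: slZ_conj_noopp => //; rewrite negb_and pi' orbT.
- by apply: slZ_conj_noopp => //; rewrite negb_and pj.
Qed.

Lemma slZ_act g z : Z z -> Z (pi g z).
Proof.
pose K := [set g : G | forall z, Z z -> Z (pi g z) /\ Z (pi g^-1%g z)].
suff : K g by move=> Kg Zz; exact: (Kg _ Zz).1.
have K_el i j a : i != j -> forall z, Z z -> Z (pi (el i j a) z).
  by move=> ij {}z Zz l m lm; apply/torsJ; exact: slZ_conj.
have sgK : is_subgroup K.
  split; first by move=> z' Zz'; rewrite invg1 !hact1.
  - move=> x y Kx Ky z' Zz'; rewrite invgM !hactM; split.
      by apply: (Kx _ _).1; exact: (Ky _ _).1.
    by apply: (Ky _ _).2; exact: (Kx _ _).2.
  - by move=> x Kx z' Zz'; rewrite invgK; have [? ?] := Kx _ Zz'.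
by apply: SL_gen => // i j ij z' Zz'; rewrite el_inv//; split; apply: K_el.
Qed.

Lemma slZ_sub : subspace Z.
Proof.
have sT i j := tors_sub pi k (el i j 1).
split.
- by move=> i j _; exact: sub0.
- by move=> u v Zu Zv i j ij; apply: (subD (sT i j)); [exact: Zu|exact: Zv].
- by move=> a u Zu i j ij; apply: (subZ (sT i j)); exact: Zu.
- move=> v vE i j ij; apply: (sub_closed (sT i j)) => e e0.
  by have [w Zw vw] := vE e e0; exists w => //; exact: Zw.
Qed.

Hypothesis k2 : (1 < k)%N.
Local Notation Rk := (Rk k).
Local Notation Jk := (Jk k).

Lemma slZ_cont i j z e : i != j -> Z z -> 0 < e ->
  exists s, forall c : int, Jk s c%:~R -> hn (pi (el i j c) z - z) <= e.
Proof.
move=> ij Zz e0; have [s S] := Zz i j ij e e0; exists s => c /(Jk_int).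
move=> /dvdzP[q ->]; have P (a : nat) : hn (pi (el i j (a%:Z * (k ^ s)%:Z)) z - z) <= e.
  have -> : el i j (a%:Z * (k ^ s)%:Z) = (el i j 1 ^+ (a * k ^ s))%g.
    by rewrite el_exp// -PoszM natz.
  exact: S.
case: q => a //; rewrite NegzE mulNr -el_inv//.
rewrite -(hn_act pi (el i j (a.+1%:Z * (k ^ s)%:Z))) hactB hactVK hnB; exact: P.
Qed.

Lemma slZ_cont2 i j z e : i != j -> Z z -> 0 < e ->
  exists s, forall c c' : int, Jk s (c%:~R - c'%:~R) -> hn (pi (el i j c) z - pi (el i j c') z) <= e.
Proof.
move=> ij Zz e0; have [s S] := slZ_cont ij Zz e0; exists s => c c' cc.
rewrite -(hn_act pi (el i j c')^-1%g) hactB hactK -hactM el_inv// el_add//.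
by apply: S; rewrite rmorphD rmorphN /= addrC.
Qed.

Definition zlim i j (r : rat) z w := forall e : R, 0 < e ->
  exists s, forall c : int, Jk s (c%:~R - r) -> hn (pi (el i j c) z - w) <= e.

Lemma zlim_unique i j r z w w' : Rk r -> zlim i j r z w -> zlim i j r z w' -> w = w'.
Proof.
move=> Rr L L'; apply/eqP; rewrite -subr_eq0; apply/eqP/hn_eq0/eqP.
rewrite eq_le sqrtr_ge0 andbT; apply: le_eps => e e0; rewrite add0r.
have e2 : 0 < e / 2 by lra.
have [s S] := L _ e2; have [s' S'] := L' _ e2.
have [c cr] := Rk_dense (maxn s s') Rr.
rewrite (_ : e = e / 2 + e / 2); last by lra.
apply: (le_trans (hn_triangle (pi (el i j c) z) _ _)); apply: lerD.
  by rewrite hnB; apply: S; apply: Jk_le cr; exact: leq_maxl.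
by apply: S'; apply: Jk_le cr; exact: leq_maxr.
Qed.

(** Integers congruent to r modulo higher and higher powers of k give a Cauchy sequence of vectors
    by [slZ_cont2]. *)
Lemma zlim_exists i j r z : i != j -> Rk r -> Z z -> exists w, zlim i j r z w.
Proof.
move=> ij Rr Zz; have cE s := Rk_dense s Rr.
pose c s := xget 0 [set c : int | Jk s (c%:~R - r)].
have cP s : Jk s ((c s)%:~R - r).
  by have [c0 c0P] := cE s; apply: (@xgetPex _ 0 [set c : int | Jk s (c%:~R - r)]); exists c0.
have close s p q : (s <= p)%N -> (s <= q)%N -> Jk s ((c p)%:~R - (c q)%:~R).
  move=> sp sq; rewrite (_ : _ - _ = ((c p)%:~R - r) - ((c q)%:~R - r)); last by ring.
  by apply: JkB => //; [exact: Jk_le sp _ (cP p)|exact: Jk_le sq _ (cP q)].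
have [w wP] : exists l : H, forall e, 0 < e -> exists N : nat, forall t : nat, (N <= t)%N ->
    hn (pi (el i j (c t)) z - l) < e.
  apply: hlim => e e0; have e2 : 0 < e / 2 by lra.
  have [s S] := slZ_cont2 ij Zz e2; exists s => p q sp sq.
  by apply: (le_lt_trans (S _ _ (close _ _ _ sp sq))); lra.
exists w => e e0; have e2 : 0 < e / 2 by lra.
have [s S] := slZ_cont2 ij Zz e2; have [N NP] := wP _ e2; exists s => c' c'r.
rewrite (_ : e = e / 2 + e / 2); last by lra.
apply: (le_trans (hn_triangle (pi (el i j (c (maxn s N))) z) _ _)); apply: lerD.
  apply: S; rewrite (_ : _ - _ = (c'%:~R - r) - ((c (maxn s N))%:~R - r)); last by ring.
  by apply: JkB => //; apply: Jk_le (cP _); exact: leq_maxl.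
by apply/ltW/NP; exact: leq_maxr.
Qed.

Definition Ez i j r z : H := xget z [set w | zlim i j r z w].

Lemma EzP i j r z : i != j -> Rk r -> Z z -> zlim i j r z (Ez i j r z).
Proof.
move=> ij Rr Zz; have [w wP] := zlim_exists ij Rr Zz.
by apply: (@xgetPex _ z [set w | zlim i j r z w]); exists w.
Qed.

Lemma EzE i j r z w : Rk r -> zlim i j r z w -> i != j -> Z z -> Ez i j r z = w.
Proof. by move=> Rr L ij Zz; apply: (zlim_unique Rr _ L); exact: EzP. Qed.

Lemma Ez_in i j r z : i != j -> Rk r -> Z z -> Z (Ez i j r z).
Proof.
move=> ij Rr Zz; apply: (sub_closed slZ_sub) => e e0.
have e2 : 0 < e / 2 by lra.
have [s S] := EzP ij Rr Zz e2; have [c cr] := Rk_dense s Rr.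
exists (pi (el i j c) z); first exact: slZ_act.
by rewrite hnB; apply: (le_lt_trans (S _ cr)); lra.
Qed.

Lemma Ez_int i j (c : int) z : i != j -> Z z -> Ez i j c%:~R z = pi (el i j c) z.
Proof.
move=> ij Zz; apply: EzE => //; first exact: Rk_int.
move=> e e0; have [s S] := slZ_cont2 ij Zz e0; exists s => c' c'c; exact: S.
Qed.

Lemma Ez_add i j r r' z : i != j -> Rk r -> Rk r' -> Z z ->
  Ez i j r (Ez i j r' z) = Ez i j (r + r') z.
Proof.
move=> ij Rr Rr' Zz; apply/esym/EzE => //; first exact: RkD.
move=> e e0; have e2 : 0 < e / 2 by lra.
have [s S] := EzP ij Rr' Zz e2; have [s' S'] := EzP ij Rr (Ez_in ij Rr' Zz) e2.
exists (maxn s s') => c cr; have [c' c'r] := Rk_dense (maxn s s') Rr'.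
rewrite (_ : e = e / 2 + e / 2); last by lra.
have -> : el i j c = (el i j (c - c') * el i j c')%g by rewrite el_add// subrK.
rewrite hactM; apply: (le_trans (hn_triangle (pi (el i j (c - c')) (Ez i j r' z)) _ _)).
apply: lerD; first by rewrite -hactB hn_act; apply: S; apply: Jk_le c'r; exact: leq_maxl.
apply: S'; rewrite rmorphB /= (_ : _ - r = (c%:~R - (r + r')) - (c'%:~R - r')); last by ring.
by apply: Jk_le (JkB cr c'r); exact: leq_maxr.
Qed.

Lemma Ez0 i j z : i != j -> Z z -> Ez i j 0 z = z.
Proof. by move=> ij Zz; rewrite (_ : 0 = (0 : int)%:~R)// Ez_int// el0// hact1. Qed.

Lemma Ez_nonexp i j r u v : i != j -> Rk r -> Z u -> Z v ->
  hn (Ez i j r u - Ez i j r v) <= hn (u - v).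
Proof.
move=> ij Rr Zu Zv; apply: le_eps => e e0; have e2 : 0 < e / 2 by lra.
have [s S] := EzP ij Rr Zu e2; have [s' S'] := EzP ij Rr Zv e2.
have [c cr] := Rk_dense (maxn s s') Rr.
have cu := S c (Jk_le (leq_maxl _ _) cr); have cv := S' c (Jk_le (leq_maxr _ _) cr).
apply: (le_trans (hn_triangle (pi (el i j c) u) _ _)).
have := hn_triangle (pi (el i j c) v) (pi (el i j c) u) (Ez i j r v).
rewrite -hactB hn_act; move: cu cv; rewrite (hnB (pi _ u)); lra.
Qed.

Lemma Ez_cont i j z e : i != j -> Z z -> 0 < e ->
  exists s, forall r r', Rk r -> Rk r' -> Jk s (r' - r) -> hn (Ez i j r' z - Ez i j r z) <= e.
Proof.
move=> ij Zz e0; have e3 : 0 < e / 3 by lra.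
have [s S] := slZ_cont2 ij Zz e3; exists s => r r' Rr Rr' rr.
have [t T] := EzP ij Rr Zz e3; have [t' T'] := EzP ij Rr' Zz e3.
have [c cr] := Rk_dense (maxn s t) Rr; have [c' cr'] := Rk_dense (maxn s t') Rr'.
have h1 := T c (Jk_le (leq_maxr _ _) cr); have h2 := T' c' (Jk_le (leq_maxr _ _) cr').
have h3 : hn (pi (el i j c') z - pi (el i j c) z) <= e / 3.
  apply: S; rewrite (_ : _ - _ = (c'%:~R - r') - (c%:~R - r) + (r' - r)); last by ring.
  apply: JkD => //; apply: JkB; [exact: Jk_le (leq_maxl _ _) _ cr'|exact: Jk_le (leq_maxl _ _) _ cr].
apply: (le_trans (hn_triangle (pi (el i j c') z) _ _)).
have := hn_triangle (pi (el i j c) z) (pi (el i j c') z) (Ez i j r z).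
by move: h1 h2 h3; rewrite (hnB (pi (el i j c') z) (Ez _ _ _ _)); lra.
Qed.


End SLTorsion.

(** * Steinberg relations in the limit and the fixed vector *)

Section SteinbergLimits.
Variables (R : realType) (n : nat) (n3 : (3 <= n)%N) (H : hilb R) (pi : hrep (SL int n) H).
Variables (k : nat) (k2 : (1 < k)%N).
Local Notation Z := (slZ pi k).
Local Notation Rk := (Rk k).
Local Notation Jk := (Jk k).
Local Notation T := (ziso Z).
Local Notation Ez := (Ez pi k).
Implicit Types (i j l m : 'I_n) (z u v w : H) (r : rat).

Let Ef i j r x := if pselect (Z x) is left _ then Ez i j r x else x.

Let EfE i j r x : Z x -> Ef i j r x = Ez i j r x.
Proof. by rewrite /Ef; case: pselect. Qed.

Let EfK i j r : i != j -> Rk r -> cancel (Ef i j r) (Ef i j (- r)).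
Proof.
move=> ij Rr x; have [Zx|nZx] := pselect (Z x); last by rewrite /Ef; do 2 case: pselect.
rewrite (EfE _ _ _ Zx) EfE; last exact: (Ez_in n3).
by rewrite (Ez_add n3)// ?addNr ?Ez0//; exact: RkN.
Qed.

Definition Egen i j r (ijr : i != j /\ Rk r) : T.
Proof.
case: ijr => ij Rr; exists (Ef i j r) (Ef i j (- r)).
- exact: EfK.
- by rewrite -{2}[r]opprK; apply: EfK => //; exact: RkN.
- by move=> x nZx; rewrite /Ef; case: pselect.
- by move=> x Zx; rewrite EfE//; exact: (Ez_in n3).
- by move=> x Zx; rewrite EfE//; apply: (Ez_in n3) => //; exact: RkN.
- move=> x y Zx Zy; rewrite !EfE//; apply/eqP; rewrite eq_le Ez_nonexp//=.
  have RNr := RkN Rr.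
  have xE u : Z u -> u = Ez i j (- r) (Ez i j r u) by move=> Zu; rewrite (Ez_add n3)// addNr Ez0.
  by rewrite {1}(xE x)// {1}(xE y)//; apply: Ez_nonexp => //; exact: (Ez_in n3).
Defined.

Definition E i j r : T := if pselect (i != j /\ Rk r) is left h then Egen h else 1%g.

Lemma EE i j r x : i != j -> Rk r -> Z x -> E i j r x = Ez i j r x.
Proof.
move=> ij Rr Zx; rewrite /E; case: pselect => [h|[]//].
by rewrite /Egen; case: h => ? ? /=; exact: EfE.
Qed.

Lemma E_int i j (c : int) x : i != j -> Z x -> E i j c%:~R x = pi (el i j c) x.
Proof. by move=> ij Zx; rewrite EE// ?Ez_int//; exact: Rk_int. Qed.

Lemma E_add i j a b : i != j -> Rk a -> Rk b -> E i j (a + b) = (E i j a * E i j b)%g.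
Proof.
move=> ij Ra Rb; apply: ziso_eq => x Zx; rewrite zisoME EE//; last exact: RkD.
by rewrite [E i j b x]EE// [RHS]EE// ?(Ez_add n3)//; exact: (Ez_in n3).
Qed.

Local Notation word := (seq ('I_n * 'I_n * rat)).

Definition wd (l : word) : T := (\prod_(p <- l) E p.1.1 p.1.2 p.2)%g.

(** Letterwise k-adic closeness, which also records that the letters are admissible; [near 0 l l]
    says just that about [l]. *)
Inductive near (s : nat) : word -> word -> Prop :=
| near_nil : near s [::] [::]
| near_cons i j r r' (l l' : word) : i != j -> Rk r -> Rk r' -> Jk s (r' - r) ->
    near s l l' -> near s ((i, j, r) :: l) ((i, j, r') :: l').

Lemma near_le s t (l l' : word) : (s <= t)%N -> near t l l' -> near s l l'.
Proof.
move=> st; elim=> [|i j r r' {}l {}l' ij Rr Rr' Jr _ IH]; first exact: near_nil.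
by apply: near_cons => //; exact: Jk_le Jr.
Qed.

Lemma wd_cont (l : word) z e : near 0 l l -> Z z -> 0 < e ->
  exists s, forall l' : word, near s l l' -> hn (wd l' z - wd l z) <= e.
Proof.
move=> + Zz; elim: l e => [|[[i j] r] l IH] e nl e0.
  exists 0%N => l' nl'; inversion nl'; subst.
  by rewrite subrr /hn dot0l sqrtr0 ltW.
inversion nl; subst; have e2 : 0 < e / 2 by lra.
have [s S] := IH _ ltac:(eassumption) e2.
have Zl : Z (wd l z) := zf_in (wd l) Zz.
have ij : i != j by [].
have [t St] := Ez_cont ij Zl e2.
exists (maxn s t) => l' nl'; inversion nl'; subst.
rewrite /wd !big_cons !zisoME -!/(wd _) /= (_ : e = e / 2 + e / 2); last by lra.
set y := wd _ z; set y' := wd _ z.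
have Zy : Z y := zf_in _ Zz.
have Zy' : Z y' := zf_in _ Zz.
apply: (le_trans (hn_triangle (E i j r' y') _ _)); apply: lerD.
  by rewrite zf_iso//; apply: S; apply: (near_le (leq_maxl s t)).
rewrite !EE//; apply: St => //; by apply: (Jk_le (leq_maxr s t)).
Qed.

(** Relations pass to k-adic limits, because a word moves each vector of [Z] continuously in its
    letters. Integer letters transport the relations of SL_n(Z); letters [ym z m] give [E_hst]. *)
Lemma word_eq (l1 l2 : word) : near 0 l1 l1 -> near 0 l2 l2 ->
  (forall s, exists l1' l2' : word, [/\ near s l1 l1', near s l2 l2' & wd l1' = wd l2']) ->
  wd l1 = wd l2.
Proof.
move=> n1 n2 H12; apply: ziso_eq => z Zz; apply/eqP; rewrite -subr_eq0; apply/eqP/hn_eq0/eqP.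
rewrite eq_le sqrtr_ge0 andbT; apply: le_eps => e e0; rewrite add0r.
have e2 : 0 < e / 2 by lra.
have [s S] := wd_cont n1 Zz e2; have [t St] := wd_cont n2 Zz e2.
have [l1' [l2' [m1 m2 eq12]]] := H12 (maxn s t).
rewrite (_ : e = e / 2 + e / 2); last by lra.
apply: (le_trans (hn_triangle (wd l1' z) _ _)); apply: lerD.
  by rewrite hnB; apply: S; exact: near_le (leq_maxl _ _) m1.
by rewrite eq12; apply: St; exact: near_le (leq_maxr _ _) m2.
Qed.

Let wd2 p q : wd [:: p; q] = (E p.1.1 p.1.2 p.2 * E q.1.1 q.1.2 q.2)%g.
Proof. by rewrite /wd !big_cons big_nil mulg1. Qed.
Let wd3 p q t : wd [:: p; q; t] =
  (E p.1.1 p.1.2 p.2 * (E q.1.1 q.1.2 q.2 * E t.1.1 t.1.2 t.2))%g.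
Proof. by rewrite /wd !big_cons big_nil mulg1. Qed.
Let wd4 p q t o : wd [:: p; q; t; o] =
  (E p.1.1 p.1.2 p.2 * (E q.1.1 q.1.2 q.2 * (E t.1.1 t.1.2 t.2 * E o.1.1 o.1.2 o.2)))%g.
Proof. by rewrite /wd !big_cons big_nil mulg1. Qed.

Let J00 : Jk 0 0. Proof. exact: Jk0. Qed.

Lemma E_comm i j l m a b : i != j -> l != m -> j != l -> m != i -> Rk a -> Rk b ->
  commute (E i j a) (E l m b).
Proof.
move=> ij lm jl mi Ra Rb; rewrite /commute.
have := @word_eq [:: (i, j, a); (l, m, b)] [:: (l, m, b); (i, j, a)].
rewrite !wd2 /=; apply; do ?[apply: near_cons; rewrite ?subrr//|exact: near_nil].
move=> s; have [c ca] := Rk_dense s Ra; have [d db] := Rk_dense s Rb.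
exists [:: (i, j, c%:~R); (l, m, d%:~R)], [:: (l, m, d%:~R); (i, j, c%:~R)]; split.
- by do ?[apply: near_cons => //|exact: near_nil|exact: Rk_int].
- by do ?[apply: near_cons => //|exact: near_nil|exact: Rk_int].
rewrite !wd2 /=; apply: ziso_eq => z Zz; rewrite !zisoME.
rewrite (E_int _ lm Zz) (E_int _ ij Zz) !E_int//; [|exact: slZ_act|exact: slZ_act].
by rewrite -!hactM el_commute.
Qed.

Lemma E_heis i j l a b : i != j -> j != l -> i != l -> Rk a -> Rk b ->
  (E i j a ^ E j l b = E i l (a * b) * E i j a)%g.
Proof.
move=> ij jl il Ra Rb; have Rab := RkM Ra Rb.
suff : (E i j a * E j l b = E j l b * (E i l (a * b) * E i j a))%g.
  by move=> e; rewrite conjgE e mulKg.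
have := @word_eq [:: (i, j, a); (j, l, b)] [:: (j, l, b); (i, l, a * b); (i, j, a)].
rewrite wd2 wd3 /=; apply; do ?[apply: near_cons; rewrite ?subrr//|exact: near_nil].
move=> s; have [c ca] := Rk_dense s Ra; have [d db] := Rk_dense s Rb.
exists [:: (i, j, c%:~R); (j, l, d%:~R)], [:: (j, l, d%:~R); (i, l, (c * d)%:~R); (i, j, c%:~R)].
have Jcd : Jk s ((c * d)%:~R - a * b).
  rewrite rmorphM /= (_ : _ - _ = c%:~R * (d%:~R - b) + b * (c%:~R - a)); last by ring.
  by apply: JkD; apply: JkM => //; exact: Rk_int.
split.
- by do ?[apply: near_cons => //|exact: near_nil|exact: Rk_int].
- by do ?[apply: near_cons => //|exact: near_nil|exact: Rk_int].
rewrite wd2 wd3 /=; apply: ziso_eq => z Zz; rewrite !zisoME.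
have Za g x : Z x -> Z (pi g x) by exact: slZ_act.
rewrite (E_int _ jl Zz) (E_int _ ij Zz) (E_int _ ij (Za _ _ Zz)) (E_int _ il (Za _ _ Zz)).
by rewrite (E_int _ jl (Za _ _ (Za _ _ Zz))) -!hactM -?mulgA -el_heis// -conjgC.
Qed.

Section Level.
Variable a : nat.
Hypothesis a2 : (1 < a)%N.
Local Notation J := (Jk a).

Let a0 : (0 < a)%N. Proof. exact: ltnW. Qed.
Let JV s : J s -> Rk (1 + s)^-1. Proof. by move=> Js; have [] := Jk_unit k2 a0 Js. Qed.
Let J1 s : J s -> 1 + s != 0. Proof. by move=> Js; have [] := Jk_unit k2 a0 Js. Qed.
Let JR : J `<=` Rk := @Jk_sub k a.
Let JD := @JkD k a.
Let JM := @JkM k a.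
Let R1 := Rk1 k.
Let RD := @RkD k.
Let RN := @RkN k.
Let RM := @RkM k.

(* For [y = ym z m] this is [hst_ym]; these values are dense and both sides are continuous. *)
Lemma E_hst i j (y z : rat) : i != j -> Rk y -> J z -> hst E i j y z = eta E i j (y * z).
Proof.
move=> ij Ry Jz; have ji : j != i by rewrite eq_sym.
have Rz : Rk z := JR Jz.
have tJ y' : Rk y' -> J (y' * z) by move=> Ry'; exact: JM.
pose t y' := 1 + y' * z.
have RV y' : Rk y' -> Rk (t y')^-1 by move=> Ry'; exact: JV (tJ _ Ry').
have t0 y' : Rk y' -> t y' != 0 by move=> Ry'; exact: J1 (tJ _ Ry').
pose l1 y' : word := [:: (j, i, - (z / t y')); (i, j, y'); (j, i, z); (i, j, - (y' / t y'))].
pose l2 y' : word := [:: (j, i, - (y' * z / t y')); (i, j, 1); (j, i, y' * z); (i, j, - (1 / t y'))].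
have l1E y' : wd (l1 y') = hst E i j y' z by rewrite hstE wd4.
have l2E y' : wd (l2 y') = eta E i j (y' * z) by rewrite /eta hstE wd4 /= /t (mul1r (y' * z)).
rewrite -l1E -l2E.
have nr s y' : Rk y' -> Jk s (y' - y) -> near s (l1 y) (l1 y') /\ near s (l2 y) (l2 y').
  move=> Ry' Jy.
  have Jt : Jk s ((t y')^-1 - (t y)^-1).
    have -> : (t y')^-1 - (t y)^-1 = (- z * (t y)^-1 * (t y')^-1) * (y' - y).
      move: (t0 y Ry) (t0 y' Ry'); rewrite /t => u0 u0'; field; by rewrite u0'.
    by apply: JkM => //; do ![apply: RM|apply: RN|apply: RV] => //.
  have Jyt : Jk s (y' / t y' - y / t y).
    rewrite (_ : _ - _ = y' * ((t y')^-1 - (t y)^-1) + (t y)^-1 * (y' - y)); last by ring.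
    by apply: JkD; apply: JkM => //; exact: RV.
  have RzV y'' : Rk y'' -> Rk (- (z / t y'')) by move=> R''; apply/RN/RM => //; exact: RV.
  have RyV y'' : Rk y'' -> Rk (- (y'' / t y'')) by move=> R''; apply/RN/RM => //; exact: RV.
  have RyzV y'' : Rk y'' -> Rk (- (y'' * z / t y'')).
    by move=> R''; apply/RN/RM; [exact: RM|exact: RV].
  have R1V y'' : Rk y'' -> Rk (- (1 / t y'')) by move=> R''; apply/RN/RM => //; exact: RV.
  split.
    apply: near_cons => //; [exact: RzV|exact: RzV| |].
      rewrite -opprD -mulrBr; apply: JkN; exact: JkM.
    apply: near_cons => //; apply: near_cons => //; first by rewrite subrr; exact: Jk0.
    apply: near_cons; [by []|exact: RyV|exact: RyV| |exact: near_nil].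
    by rewrite -opprD; exact: JkN.
  apply: near_cons => //; [exact: RyzV|exact: RyzV| |].
    rewrite -opprD; apply: JkN; rewrite (_ : _ - _ = z * (y' / t y' - y / t y)); first exact: JkM.
    by ring.
  apply: near_cons => //; first by rewrite subrr; exact: Jk0.
  apply: near_cons => //; [exact: RM|exact: RM| |].
    by rewrite -mulrBl mulrC; exact: JkM.
  apply: near_cons; [by []|exact: R1V|exact: R1V| |exact: near_nil].
  by rewrite -opprD; apply: JkN; rewrite -mulrBr; exact: JkM.
apply: word_eq.
- by have [] := nr 0%N y Ry; rewrite ?subrr.
- by have [] := nr 0%N y Ry; rewrite ?subrr.
move=> s; have [m mE] := ym_dense k2 s (Jk_le a2 Jz) Ry.
have Rm : Rk (ym z m) by exact: Rk_ym.
have [nr1 nr2] := nr s _ Rm mE.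
exists (l1 (ym z m)), (l2 (ym z m)); split => //.
by rewrite l1E l2E; apply: (hst_ym n3 R1 RD RN RM JR JD JM JV J1 E_add E_comm E_heis).
Qed.

Local Notation W := (words (gens E J n)).

Lemma W_symm x : W x -> W x^-1%g.
Proof. exact: (words_symm n3 R1 RD RN RM JR JD JM JV J1 E_add E_comm E_heis E_hst). Qed.

Lemma W_normal l m b x : l != m -> Rk b -> W x -> W (x ^ E l m b)%g.
Proof.
exact: (words_normal n3 R1 RD RN RM JR JD JM JV J1 E_add E_comm E_heis (Jk0 k a) E_hst).
Qed.

Lemma W_bound (N : T -> R) (eps : R) x :
  (forall x y, N (x * y)%g <= N x + N y) -> N 1%g <= 0 -> 0 <= eps ->
  (forall g, gens E J n g -> N g <= eps) ->
  W x -> N x <= n%:R * eps + n%:R * ((n%:R * eps) *+ 2).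
Proof.
move=> NM N1 e0 Ne; have := @words_bound n n3 T E Rk J R1 RD RN RM JR JD JM JV J1 E_add
  E_comm E_heis (Jk0 k a) E_hst R N eps n x NM N1 e0 Ne (leqnn n); exact.
Qed.

Definition slY : set H := [set y | Z y /\ forall x, W x -> x y = y].

(** The level group is normalised by every [E l m b] with b in [Rk], in particular by the elementary
    integer matrices, so its fixed vectors are permuted. *)
Lemma slY_act g y : slY y -> slY (pi g y).
Proof.
pose K := [set g : SL int n | forall y, slY y -> slY (pi g y) /\ slY (pi g^-1%g y)].
suff : K g by move=> Kg Yy; exact: (Kg _ Yy).1.
have K_el i j (b : int) y' : i != j -> slY y' -> slY (pi (el i j b) y').
  move=> ij [Zy yW]; split; first exact: slZ_act.
  move=> x Wx; rewrite -(E_int _ ij Zy) -zisoME conjgC zisoME yW//.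
  by apply: W_normal => //; exact: Rk_int.
have sgK : is_subgroup K.
  split; first by move=> z' Zz'; rewrite invg1 !hact1.
  - move=> x y' Kx Ky z' Zz'; rewrite invgM !hactM; split.
      by apply: (Kx _ _).1; exact: (Ky _ _).1.
    by apply: (Ky _ _).2; exact: (Kx _ _).2.
  - by move=> x Kx z' Zz'; rewrite invgK; have [? ?] := Kx _ Zz'.
by apply: SL_gen => // i j ij z' Zz'; rewrite el_inv//; split; apply: K_el.
Qed.

(* The fixer of [slY] is normal and contains all [el i j (k ^ a)]. *)
Lemma slY_fixer : let K := [set g : SL int n | forall y, slY y -> pi g y = y] in
  is_subgroup K /\ finite_index K.
Proof.
move=> K; have sgK : is_subgroup K.
  split; first by move=> y _; rewrite hact1.
  - by move=> x x' Kx Kx' y Yy; rewrite hactM Kx'// Kx.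
  - by move=> x Kx y Yy; rewrite -{1}(Kx y Yy) hactK.
split => //; apply: (@SL_finite_index n (k ^ a) K n3) => //.
- by rewrite expn_gt0 ltnW.
- by move=> x h Kx y Yy; rewrite conjgE !hactM Kx ?hactK//; exact: slY_act.
move=> i j ij y [Zy yW]; rewrite -E_int// yW//; apply: words_gen.
left; exists i, j, (k ^ a)%:Z%:~R; split => //.
exists 1; first exact: R1.
by rewrite mulr1 -natrX.
Qed.

End Level.

Lemma sl_fixed z0 : Z z0 -> z0 != 0 -> exists K : set (SL int n),
  [/\ is_subgroup K, finite_index K & exists2 c, c != 0 & forall h, K h -> pi h c = c].
Proof.
move=> Zz0 z00.
have hn0 : 0 < hn z0.
  rewrite lt_neqAle sqrtr_ge0 andbT eq_sym; apply: contra_neq z00; exact: hn_eq0.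
(* [W_bound] for generators moving [z0] by at most 3 e gives (3 n + 6 n^2) e <= C e, and e is chosen
   so that C e < |z0|. *)
pose C : R := 3 * n%:R + 6 * n%:R ^+ 2 + 1.
have nR : (0 : R) <= n%:R by [].
have C0 : 0 < C by rewrite /C; move: (n%:R : R) nR => N N0; nra.
pose e := hn z0 / (C + 1); have e0 : 0 < e by rewrite divr_gt0//; lra.
(* The second estimate is for eta_ij(s) = E_ji(- s / t) [E_ij(1) E_ji(s) E_ij(-1)] E_ij(s / t), t =
   1 + s: the bracket moves [z0] as far as E_ji(s) moves E_ij(-1) z0. *)
pose P (p : 'I_n * 'I_n) (s : nat) := p.1 != p.2 -> forall r, Jk s r ->
    hn (Ez p.1 p.2 r z0 - z0) <= e /\
    hn (Ez p.2 p.1 r (Ez p.1 p.2 (-1) z0) - Ez p.1 p.2 (-1) z0) <= e.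
have Pex p : exists s, P p s.
  case: p => i j; rewrite /P /=.
  have [ij|ij] := eqVneq i j; first by exists 0%N.
  have ji : j != i by rewrite eq_sym.
  have RN1 : Rk (-1) by apply: RkN; exact: Rk1.
  have Zw := Ez_in n3 ij RN1 Zz0.
  have [s S] := Ez_cont ij Zz0 e0; have [t St] := Ez_cont ji Zw e0.
  exists (maxn s t) => _ r Jr; split.
    rewrite -[X in _ - X](Ez0 ij Zz0); apply: S; [exact: Rk0|exact: Jk_sub Jr|].
    by rewrite subr0; apply: Jk_le (leq_maxl _ _) _ Jr.
  rewrite -[X in _ - X](Ez0 ji Zw); apply: St; [exact: Rk0|exact: Jk_sub Jr|].
  by rewrite subr0; apply: Jk_le (leq_maxr _ _) _ Jr.
have [f fP] := fin_all_exists Pex.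
(* The summand 2 secures a > 1 even when all [f p] vanish. *)
pose a := (\max_p f p).+2.
have a2 : (1 < a)%N by [].
have fa p : (f p <= a)%N by apply: leqW; apply: leqW; exact: leq_bigmax.
pose N (x : T) := hn (x z0 - z0).
have NM x y : N (x * y)%g <= N x + N y.
  rewrite /N zisoME [leRHS]addrC; apply: (le_trans (hn_triangle (x z0) _ _)).
  by rewrite zf_iso//; exact: (zf_in y Zz0).
have N1 : N 1%g <= 0 by rewrite /N ziso1E subrr /hn dot0l sqrtr0.
have NE i j r : i != j -> Jk a r -> N (E i j r) <= e.
  move=> ij Jr; rewrite /N EE//; last exact: Jk_sub Jr.
  exact: (fP (i, j) ij r (Jk_le (fa _) Jr)).1.
have Ng g : gens E (Jk a) n g -> N g <= 3 * e.
  move=> [[i [j [r [ij _ _ Jr ->]]]]|[i [j [s [ij Js ->]]]]].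
    by apply: (le_trans (NE _ _ _ ij Jr)); move: e0; lra.
  have ji : j != i by rewrite eq_sym.
  have [RV t0] := Jk_unit k2 (isT : (0 < a)%N) Js.
  have Rs := Jk_sub Js.
  have Jst : Jk a (s / (1 + s)) by exact: JkMr.
  have RN1 : Rk (-1) by apply: RkN; exact: Rk1.
  have Zw := Ez_in n3 ij RN1 Zz0.
  have -> : eta E i j s = (E j i (- (s / (1 + s))) *
      ((E i j 1 * (E j i s * E i j (-1))) * E i j (s / (1 + s))))%g.
    rewrite /eta hstE mul1r -!mulgA -E_add//; last exact: Jk_sub Jst.
    by congr (_ * (_ * (_ * E _ _ _)))%g; field.
  apply: (le_trans (NM _ _)); rewrite (_ : 3 * e = e + (e + e)); last by ring.
  apply: lerD; first by apply: NE => //; exact: JkN.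
  apply: (le_trans (NM _ _)); apply: lerD; last exact: NE.
  rewrite /N; have z0E : z0 = E i j 1 (Ez i j (-1) z0).
    by rewrite EE ?(Ez_add n3) ?addrN ?Ez0//; exact: Rk1.
  rewrite {2}z0E !zisoME zf_iso//; last first.
    exact: (zf_in _ (zf_in _ Zz0)).
  rewrite [E i j (-1) z0]EE// EE//.
  exact: (fP (i, j) ij s (Jk_le (fa _) Js)).2.
pose W := words (gens E (Jk a) n).
have NW x : W x -> N x <= C * e.
  move=> Wx; have e3 : 0 <= 3 * e by lra.
  have := W_bound a2 NM N1 e3 Ng Wx; move=> h; apply: (le_trans h).
  by rewrite /C; move: (n%:R : R) nR e0 => M M0 e0'; nra.
have Ce : C * e < hn z0.
  rewrite /e mulrCA gtr_pMr// ltr_pdivrMr; lra.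
pose O := [set o | exists2 x : T, W x & o = x z0].
have sZ := slZ_sub pi k.
have Zmid u v : Z u -> Z v -> Z (2^-1 *: (u + v)).
  by move=> Zu Zv; apply: (subZ sZ); exact: (subD sZ).
have O0 : O z0 by exists 1%g => //; exact: words1.
have OM o : O o -> dot (z0 - o) (z0 - o) <= (C * e) ^+ 2.
  move=> [x Wx ->]; rewrite -hn_sqr hnB lerXn2r ?nnegrE ?sqrtr_ge0//; last exact: NW.
  by apply: mulr_ge0; exact: ltW.
have [rho [c [Zc cO rM cU]]] := circumcenter (sub_closed sZ) Zmid Zz0 O0 OM.
have Wc x : W x -> x c = c.
  move=> Wx; have Zxc : Z (x c) := zf_in x Zc.
  have : dot (c - x c) (c - x c) <= 2 * (rho - rho).
    apply: cU => // _ [y Wy ->].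
    have -> : y z0 = x ((x^-1 * y)%g z0) by rewrite -zisoME mulVKg.
    rewrite -hn_sqr zf_iso//; last exact: (zf_in _ Zz0).
    rewrite hn_sqr; apply: cO; exists (x^-1 * y)%g => //.
    by apply: words_mul => //; exact: W_symm.
  rewrite subrr mulr0 => d0; apply/esym/eqP; rewrite -subr_eq0; apply/eqP/dot_eq0/eqP.
  by rewrite eq_le d0 dot_ge0.
have Yc : slY a c by [].
have [sgK fiK] := slY_fixer a2.
exists [set g : SL int n | forall y, slY a y -> pi g y = y]; split => //.
exists c; last by move=> h; apply.
(* A centre at 0 would be at distance |z0| from the orbit point [z0], beyond the radius bound C
   e. *)
apply/eqP => c0; have : dot (c - z0) (c - z0) <= rho.
  exact: cO.
apply/negP; rewrite -ltNge; apply: (le_lt_trans rM).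
rewrite c0 sub0r -hn_sqr hnN ltr_pXn2r ?nnegrE ?sqrtr_ge0//.
by apply: mulr_ge0; exact: ltW.
Qed.

End SteinbergLimits.

(** The hypothesis says, without projections, that [v] has a component of norm greater than d along
    fixed vectors of each conjugate. The witness is the projection itself for complex
    representations and a centred indicator for actions. *)
Theorem sl_main (R : realType) (n : nat) (H : hilb R) (pi : hrep (SL int n) H) (v : H) (d : R) :
  (3 <= n)%N -> 0 < d ->
  (forall h (i j : 'I_n), i != j -> exists2 w, pi (el i j 1 ^ h)%g w = w &
    d ^+ 2 * dot w w < dot v w ^+ 2) ->
  exists K : set (SL int n),
  [/\ is_subgroup K, finite_index K & exists2 c, c != 0 & forall h, K h -> pi h c = c].
Proof.
move=> n3 d0 hyp; have [k [k0 [z z0 Zz]]] := torsion_vector n3 d0 hyp.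
(* Only 0 < k is known at this point; doubling k gives k > 1 and keeps the vector k-adically
   continuous. *)
have k2 : (1 < 2 * k)%N by lia.
apply: (@sl_fixed R n n3 H pi (2 * k) k2 z _ z0) => i j ij.
exact: (@tors_dvd _ _ _ pi k 2 _ z (Zz i j ij)).
Qed.

(** * Complex representations *)

Section Realification.
Variables (R : realType) (V : hilbertType R).
Local Notation C := R[i].
Implicit Types (u v w : V) (a b : R).

(** A second name for the type, so that it can carry the real scalar multiplication besides the
    complex one. *)
Definition realif : Type := V.
HB.instance Definition _ := GRing.Zmodule.on realif.

Definition rscale (a : R) (v : realif) : realif := (a%:C%C : C) *: (v : V).

Fact rscaleA a b v : rscale a (rscale b v) = rscale (a * b) v.
Proof. by rewrite /rscale scalerA rmorphM. Qed.
Fact rscale1 : left_id 1 rscale.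
Proof. by move=> v; rewrite /rscale rmorph1 scale1r. Qed.
Fact rscaleDr : right_distributive rscale +%R.
Proof. by move=> a u v; rewrite /rscale scalerDr. Qed.
Fact rscaleDl v : {morph rscale^~ v : a b / a + b}.
Proof. by move=> a b; rewrite /rscale rmorphD scalerDl. Qed.
HB.instance Definition _ :=
  GRing.Zmodule_isLmodule.Build R realif rscaleA rscale1 rscaleDr rscaleDl.

Definition rdot u v : R := complex.Re (hdot u v).

Lemma hdotC u v : hdot u v = Num.conj (hdot v u).
Proof. by rewrite (hermC hdot) expr0 mul1r. Qed.

Lemma hnorm_sqr v : hnorm v ^+ 2 = rdot v v.
Proof.
rewrite /rdot -hdot_norm /hnorm !expr2.
have : 0 <= `|v| by exact: normr_ge0.
by case: `|v| => x y; rewrite lecE /= => /andP[/eqP -> _]; rewrite mulr0 subr0.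
Qed.

Lemma hnorm_ge0 v : 0 <= hnorm v.
Proof. by rewrite /hnorm; have : 0 <= `|v| by []; rewrite lecE => /andP[]. Qed.

Lemma norm_hnorm v : `|v| = (hnorm v)%:C%C.
Proof.
rewrite /hnorm; have : 0 <= `|v| by exact: normr_ge0.
by case: `|v| => x y; rewrite lecE /= => /andP[/eqP ->].
Qed.

Fact rdotC u v : rdot u v = rdot v u.
Proof. by rewrite /rdot hdotC; case: (hdot v u). Qed.
Fact rdotDl u v w : rdot (u + v) w = rdot u w + rdot v w.
Proof. by rewrite /rdot linearDl raddfD. Qed.
Fact rdotZl a u v : rdot (rscale a u) v = a * rdot u v.
Proof.
rewrite /rdot /rscale linearZl_LR /=; case: (hdot u v) => x y /=.
by rewrite mul0r subr0.
Qed.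
Fact rdot_ge0 u : 0 <= rdot u u.
Proof. by rewrite -hnorm_sqr sqr_ge0. Qed.
Fact rdot_eq0 u : rdot u u = 0 -> u = 0.
Proof.
rewrite -hnorm_sqr => /eqP; rewrite sqrf_eq0 => /eqP h0.
by apply/normr0_eq0; rewrite norm_hnorm h0.
Qed.
Fact rdot_complete (f : nat -> V) :
  (forall e, 0 < e -> exists N : nat, forall m p, (N <= m)%N -> (N <= p)%N ->
     rdot (f m - f p) (f m - f p) < e) ->
  exists l, forall e, 0 < e -> exists N : nat, forall m, (N <= m)%N ->
     rdot (f m - l) (f m - l) < e.
Proof.
move=> fC.
have lt_norm (e : C) : 0 < e -> 0 < complex.Re e /\ forall u, rdot u u < (complex.Re e) ^+ 2 -> `|u| < e.
  case: e => x y; rewrite ltcE /= => /andP[/eqP -> x0]; split => // u.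
  rewrite -hnorm_sqr ltr_pXn2r ?nnegrE ?hnorm_ge0 ?(ltW x0)// => h.
  by rewrite norm_hnorm ltcE /= eqxx h.
have cf : cvg (f @ \oo).
  apply/cauchy_cvgP/cauchy_exP => e /lt_norm[e0 eP].
  have [N NP] := fC _ (exprn_gt0 2 e0); exists (f N); exists N => // m /= Nm.
  by rewrite -ball_normE /=; apply: eP; exact: NP.
exists (lim (f @ \oo)) => e e0.
have se0 : (0 : C) < (Num.sqrt e)%:C%C by rewrite ltcR sqrtr_gt0.
have /cvgrPdist_lt/(_ _ se0)[N _ NP] := cf.
exists N => m Nm; have := NP m Nm; rewrite distrC norm_hnorm ltcR => h.
by rewrite -hnorm_sqr -(sqr_sqrtr (ltW e0)) ltr_pXn2r ?nnegrE ?hnorm_ge0 ?sqrtr_ge0.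
Qed.

Definition hilb_of : hilb R :=
  @Hilb R realif rdot rdotC rdotDl rdotZl rdot_ge0 rdot_eq0 rdot_complete.

(** The real projection is also the complex one: orthogonality of real parts, tested on u and on i
    u, kills both parts of [hdot]. *)
Lemma orth_projP (W : set V) v : subspace (W : set hilb_of) -> (forall (a : C) u, W u -> W (a *: u)) ->
  W (orth_proj W v) /\ forall u, W u -> hdot (v - orth_proj W v) u = 0.
Proof.
move=> sW WZ; apply: (@xgetPex _ 0 [set w | W w /\ forall u, W u -> hdot (v - w) u = 0]).
have [Ww wP] := projP sW v; exists (proj (W : set hilb_of) v); split => // u Wu.
have re (x : V) : W x -> complex.Re (hdot (v - proj (W : set hilb_of) v) x) = 0 by exact: wP.
have := re _ Wu; have := re _ (WZ 'i%C u Wu); rewrite linearZr_LR /=.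
by case: (hdot _ u) => x y /=; rewrite mul0r sub0r mulN1r opprK => -> ->.
Qed.

Section Rep.
Variables (L G : groupType) (phi : L -> G) (pi : unitary_rep G V).
Hypotheses (phi1 : phi 1%g = 1%g) (phiM : forall x y, phi (x * y)%g = (phi x * phi y)%g).

Fact rep1 (v : hilb_of) : pi (phi 1%g) v = v. Proof. by rewrite phi1 urep1. Qed.
Fact repM g h (v : hilb_of) : pi (phi (g * h)%g) v = pi (phi g) (pi (phi h) v).
Proof. by rewrite phiM urepM. Qed.
Fact repD g (u v : hilb_of) : pi (phi g) (u + v) = pi (phi g) u + pi (phi g) v.
Proof. exact: linearD. Qed.
Fact repZ g a (u : hilb_of) : pi (phi g) (a *: u) = a *: (pi (phi g) u : hilb_of).
Proof. exact: (linearZ_LR (pi (phi g)) a%:C%C u). Qed.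
Fact rep_dot g (u v : hilb_of) : dot (pi (phi g) u : hilb_of) (pi (phi g) v) = dot u v.
Proof. by rewrite /= /rdot urep_dot. Qed.

Definition hrep_of : hrep L hilb_of :=
  @HRep R L hilb_of (fun g => pi (phi g)) rep1 repM repD repZ rep_dot.
End Rep.

Lemma fixed_space_sub (G : groupType) (pi : unitary_rep G V) (F : set G) :
  subspace (fixed_space pi F : set hilb_of).
Proof.
split.
- by move=> h _; exact: linear0.
- by move=> u v Fu Fv h Fh; rewrite linearD Fu// Fv.
- by move=> a u Fu h Fh; rewrite -[RHS](congr1 (fun x : V => a%:C%C *: x) (Fu h Fh)); exact: linearZ_LR.
- move=> v vE h Fh; apply/eqP; rewrite -subr_eq0; apply/eqP.
  apply: (@hn_eq0 R hilb_of); apply/eqP; rewrite eq_le sqrtr_ge0 andbT.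
  apply: le_eps => e e0; rewrite add0r; have e2 : 0 < e / 2 by lra.
  have [w Fw vw] := vE _ e2; rewrite (_ : e = e / 2 + e / 2); last by lra.
  apply: (le_trans (@hn_triangle R hilb_of (pi h w) _ _)); apply: lerD.
    have := @hn_act R G hilb_of (@hrep_of G G id pi erefl (fun _ _ => erefl)) h (v - w).
    by rewrite /= linearB => ->; exact: ltW.
  by rewrite Fw// hnB; exact: ltW.
Qed.

End Realification.

(** * Homomorphisms out of SL_n(Z) *)

Lemma infinite_cyclic (G : groupType) (x : G) :
  (forall a b, (x ^+ a = x ^+ b)%g -> a = b) -> infinite_set (cyclic_subgroup x).
Proof.
move=> xI; apply: (@sub_infinite_set _ (range (fun k : nat => x ^+ k)%g)).
  by move=> _ [k _ <-]; exists k; left.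
move=> fin; apply: infinite_nat; rewrite -(@eq_finite_set _ _ (range (fun k => x ^+ k)%g))//.
by apply: inj_card_eq => a b _ _; exact: xI.
Qed.

Lemma cyclic1 (G : groupType) (x : G) : cyclic_subgroup x x.
Proof. by exists 1%N; left; rewrite expg1. Qed.

Lemma cyclicM (G : groupType) (x c : G) : cyclic_subgroup x c ->
  cyclic_subgroup x (x * c)%g /\ cyclic_subgroup x (x^-1 * c)%g.
Proof.
move=> [[|k] [->|->]].
- by split; exists 1%N; [left|right]; rewrite expg0 mulg1 expg1.
- by split; exists 1%N; [left|right]; rewrite expg0 invg1 mulg1 expg1.
- by split; [exists k.+2; left; rewrite -expgS|exists k; left; rewrite expgS mulKg].
- split; [exists k; right; rewrite expgSr invgM mulVKg//|].
  by exists k.+2; right; rewrite (expgSr x k.+1) invgM.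
Qed.

Lemma finite_index_image (L G : groupType) (phi : L -> G) (F : seq G) (K : set L) :
  (forall x y, phi (x * y)%g = (phi x * phi y)%g) ->
  (forall x, exists2 r, r \in F & exists s, x = (r * phi s)%g) ->
  finite_index K -> finite_index (phi @` K).
Proof.
move=> phiM cover fK.
apply: (@sub_finite_set _ _ [set [set (r * phi y)%g | y in S] | r in [set` F] &
    S in [set [set (x * h)%g | h in K] | x in [set: L]]]).
  move=> _ [x _ <-]; have [r rF [s ->]] := cover x.
  exists r => //; exists [set (s * h)%g | h in K]; first by exists s.
  apply/seteqP; split => y.
    by move=> [_ [h Kh <-] <-]; exists (phi h); [exists h|rewrite phiM mulgA].
  move=> [_ [h Kh <-] <-]; exists (s * h)%g; first by exists h.
  by rewrite phiM mulgA.
by apply: finite_image2 => //; exact: finite_seq.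
Qed.

(** What the three groups share: finite index survives taking images, and conjugates of elementary
    matrices keep infinite order. *)
Record sl_hom (n : nat) (G : groupType) := SlHom {
  slh :> SL int n -> G;
  slh1 : slh 1%g = 1%g;
  slhM : forall x y, slh (x * y)%g = (slh x * slh y)%g;
  slh_index : forall K, is_subgroup K -> finite_index K -> finite_index (slh @` K);
  slh_inf : forall h (i j : 'I_n), i != j ->
    infinite_set (cyclic_subgroup (slh (el i j 1 ^ h)%g));
  slh_countable : countable [set: G]
}.

Section SlHom.
Variables (n : nat) (G : groupType) (phi : sl_hom n G).
Hypothesis n3 : (3 <= n)%N.

Lemma slhV x : phi x^-1%g = (phi x)^-1%g.
Proof. by apply: (mulgI (phi x)); rewrite -slhM !mulgV slh1. Qed.

Lemma slh_subgroup K : is_subgroup K -> is_subgroup (phi @` K).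
Proof.
move=> [K1 KM KV]; split.
- by exists 1%g => //; exact: slh1.
- move=> _ _ [x Kx <-] [y Ky <-]; exists (x * y)%g; first exact: KM.
  exact: slhM.
- by move=> _ [x Kx <-]; exists (x^-1)%g; [exact: KV|exact: slhV].
Qed.

Lemma slh_ord2 : exists i j : 'I_n, i != j.
Proof.
have i : 'I_n by exists 0%N; lia.
by have [j /andP[ji _]] := ord_third i i n3; exists j, i.
Qed.

(** If the infimum exceeded some d > 0, all conjugates of elementary matrices would satisfy the
    hypothesis of [sl_main], with w the projection of v and <v, w> = |w|^2. The vector fixed by the
    resulting K is fixed by its image, a subgroup of finite index, against total ergodicity. *)
Theorem slh_escape (R : realType) : cyclic_escape_property R G.
Proof.
split; last first.
- move=> V pi te v; set S := [set _ | _ in _].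
  have S0 : (0 <= ereal_inf S)%E.
    by apply: le_ereal_inf_tmp => _ [C _ <-]; rewrite lee_fin hnorm_ge0.
  apply/eqP; rewrite eq_le S0 andbT.
  apply/lee_addgt0Pr => d d0; rewrite add0e leNgt; apply/negP => dS.
  have big (h : SL int n) (i j : 'I_n) : i != j -> exists2 w : hilb_of V,
      pi (phi (el i j 1 ^ h)%g) w = w & d ^+ 2 * dot w w < dot (v : hilb_of V) w ^+ 2.
    move=> ij; set x := phi _; set F := fixed_space pi (cyclic_subgroup x).
    have FZ (a : R[i]) u : F u -> F (a *: u).
      by move=> Fu g Cg; rewrite linearZ_LR/= Fu.
    have [Fw wP] := orth_projP v (fixed_space_sub pi (cyclic_subgroup x)) FZ.
    exists (orth_proj F v); first exact: (Fw _ (cyclic1 x)).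
    have dw : d < hnorm (orth_proj F v).
      rewrite -lte_fin; apply: (lt_le_trans dS); apply: ereal_inf_lbound.
      exists (cyclic_subgroup x) => //; split; first by exists x.
      exact: slh_inf.
    have -> : dot (v : hilb_of V) (orth_proj F v) = hnorm (orth_proj F v) ^+ 2.
      rewrite hnorm_sqr; apply/eqP; rewrite -subr_eq0; apply/eqP.
      have := congr1 (@complex.Re R) (wP _ Fw) => /= <-.
      by rewrite linearBl raddfB.
    rewrite /= -hnorm_sqr [ltRHS]expr2 ltr_pM2r; last by rewrite exprn_gt0// (lt_trans d0).
    by rewrite ltr_pXn2r ?nnegrE ?hnorm_ge0 ?(ltW d0).
  have [K [sgK fK [c c0 Kc]]] := @sl_main R n (hilb_of V) (hrep_of pi (slh1 phi) (slhM phi)) v d n3 d0 big.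
  have : fixed_space pi (phi @` K) c by move=> _ [h Kh <-]; exact: Kc.
  rewrite te; [|exact: slh_subgroup|exact: slh_index].
  by move=> /= cE; move: c0; rewrite cE eqxx.
- exact: (slh_countable phi).
- have [i [j ij]] := slh_ord2.
  have h := @slh_inf n G phi 1%g i j ij; have sub := @subsetT _ (cyclic_subgroup (phi (el i j 1 ^ 1)%g)).
  exact: sub_infinite_set sub h.
Qed.

End SlHom.

Section Instances.
Variables (n : nat).
Hypothesis n3 : (3 <= n)%N.
Local Notation S := (SL int n).
Implicit Types (i j : 'I_n) (h : S).

Lemma el_scalar i j c h : i != j -> is_scalar_mx (val (el i j c ^ h)%g) -> c = 0.
Proof.
move=> ij sc; have sc' : is_scalar_mx (val (el i j c)).
  have -> : el i j c = ((el i j c ^ h) ^ h^-1)%g by rewrite conjgK.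
  exact: (@SL_scalarJ int n (el i j c ^ h)%g h^-1%g).
move: sc' => /is_scalar_mxP[a]; rewrite el_val// => /matrixP/(_ i j).
by rewrite !mxE (negPf ij) !eqxx /= add0r mulr1.
Qed.

(** A quotient of two powers of the conjugate is a conjugate of some el_ij(c), scalar only for c =
    0. This gives infinite order in all three groups. *)
Lemma el_pow_scalar i j h a b : i != j ->
  is_scalar_mx (val (((el i j 1 ^ h) ^+ a)^-1 * (el i j 1 ^ h) ^+ b)%g) -> a = b.
Proof.
move=> ij; rewrite -!conjXg -conjVg -conjMg !el_expn// el_inv// el_add//.
by move=> /(el_scalar ij)/eqP; rewrite addrC subr_eq0 => /eqP[].
Qed.

Lemma countable_SL : countable [set: S].
Proof.
apply/countable_injP; exists (fun A => pickle (val A)) => A B _ _.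
by move=> /(pcan_inj pickleK)/val_inj.
Qed.

Lemma countable_GL : countable [set: GL int n].
Proof.
apply/countable_injP; exists (fun A => pickle (val A)) => A B _ _.
by move=> /(pcan_inj pickleK)/val_inj.
Qed.

Lemma countable_inj (X Y : Type) (f : X -> Y) : injective f -> countable [set: Y] -> countable [set: X].
Proof.
move=> fI /countable_injP[g gI]; apply/countable_injP; exists (g \o f) => x y _ _ /= e.
by apply: fI; apply: gI; rewrite ?inE.
Qed.

Definition slh_SL : sl_hom n S.
Proof.
refine (@SlHom n S id erefl (fun _ _ => erefl) _ _ countable_SL).
- by move=> K _ fK; rewrite image_id.
- move=> h i j ij; apply: infinite_cyclic => a b e; apply: (el_pow_scalar (h := h) ij).
  by rewrite e mulVg SL_oneE scalar_mx_is_scalar.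
Defined.

Local Notation piS := (\pi_(quotient_group (@SL_scalar int n)))%qT.

Lemma morph_exp (L G : groupType) (phi : L -> G) : phi 1%g = 1%g ->
  (forall x y, phi (x * y)%g = (phi x * phi y)%g) ->
  forall x a, (phi x ^+ a)%g = phi (x ^+ a)%g.
Proof. by move=> p1 pM x; elim=> [|a IH]; rewrite ?expg0 ?p1// !expgS IH pM. Qed.

Definition slh_PSL : sl_hom n (PSL int n).
Proof.
have piM x y : (piS (x * y) = piS x * piS y)%g by apply: esym; exact: pi_quotM.
refine (@SlHom n (PSL int n) piS erefl piM _ _ _).
- move=> K _; apply: (@finite_index_image _ _ _ [:: 1%g]) => // x.
  exists 1%g; first by rewrite inE.
  by exists (repr x); rewrite mul1g reprK.
- move=> h i j ij; apply: infinite_cyclic => a b.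
  rewrite !(morph_exp (phi := piS) erefl piM) => /eq_quotP sc.
  exact: (el_pow_scalar (h := h) ij sc).
- by apply: (countable_inj (can_inj reprK)); exact: countable_SL.
Defined.

Definition GL_of_SL (A : S) : GL int n := MkGL (SL_unitmx A).

Local Notation piG := (\pi_(quotient_group (@GL_scalar int n)))%qT.

Lemma det_GL (A : GL int n) : \det (val A) = 1 \/ \det (val A) = -1.
Proof. by have := valP A; rewrite unitmxE; case: (\det _) => [[|[|m]]|[|m]]//; [left|right]. Qed.

Lemma GL_cover (r : GL int n) (x : GL int n) : \det (val x) = \det (val r) ->
  exists s, x = (r * GL_of_SL s)%g.
Proof.
move=> dd; have d1 : \det (val (r^-1 * x)%g) == 1.
  rewrite /= det_mulmx det_inv dd mulVr//; exact: (valP r).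
exists (MkSL d1).
have -> : GL_of_SL (MkSL d1) = (r^-1 * x)%g by apply: val_inj.
by rewrite mulVKg.
Qed.

Definition slh_PGL : sl_hom n (PGL int n).
Proof.
have GM x y : (GL_of_SL (x * y) = GL_of_SL x * GL_of_SL y)%g by apply: val_inj.
have piM x y : (piG (GL_of_SL (x * y)) = piG (GL_of_SL x) * piG (GL_of_SL y))%g.
  by rewrite GM; apply: esym; exact: pi_quotM.
have pi1 : (piG (GL_of_SL 1) = 1)%g.
  by rewrite (_ : GL_of_SL 1 = 1)%g//; apply: val_inj.
refine (@SlHom n (PGL int n) (fun x => piG (GL_of_SL x)) pi1 piM _ _ _).
(* A matrix of determinant -1 represents the second coset; should none exist, 1 takes its place. *)
- move=> K _; have [r rP] : exists r : GL int n, forall x : GL int n,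
      \det (val x) = 1 \/ \det (val x) = \det (val r).
    have [[r rE]|no] := pselect (exists r : GL int n, \det (val r) = -1).
      by exists r => x; rewrite rE; exact: det_GL.
    exists 1%g => x; left; have [//|xE] := det_GL x; exfalso; apply: no; by exists x.
  apply: (@finite_index_image _ _ _ [:: 1%g; piG r]) => // x.
  have [x1|xr] := rP (repr x).
    exists 1%g; first by rewrite inE eqxx.
    have [|s sE] := @GL_cover 1%g (repr x); first by rewrite x1 /= det1.
    by exists s; rewrite mul1g -[LHS]reprK sE mul1g.
  exists (piG r); first by rewrite !inE eqxx orbT.
  have [s sE] := GL_cover xr; exists s.
  by rewrite -[LHS]reprK sE; apply: esym; exact: pi_quotM.
- move=> h i j ij; apply: infinite_cyclic => a b.
  rewrite !(morph_exp (phi := fun x => piG (GL_of_SL x)) pi1 piM) => /eq_quotP sc.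
  exact: (el_pow_scalar (h := h) ij sc).
- by apply: (countable_inj (can_inj reprK)); exact: countable_GL.
Defined.

End Instances.

(** * The Koopman representation *)

Section Separation.
Variables (R : realType) (E : lmodType R) (sd : E -> E -> R).
Hypotheses (sdC : forall u v, sd u v = sd v u)
  (sdD : forall u v w, sd (u + v) w = sd u w + sd v w)
  (sdZ : forall a u v, sd (a *: u) v = a * sd u v)
  (sd0 : forall u, 0 <= sd u u).
Hypothesis sd_complete : forall f : nat -> E,
  (forall e, 0 < e -> exists N : nat, forall m p, (N <= m)%N -> (N <= p)%N ->
     sd (f m - f p) (f m - f p) < e) ->
  exists l, forall e, 0 < e -> exists N : nat, forall m, (N <= m)%N ->
     sd (f m - l) (f m - l) < e.
Implicit Types (u v : E) (a : R).

(* The quotient of [E] by the kernel of the semi-inner product, each class [u]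
   being represented by the functional [sd u]. *)
Definition sepp : {pred (E -> R^o)} := fun phi => `[< exists u, phi = sd u >].

Fact sepp_submod : submod_closed sepp.
Proof.
split.
- apply/asboolP; exists 0; apply/funext => v.
  by rewrite -(scale0r (0 : E)) sdZ mul0r.
- move=> a _ _ /asboolP[u ->] /asboolP[v ->]; apply/asboolP; exists (a *: u + v).
  by apply/funext => w; rewrite sdD sdZ.
Qed.
HB.instance Definition _ := GRing.isSubmodClosed.Build _ _ sepp sepp_submod.

Record sept := Sept { septv :> E -> R^o; _ : septv \in sepp }.
HB.instance Definition _ := [isSub for septv].
HB.instance Definition _ := [Choice of sept by <:].
HB.instance Definition _ := [SubChoice_isSubLmodule of sept by <:].

Fact cls_subproof u : (sd u : E -> R^o) \in sepp.
Proof. by apply/asboolP; exists u. Qed.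
Definition cls u : sept := Sept (cls_subproof u).

Fact rep_ex (p : sept) : exists u, septv p = sd u.
Proof. by case: p => p /= /asboolP. Qed.
Definition rep (p : sept) : E := sval (cid (rep_ex p)).
Lemma repE p : septv p = sd (rep p). Proof. exact: svalP (cid (rep_ex p)). Qed.
Lemma repK p : cls (rep p) = p. Proof. by apply: val_inj; rewrite /= -repE. Qed.

Definition sepdot (p q : sept) : R := p (rep q).

Lemma sepdotE u v : sepdot (cls u) (cls v) = sd u v.
Proof. by rewrite /sepdot /= sdC -[sd (rep _) u]/((sd (rep (cls v))) u) -repE /= sdC. Qed.

Lemma clsB u v : cls (u - v) = cls u - cls v.
Proof.
by apply: val_inj; apply/funext => w /=; rewrite sdD -scaleN1r sdZ mulN1r.
Qed.

Lemma clsD u v : cls (u + v) = cls u + cls v.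
Proof. by apply: val_inj; apply/funext => w /=; rewrite sdD. Qed.
Lemma clsZ a u : cls (a *: u) = a *: cls u.
Proof. by apply: val_inj; apply/funext => w /=; rewrite sdZ. Qed.

Let sdZr a u v : sd u (a *: v) = a * sd u v. Proof. by rewrite sdC sdZ sdC. Qed.
Let sdDr u v w : sd u (v + w) = sd u v + sd u w. Proof. by rewrite sdC sdD !(sdC _ u). Qed.

Lemma sd_null u v : sd u u = 0 -> sd u v = 0.
Proof.
move=> u0; apply/eqP/negPn/negP => uv.
(* The coefficient makes the quadratic expression equal to sd v v - (sd v v + 1) = -1. *)
have := sd0 ((- (sd v v + 1) / (2 * sd u v)) *: u + v).
rewrite sdD !sdDr !sdZ !sdZr u0 !mulr0 add0r (sdC v u).
have -> : - (sd v v + 1) / (2 * sd u v) * sd u v = - (sd v v + 1) / 2 by field.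
by lra.
Qed.

Fact sepdotC p q : sepdot p q = sepdot q p.
Proof. by rewrite -(repK p) -(repK q) !sepdotE sdC. Qed.
Fact sepdotDl p q r : sepdot (p + q) r = sepdot p r + sepdot q r.
Proof. by []. Qed.
Fact sepdotZl a p q : sepdot (a *: p) q = a * sepdot p q.
Proof. by []. Qed.
Fact sepdot_ge0 p : 0 <= sepdot p p.
Proof. by rewrite -(repK p) sepdotE. Qed.
Fact sepdot_eq0 p : sepdot p p = 0 -> p = 0.
Proof.
rewrite -(repK p) sepdotE => p0; apply: val_inj; apply/funext => w /=.
exact: sd_null.
Qed.
Fact sepdot_complete (f : nat -> sept) :
  (forall e, 0 < e -> exists N : nat, forall m p, (N <= m)%N -> (N <= p)%N ->
     sepdot (f m - f p) (f m - f p) < e) ->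
  exists l, forall e, 0 < e -> exists N : nat, forall m, (N <= m)%N ->
     sepdot (f m - l) (f m - l) < e.
Proof.
move=> fC; have [e e0|l lP] := @sd_complete (rep \o f).
  have [N NP] := fC e e0; exists N => m p Nm Np; have := NP m p Nm Np.
  by rewrite -(repK (f m)) -(repK (f p)) -clsB sepdotE.
exists (cls l) => e e0; have [N NP] := lP e e0; exists N => m Nm; have := NP m Nm.
by rewrite -[in X in _ -> X](repK (f m)) -clsB sepdotE.
Qed.

Definition sep_hilb : hilb R :=
  @Hilb R sept sepdot sepdotC sepdotDl sepdotZl sepdot_ge0 sepdot_eq0 sepdot_complete.

Section Action.
Variables (G : groupType) (U : G -> E -> E).
Hypotheses (U1 : forall u, U 1%g u = u) (UM : forall g h u, U (g * h)%g u = U g (U h u))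
  (UD : forall g u v, U g (u + v) = U g u + U g v) (UZ : forall g a u, U g (a *: u) = a *: U g u)
  (Usd : forall g u v, sd (U g u) (U g v) = sd u v).

Definition sepact g (p : sep_hilb) : sep_hilb := cls (U g (rep p)).

(** Independence of the representative: [U g] has the adjoint [U g^-1], so the functional of [U g x]
    is determined by that of x. *)
Lemma sepact_cls g u : sepact g (cls u) = cls (U g u).
Proof.
have mv x w : sd (U g x) w = sd x (U g^-1%g w).
  by rewrite -[in LHS](U1 w) -(mulgV g) UM Usd.
apply: val_inj; apply/funext => w /=; rewrite !mv.
by rewrite -[LHS]/((sd (rep (cls u))) _) -repE.
Qed.

Fact sepact1 p : sepact 1%g p = p.
Proof. by rewrite -(repK p) sepact_cls U1. Qed.
Fact sepactM g h p : sepact (g * h)%g p = sepact g (sepact h p).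
Proof. by rewrite -(repK p) !sepact_cls UM. Qed.
Fact sepactD g (p q : sep_hilb) : sepact g (p + q) = sepact g p + sepact g q.
Proof. by rewrite -(repK p) -(repK q) -clsD !sepact_cls UD clsD. Qed.
Fact sepactZ g a (p : sep_hilb) : sepact g (a *: p) = a *: sepact g p.
Proof. by rewrite -(repK p) -clsZ !sepact_cls UZ clsZ. Qed.
Fact sepact_dot g (p q : sep_hilb) : dot (sepact g p) (sepact g q) = dot p q.
Proof. by rewrite -(repK p) -(repK q) !sepact_cls [LHS]sepdotE [RHS]sepdotE Usd. Qed.

Definition sep_rep : hrep G sep_hilb :=
  @HRep R G sep_hilb sepact sepact1 sepactM sepactD sepactZ sepact_dot.
End Action.
End Separation.

(** * Square integrable functions *)

Lemma le_1sqr (R : realFieldType) (s : R) : s <= 1 + s ^+ 2.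
Proof. by have := sqr_ge0 (s - 2^-1); rewrite sqrrB; lra. Qed.

Section L2.
Variables (R : realType) (d : measure_display) (X : measurableType d) (mu : probability X R).
Implicit Types (f g h : X -> R) (A : set X).

Definition intble f := mu.-integrable setT (EFin \o f).
Local Notation I f := (\int[mu]_x (f x)).

Lemma intble_meas f : intble f -> measurable_fun setT f.
Proof. by move=> /integrableP[/measurable_EFinP]. Qed.

Lemma intble_le f g : measurable_fun setT f -> (forall x, `|f x| <= g x) -> intble g -> intble f.
Proof.
move=> mf fg ig; apply: le_integrable ig => //; first exact/measurable_EFinP.
by move=> x _ /=; rewrite lee_fin; apply: le_trans (fg x) (ler_norm _).
Qed.

Lemma intbleD f g : intble f -> intble g -> intble (fun x => f x + g x).
Proof. by move=> fi gi; have := integrableD measurableT fi gi. Qed.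

Lemma intbleZ a f : intble f -> intble (fun x => a * f x).
Proof. by move=> fi; have := integrableZl measurableT a fi. Qed.

Lemma intble_cst a : intble (fun _ => a).
Proof. exact: finite_measure_integrable_cst. Qed.

Lemma ID f g : intble f -> intble g -> I (fun x => f x + g x) = I f + I g.
Proof. by move=> fi gi; rewrite RintegralD. Qed.

Lemma IZ a f : intble f -> I (fun x => a * f x) = a * I f.
Proof. by move=> fi; rewrite RintegralZl. Qed.

Lemma I_le f g : intble f -> intble g -> (forall x, f x <= g x) -> I f <= I g.
Proof. by move=> fi gi fg; apply: le_Rintegral. Qed.

Lemma I_cst a : I (fun _ => a) = a.
Proof.
have mu1 : fine (mu setT) = 1 by rewrite probability_setT.
by rewrite Rintegral_cst// -[RHS]mulr1; congr (_ * _); exact: mu1.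
Qed.

Lemma I_ge0 f : (forall x, 0 <= f x) -> 0 <= I f.
Proof. by move=> f0; apply: Rintegral_ge0. Qed.

Lemma I_EFin f : intble f -> (\int[mu]_x (f x)%:E)%E = (I f)%:E.
Proof. by move=> fi; rewrite /Rintegral fineK//; exact: integrable_fin_num. Qed.

Lemma intble_bound f (e : R) : measurable_fun setT f -> (forall x, 0 <= f x) ->
  (\int[mu]_x (f x)%:E <= e%:E)%E -> intble f /\ I f <= e.
Proof.
move=> mf f0 fe; have fi : intble f.
  apply/integrableP; split; first exact/measurable_EFinP.
  under eq_integral do rewrite /= ger0_norm//.
  exact: le_lt_trans fe (ltry _).
by split => //; rewrite -lee_fin -I_EFin.
Qed.

Definition L2 f := measurable_fun setT f /\ intble (fun x => f x ^+ 2).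

Lemma L2_mul f g : L2 f -> L2 g -> intble (fun x => f x * g x).
Proof.
move=> [mf fi] [mg gi]; apply: (@intble_le _ (fun x => f x ^+ 2 + g x ^+ 2)).
- exact: measurable_funM.
- move=> x; rewrite normrM -(real_normK (num_real (f x))) -(real_normK (num_real (g x))).
  by move: (normr_ge0 (f x)) (normr_ge0 (g x)); nra.
- exact: intbleD.
Qed.

Lemma L2_cst a : L2 (fun _ => a).
Proof. by split; [exact: measurable_cst|exact: intble_cst]. Qed.

Lemma L2_int f : L2 f -> intble f.
Proof.
move=> fL; have := L2_mul fL (L2_cst 1); rewrite /intble.
by congr (mu.-integrable _ _); apply/funext => x /=; rewrite mulr1.
Qed.

Lemma L2Z a f : L2 f -> L2 (fun x => a * f x).
Proof.
move=> [mf fi]; split; first by apply: measurable_funM => //; exact: measurable_cst.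
have := intbleZ (a ^+ 2) fi; rewrite /intble; congr (mu.-integrable _ _).
by apply/funext => x /=; rewrite exprMn.
Qed.

Lemma L2D f g : L2 f -> L2 g -> L2 (fun x => f x + g x).
Proof.
move=> fL gL; have [mf fi] := fL; have [mg gi] := gL; split; first exact: measurable_funD.
have := intbleD (intbleD fi (intbleZ 2 (L2_mul fL gL))) gi; rewrite /intble.
by congr (mu.-integrable _ _); apply/funext => x /=; congr (_%:E); ring.
Qed.

Lemma L2B f g : L2 f -> L2 g -> L2 (fun x => f x - g x).
Proof.
move=> fL gL; have := L2D fL (L2Z (-1) gL); congr L2.
by apply/funext => x; rewrite mulN1r.
Qed.

Definition sql2 f g := I (fun x => (f x - g x) ^+ 2).

Section Complete.
Variable f : nat -> X -> R.
Hypothesis fL : forall m, L2 (f m).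
Hypothesis fI : forall m, I (f m) = 0.
Hypothesis fC : forall e, 0 < e -> exists N : nat, forall m p, (N <= m)%N -> (N <= p)%N ->
  sql2 (f m) (f p) < e.

(* A subsequence whose increments are summable in [L^1], hence almost everywhere. *)
Let fast : exists g : nat -> nat, (forall k, (k <= g k)%N) /\
  forall k, sql2 (f (g k.+1)) (f (g k)) <= (4 ^+ k)^-1.
Proof.
have e0 k : 0 < ((4 : R) ^+ k)^-1 by rewrite invr_gt0 exprn_gt0.
have [N NP] := choice (fun k => fC (e0 k)).
pose g k := (\sum_(i < k.+1) N i + k)%N; exists g; split; first by move=> k; exact: leq_addl.
have Ng k : (N k <= g k)%N by rewrite /g big_ord_recr /=; lia.
have gS k : (g k <= g k.+1)%N by rewrite /g [in leqRHS]big_ord_recr /=; lia.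
by move=> k; apply: ltW; apply: NP; [exact: leq_trans (gS k)|].
Qed.

(** Turns the bounds 4^-k on squared distances from [fast] into summable bounds 2 / 2^k on the
    integrals of the increments. *)
Let abs_bound (k : nat) (u : R) : `|u| <= (2 ^+ k)^-1 + 2 ^+ k * u ^+ 2.
Proof.
have a0 : 0 < (2 : R) ^+ k by rewrite exprn_gt0.
rewrite -(real_normK (num_real u)); move: (2 ^+ k) a0 `|u| (normr_ge0 u) => a a0 t t0.
rewrite -(ler_pM2l a0) mulrDr mulfV ?gt_eqF//.
by rewrite (_ : a * (a * t ^+ 2) = (a * t) ^+ 2) ?le_1sqr//; ring.
Qed.

(** Riesz-Fischer: the subsequence converges almost everywhere, and Fatou's lemma bounds the
    distance of its limit from each [f m]. The mean stays 0 because the integral of u is at most a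
    plus 1 / a times that of u^2, for any a > 0 and either sign of u. *)
Lemma L2_complete : exists g, [/\ L2 g, I g = 0 &
  forall e, 0 < e -> exists N : nat, forall m, (N <= m)%N -> sql2 (f m) g < e].
Proof.
have [n [nk nP]] := fast; pose g k := f (n k).
have gL k : L2 (g k) by exact: fL.
pose D k x := `|g k.+1 x - g k x|.
have mD k : measurable_fun setT (D k).
  by apply: measurableT_comp => //; exact: (L2B _ _).1.
have IDk k : (\int[mu]_x (D k x)%:E <= (2 / 2 ^+ k)%:E)%E.
  have i2 := (L2B (gL k.+1) (gL k)).2.
  have iR : intble (fun x => (2 ^+ k)^-1 + 2 ^+ k * (g k.+1 x - g k x) ^+ 2).
    by apply: intbleD; [exact: intble_cst|exact: intbleZ].
  have iD : intble (D k).
    by apply: intble_le iR => // x; rewrite /D normr_id; exact: abs_bound.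
  rewrite I_EFin// lee_fin; apply: (le_trans (I_le iD iR _)); first by move=> x; exact: abs_bound.
  rewrite ID//; [|exact: intble_cst|exact: intbleZ]; rewrite I_cst IZ//.
  have := nP k; rewrite /sql2 -/(g k.+1) -/(g k).
  have -> : (4 : R) ^+ k = 2 ^+ k * 2 ^+ k by rewrite -exprMn -natrM.
  have a0 : 0 < (2 : R) ^+ k by rewrite exprn_gt0.
  set t := Rintegral _ _ _; clearbody t.
  move: (2 ^+ k) a0 => a a0; rewrite invfM => ta.
  have : a * t <= a^-1 by rewrite -ler_pdivlMl// mulrC.
  by move: (a^-1) => b; lra.
pose F x := (\sum_(k <oo) (D k x)%:E)%E.
have mF : measurable_fun setT F.
  apply: ge0_emeasurable_sum => k; first by move=> x _ _; rewrite lee_fin normr_ge0.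
  by move=> _; exact/measurable_EFinP.
have F0 x : (0 <= F x)%E by apply: nneseries_ge0 => k _ _; rewrite lee_fin normr_ge0.
have IF : (\int[mu]_x F x <= 4%:E)%E.
  rewrite integral_nneseries//; last 2 first.
  - by move=> k; exact/measurable_EFinP.
  - by move=> k x _; rewrite lee_fin normr_ge0.
  apply: lime_le; first by apply: is_cvg_nneseries => k _ _; apply: integral_ge0 => x _; rewrite lee_fin normr_ge0.
  apply: nearW => K; apply: (@le_trans _ _ (\sum_(0 <= k < K) (2 / 2 ^+ k)%:E)%E).
    by apply: lee_sum => k _; exact: IDk.
  rewrite sumEFin lee_fin.
  suff -> : \sum_(0 <= k < K) (2 / 2 ^+ k) = 4 - 4 / 2 ^+ K :> R.
    by rewrite gerBl divr_ge0// exprn_ge0.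
  elim: K => [|K IH]; first by rewrite big_nil expr0 divr1 subrr.
  rewrite big_nat_recr//= IH exprS; have : (2 : R) ^+ K != 0 by rewrite expf_neq0.
  by move=> a0; field.
have Ffin : {ae mu, forall x, F x \is a fin_num}.
  have Fi : mu.-integrable setT F.
    apply/integrableP; split => //.
    under eq_integral do rewrite gee0_abs//.
    exact: le_lt_trans IF (ltry _).
  by have [N [mN N0 NF]] := integrable_ae measurableT Fi; exists N; split => // x /= nF; apply: NF => /= /(_ Logic.I).
have [N [mN N0 NF]] := Ffin.
have gcv x : ~ N x -> cvgn (g ^~ x).
  move=> Nx; have Fx : F x \is a fin_num by apply: contrapT => nF; apply: Nx; exact: NF.
  have cs : cvgn [normed series (telescope (g ^~ x))].
    apply: nondecreasing_is_cvgn; first by apply: nondecreasing_series => k _ _; exact: normr_ge0.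
    exists (fine (F x)) => _ [k _ <-]; rewrite -lee_fin fineK// /series /= -sumEFin.
    by apply: nneseries_lim_ge => j _; rewrite lee_fin normr_ge0.
  have := normed_cvg cs; rewrite telescopeK => c1.
  have -> : g ^~ x = (fun k => (g k x - g 0%N x) + g 0%N x) by apply/funext => k; rewrite subrK.
  by apply: is_cvgD => //; exact: is_cvg_cst.
(* Cutting off on the null set makes the sequence converge everywhere, so its limit is
   measurable. *)
pose gt k x := g k x * \1_(~` N) x.
have gtE k x : ~ N x -> gt k x = g k x.
  by move=> Nx; rewrite /gt indicE mem_set// mulr1.
have gt0 k x : N x -> gt k x = 0.
  by move=> Nx; rewrite /gt indicE memNset ?mulr0//=; apply.
have gtcv x : cvgn (gt ^~ x).
  have [Nx|Nx] := pselect (N x).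
    rewrite (_ : gt ^~ x = fun=> 0); last by apply/funext => k; exact: gt0.
    exact: is_cvg_cst.
  rewrite (_ : gt ^~ x = g ^~ x); last by apply/funext => k; exact: gtE.
  exact: gcv.
have mgt k : measurable_fun setT (gt k).
  by apply: measurable_funM; [exact: (gL k).1|apply: measurable_indic; exact: measurableC].
pose gl x := limn (gt ^~ x).
have mgl : measurable_fun setT gl.
  by apply: (measurable_fun_cvg mgt) => x _; exact: gtcv.
have key m (e : R) (P : nat) : (forall p, (P <= p)%N -> sql2 (f p) (f m) <= e) ->
    intble (fun x => (gl x - f m x) ^+ 2) /\ sql2 gl (f m) <= e.
  move=> Pe; apply: intble_bound.
  - by apply: measurable_funX; apply: measurable_funB => //; exact: (fL m).1.
  - by move=> x; exact: sqr_ge0.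
  pose h k x := ((gt k x - f m x) ^+ 2)%:E.
  have mh k : measurable_fun setT (h k).
    by apply/measurable_EFinP; apply: measurable_funX; apply: measurable_funB => //; exact: (fL m).1.
  have h0 k x : setT x -> (0 <= h k x)%E by move=> _; rewrite lee_fin sqr_ge0.
  have Ih k : (\int[mu]_x h k x)%E = (sql2 (g k) (f m))%:E.
    rewrite /sql2 -I_EFin; last exact: (L2B (gL k) (fL m)).2.
    apply: ge0_ae_eq_integral => //.
    - by apply/measurable_EFinP; exact: intble_meas (L2B (gL k) (fL m)).2.
    - by move=> x _; rewrite lee_fin sqr_ge0.
    - by move=> x _; rewrite lee_fin sqr_ge0.
    exists N; split => // x /= nx; apply: contrapT => Nx; apply: nx => _.
    by rewrite /h gtE.
  have -> : (\int[mu]_x ((gl x - f m x) ^+ 2)%:E = \int[mu]_x limn_einf (h ^~ x))%E.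
    apply: eq_integral => x _; apply: esym.
    apply: (cvg_limn_einf_sup _).1; apply: cvg_EFin; first exact: nearW.
    by apply: cvgM; apply: cvgB; (try exact: gtcv); exact: cvg_cst.
  have fat := @fatou _ _ _ mu setT measurableT h mh h0.
  apply: (le_trans fat).
  rewrite limn_einf_lim; apply: lime_le; first exact: is_cvg_einfs.
  apply: nearW => K; apply: ge_ereal_inf; exists (\int[mu]_x h (maxn K P) x)%E.
    by exists (maxn K P) => //=; exact: leq_maxl.
  rewrite Ih lee_fin; apply: Pe; apply: leq_trans (nk _); exact: leq_maxr.
have [N1 N1P] := fC (ltr01 : 0 < 1).
have near_gl e : 0 < e -> exists M : nat, forall m, (M <= m)%N ->
    intble (fun x => (gl x - f m x) ^+ 2) /\ sql2 gl (f m) <= e.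
  move=> e0; have [M MP] := fC e0; exists M => m Mm; apply: (key m e M) => p Mp.
  by apply: ltW; exact: MP.
have glL : L2 gl.
  have [M MP] := near_gl 1 ltr01; have [i1 _] := MP M (leqnn _).
  have L1 : L2 (fun x => gl x - f M x).
    by split => //; apply: measurable_funB => //; exact: (fL M).1.
  have := L2D L1 (fL M); congr L2; apply/funext => x; by rewrite subrK.
exists gl; split => //.
  apply/eqP; rewrite -normr_eq0 eq_le normr_ge0 andbT; apply: le_eps => e e0; rewrite add0r.
  have e2 : 0 < e / 2 by lra.
  have [M MP] := near_gl _ (exprn_gt0 2 e2); have [i1 le1] := MP M (leqnn _).
  have uL := L2B glL (fL M); have ui := L2_int uL.
  have -> : I gl = I (fun x => gl x - f M x).
    rewrite RintegralB//; [|exact: L2_int glL|exact: L2_int (fL M)].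
    by rewrite fI subr0.
  have bnd (c : R) (u : X -> R) : intble u -> intble (fun x => u x ^+ 2) ->
      (forall t : R, c * t <= e / 2 + (e / 2)^-1 * t ^+ 2) -> c * I u <= e / 2 + (e / 2)^-1 * I (fun x => u x ^+ 2).
    move=> iu iu2 ct.
    have i1' := intble_cst (e / 2); have i2' := intbleZ (e / 2)^-1 iu2.
    have -> : e / 2 + (e / 2)^-1 * I (fun x => u x ^+ 2) =
        I (fun x => e / 2 + (e / 2)^-1 * u x ^+ 2) by rewrite ID// I_cst IZ.
    rewrite -IZ//.
    by apply: I_le => //; [exact: intbleZ|exact: intbleD].
  have amgm (c t : R) : `|c| = 1 -> c * t <= e / 2 + (e / 2)^-1 * t ^+ 2.
    move=> c1; apply: (le_trans (ler_norm _)); rewrite normrM c1 mul1r.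
    rewrite -(real_normK (num_real t)); move: (e / 2) e2 `|t| (normr_ge0 t) => a a0 s s0.
    have -> : a + a^-1 * s ^+ 2 = a * (1 + (a^-1 * s) ^+ 2) by field; rewrite gt_eqF.
    by rewrite -ler_pdivrMl// le_1sqr.
  have fin : (e / 2)^-1 * sql2 gl (f M) <= e / 2.
    by rewrite mulrC ler_pdivrMr// -expr2.
  have b1 := bnd 1 _ ui uL.2 (fun t => amgm 1 t (normr1 _)).
  have b2 := bnd (-1) _ ui uL.2 (fun t => amgm (-1) t (normrN1 _)).
  rewrite ler_norml; move: b1 b2 fin; rewrite /sql2 mul1r mulN1r.
  set a := Rintegral _ _ (fun x => gl x - f M x); set b := (e / 2)^-1 * _.
  by clearbody a b; lra.
move=> e e0; have e2 : 0 < e / 2 by lra.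
have [M MP] := near_gl _ e2; exists M => m Mm; have [_ le1] := MP m Mm.
rewrite (_ : sql2 (f m) gl = sql2 gl (f m)); last first.
  by apply: eq_Rintegral => x _; rewrite -sqrrN opprB.
by apply: (le_lt_trans le1); lra.
Qed.
End Complete.
End L2.

Section MeanZero.
Variables (R : realType) (d : measure_display) (X : measurableType d) (mu : probability X R).
Implicit Types (f g h : X -> R) (A : set X).
Local Notation I f := (\int[mu]_x (f x)).
Local Notation L2 := (L2 mu).

Lemma ae_sign_null u : L2 u -> I u = 0 ->
  {ae mu, forall x, 0 <= u x} \/ {ae mu, forall x, u x <= 0} -> I (fun x => u x * u x) = 0.
Proof.
move=> uL u0; wlog sgn : u uL u0 / {ae mu, forall x, 0 <= u x}.
  move=> W [sgn|sgn]; first by apply: (W u) => //; left.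
  have NL : L2 (fun x => -1 * u x) by exact: L2Z.
  have NI : I (fun x => -1 * u x) = 0 by rewrite IZ ?u0 ?mulr0//; exact: L2_int.
  have Nae : {ae mu, forall x, 0 <= -1 * u x}.
    by apply: filterS sgn => x; rewrite mulN1r oppr_ge0.
  rewrite -(W _ NL NI Nae (or_introl Nae)); apply: eq_Rintegral => x _; ring.
move=> _; have ui := L2_int uL; have mu' := uL.1.
have mE : measurable_fun setT (EFin \o u) by exact/measurable_EFinP.
have abs0 : (\int[mu]_x `|(EFin \o u) x| = 0)%E.
  rewrite -[RHS]/((0 : R)%:E) -u0 -I_EFin//; apply: ae_eq_integral => //.
    exact: measurableT_comp.
  apply: filterS sgn => x ux _ /=; by rewrite ger0_norm.
have /(ae_eq_integral_abs _ measurableT mE) uae := abs0.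
have := I_cst mu 0 => <-; rewrite /Rintegral; congr fine; apply: ae_eq_integral => //.
- by apply/measurable_EFinP; exact: measurable_funM.
- by apply: filterS uae => x /= h _; have [->] := h Logic.I; rewrite mulr0.
Qed.

(** Genuine functions, so that sums and compositions are pointwise; equality almost everywhere is
    divided out only in [sep_hilb]. *)
Definition l20p : {pred (X -> R^o)} := fun f => `[< L2 f /\ I f = 0 >].

Fact l20_submod : submod_closed l20p.
Proof.
split.
- by apply/asboolP; split; [exact: L2_cst|exact: I_cst].
- move=> c u v /asboolP[uL u0] /asboolP[vL v0]; apply/asboolP; split.
    by apply: L2D => //; exact: L2Z.
  rewrite (ID (intbleZ c (L2_int uL)) (L2_int vL)) (IZ c (L2_int uL)) u0 v0.
  by rewrite mulr0 addr0.
Qed.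
HB.instance Definition _ := GRing.isSubmodClosed.Build _ _ l20p l20_submod.

Record l20 := Ml20 { l20v :> X -> R^o; _ : l20v \in l20p }.
HB.instance Definition _ := [isSub for l20v].
HB.instance Definition _ := [Choice of l20 by <:].
HB.instance Definition _ := [SubChoice_isSubLmodule of l20 by <:].

Lemma l20L (u : l20) : L2 u. Proof. by case: u => u /= /asboolP[]. Qed.
Lemma l20I (u : l20) : I u = 0. Proof. by case: u => u /= /asboolP[]. Qed.

Definition mkl20 f (fL : L2 f) (f0 : I f = 0) : l20 :=
  @Ml20 f (asboolT (conj fL f0)).

Definition sd2 (u v : l20) : R := I (fun x => u x * v x).

Lemma sd2C u v : sd2 u v = sd2 v u.
Proof. by apply: eq_Rintegral => x _; rewrite mulrC. Qed.
Lemma sd2D u v w : sd2 (u + v) w = sd2 u w + sd2 v w.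
Proof.
rewrite /sd2 -ID; [|by apply: L2_mul; exact: l20L..].
by apply: eq_Rintegral => x _; rewrite -mulrDl.
Qed.
Lemma sd2Z a u v : sd2 (a *: u) v = a * sd2 u v.
Proof.
rewrite /sd2 -IZ; last by apply: L2_mul; exact: l20L.
by apply: eq_Rintegral => x _; rewrite mulrA.
Qed.
Lemma sd2_ge0 u : 0 <= sd2 u u.
Proof. by apply: I_ge0 => x; rewrite -expr2 sqr_ge0. Qed.

Lemma sd2_complete (f : nat -> l20) :
  (forall e, 0 < e -> exists N : nat, forall m p, (N <= m)%N -> (N <= p)%N ->
     sd2 (f m - f p) (f m - f p) < e) ->
  exists l, forall e, 0 < e -> exists N : nat, forall m, (N <= m)%N ->
     sd2 (f m - l) (f m - l) < e.
Proof.
move=> fC; have [g [gL g0 gP]] := @L2_complete R d X mu (fun m => f m) (fun m => l20L (f m)) (fun m => l20I (f m)) fC.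
by exists (mkl20 gL g0) => e e0; have [N NP] := gP e e0; exists N => m Nm; exact: NP.
Qed.

Definition hilb20 : hilb R := sep_hilb sd2C sd2D sd2Z sd2_ge0 sd2_complete.

End MeanZero.

Section Koopman.
Variables (R : realType) (G : groupType) (d : measure_display) (X : measurableType d).
Variables (mu : probability X R) (a : pmp_action G mu).
Implicit Types (g h : G) (u v : l20 mu) (A B : set X).
Local Notation I f := (\int[mu]_x (f x)).

Lemma actK g : cancel (a g) (a g^-1%g). Proof. by move=> x; rewrite -actM mulVg act1. Qed.
Lemma actVK g : cancel (a g^-1%g) (a g). Proof. by move=> x; rewrite -actM mulgV act1. Qed.

Lemma image_act g A : a g @` A = a g^-1%g @^-1` A.
Proof.
apply/seteqP; split => [_ [x Ax <-]|y Ay] /=; first by rewrite actK.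
by exists (a g^-1%g y) => //; rewrite actVK.
Qed.

Lemma ge0_integral_act g (f : X -> \bar R) : measurable_fun setT f -> (forall x, 0 <= f x)%E ->
  (\int[mu]_x f (a g x) = \int[mu]_x f x)%E.
Proof.
move=> mf f0.
have := ge0_integral_pushforward (act_measurable a g) mu measurableT mf (fun x _ => f0 x).
rewrite preimage_setT => <-; apply: eq_measure_integral; first exact: act_measurable.
by move=> ? A mA _; exact: (act_preserving a g mA).
Qed.

Lemma intble_act g f : intble mu f -> intble mu (f \o a g).
Proof.
move=> fi; have mf := intble_meas fi; apply/integrableP; split.
  by apply/measurable_EFinP; apply: measurableT_comp => //; exact: act_measurable.
move/integrableP : (fi) => [_]; apply: le_lt_trans.
rewrite -(@ge0_integral_act g (fun x => `|(EFin \o f) x|%E))//.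
by apply: measurableT_comp => //; exact/measurable_EFinP.
Qed.

Lemma I_act g f : intble mu f -> I (fun x => f (a g x)) = I f.
Proof.
move=> fi; have mE : measurable_fun setT (EFin \o f) by case/integrableP: fi.
rewrite /Rintegral; congr fine.
rewrite integralE [RHS]integralE; congr (_ - _)%E.
  rewrite -[X in (\int[mu]_x X^\+ x = _)%E]/((EFin \o f) \o a g) funepos_comp.
  by apply: ge0_integral_act => //; exact: measurable_funepos.
rewrite -[X in (\int[mu]_x X^\- x = _)%E]/((EFin \o f) \o a g) funeneg_comp.
by apply: ge0_integral_act => //; exact: measurable_funeneg.
Qed.

Lemma L2_act g f : L2 mu f -> L2 mu (f \o a g).
Proof.
move=> [mf fi]; split; last exact: (intble_act g fi).
by apply: measurableT_comp => //; exact: act_measurable.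
Qed.

Fact koop_I g u : I (u \o a g^-1%g) = 0.
Proof. by rewrite (I_act _ (L2_int (l20L u))) l20I. Qed.
Definition koop g u : l20 mu := mkl20 (L2_act g^-1%g (l20L u)) (koop_I g u).

Fact koop1 u : koop 1%g u = u.
Proof. by apply: val_inj; apply/funext => x /=; rewrite invg1 act1. Qed.
Fact koopM g h u : koop (g * h)%g u = koop g (koop h u).
Proof. by apply: val_inj; apply/funext => x /=; rewrite invgM actM. Qed.
Fact koopD g u v : koop g (u + v) = koop g u + koop g v.
Proof. by apply: val_inj. Qed.
Fact koopZ g c u : koop g (c *: u) = c *: koop g u.
Proof. by apply: val_inj. Qed.
Fact koop_sd g u v : sd2 (koop g u) (koop g v) = sd2 u v.
Proof. exact: (I_act g^-1%g (L2_mul (l20L u) (l20L v))). Qed.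

Local Notation H20 := (hilb20 mu).
Local Notation kls u := (cls (@sd2 R d X mu) u : H20).

Lemma dot_kls u v : dot (kls u) (kls v) = sd2 u v.
Proof. exact: (sepdotE (@sd2C _ _ _ mu)). Qed.

Lemma klsB u v : kls (u - v) = kls u - kls v.
Proof. exact: (clsB (@sd2D _ _ _ mu) (@sd2Z _ _ _ mu)). Qed.

Lemma ae_of_null f : L2 mu f -> I (fun x => f x ^+ 2) = 0 -> {ae mu, forall x, f x = 0}.
Proof.
move=> fL f0; have [mf fi] := fL.
have mE : measurable_fun setT (EFin \o (fun x => f x ^+ 2)) by case/integrableP: fi.
have abs0 : (\int[mu]_x `|(EFin \o (fun x => f x ^+ 2)%R) x| = 0)%E.
  rewrite -[RHS]/((0 : R)%:E) -f0 -I_EFin//; apply: eq_integral => x _ /=.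
  by rewrite ger0_norm// sqr_ge0.
have /(ae_eq_integral_abs _ measurableT mE) uae := abs0.
apply: filterS uae => x /= h; have [/eqP] := h Logic.I.
by rewrite sqrf_eq0 => /eqP.
Qed.

(* Countability of [G] turns the almost invariant set [u > 0] into a strictly invariant one. *)
Lemma invariant_null (K : set G) u : countable [set: G] -> is_subgroup K -> ergodic_on a K ->
  (forall g, K g -> (kls (koop g u)) = (kls (u))) -> (kls (u)) = 0.
Proof.
move=> cG [K1 KM KV] erg fixu.
have uae g : K g -> {ae mu, forall x, u (a g^-1%g x) = u x}.
  move=> Kg; have : sd2 (koop g u - u) (koop g u - u) = 0.
    by rewrite -dot_kls klsB fixu// subrr dot0l.
  move=> s0; have := @ae_of_null (koop g u - u) (l20L _) s0.
  by apply: filterS => x /= /eqP; rewrite subr_eq0 => /eqP.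
pose S : set X := [set x | 0 < u x].
have mS : measurable S.
  have := (l20L u).1 measurableT `]0, +oo[%classic (measurable_itv _).
  by rewrite setTI; congr measurable; apply/seteqP; split => x /=; rewrite in_itv /= andbT.
have /countable_injP[p pI] := cG.
pose e (n : nat) : G := xget 1%g [set g | p g = n].
have eE g : e (p g) = g.
  have : p (e (p g)) = p g by apply: (@xgetPex _ 1%g [set h | p h = p g]); exists g.
  by apply: pI; rewrite inE.
(* Indexing by naturals through the injection [p] makes the intersection countable; off the range of
   [p] the default e n = 1 contributes [S] itself. *)
pose A0 := \bigcap_(n in [set n | K (e n)]) (a (e n)^-1%g @^-1` S).
have A0E y : A0 y <-> forall g, K g -> S (a g^-1%g y).
  split=> [Ay g Kg|Ay n Kn]; last exact: Ay.
  by have := Ay (p g); rewrite /= eE; apply.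
have mA0 : measurable A0.
  apply: bigcap_measurableType => n _; rewrite -[X in measurable X]setTI.
  exact: act_measurable.
have A0S y : A0 y -> S y by move=> /A0E/(_ _ K1); rewrite invg1 act1.
have inv h : K h -> a h @` A0 = A0.
  move=> Kh; rewrite image_act; apply/seteqP; split => y /=; move=> /A0E Ay; apply/A0E => g Kg.
    have := Ay (h^-1 * g)%g (KM _ _ (KV _ Kh) Kg); rewrite invgM invgK actM.
    by rewrite -[a h _]actM mulgV act1.
  by rewrite -actM -invgM; apply: Ay; exact: KM.
have SA0 : {ae mu, forall y, S y -> A0 y}.
  have : {ae mu, forall y, forall n, K (e n) -> u (a (e n)^-1%g y) = u y}.
    apply: ae_foralln => n; have [Kn|nKn] := pselect (K (e n)).
      by apply: filterS (uae _ Kn).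
    by apply: nearW.
  by apply: filterS => y Ey Sy n Kn; rewrite /S /= Ey.
have nullI : I (fun x => u x * u x) = 0.
  apply: ae_sign_null; [exact: l20L|exact: l20I|].
  (* Measure 0 gives u <= 0 and measure 1 gives u > 0 almost everywhere; either way the zero mean
     forces u to vanish almost everywhere. *)
  have [A00|A01] := erg A0 mA0 inv; [right|left].
    have : {ae mu, forall y, ~ A0 y}.
      by exists A0; split => // y /= /contrapT.
    by apply: filterS2 SA0 => y SA nA; rewrite leNgt; apply/negP => /SA.
  have : {ae mu, forall y, A0 y}.
    exists (~` A0); split => //; first exact: measurableC.
    by rewrite probability_setC// A01 subee.
  by apply: filterS => y /A0S /ltW.
by apply: dot_eq0; rewrite dot_kls.
Qed.

Lemma L2_indic A : measurable A -> L2 mu \1_A.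
Proof.
move=> mA; split; first exact: measurable_indic.
have := integrable_indic mu mA; rewrite /intble; congr (mu.-integrable _ _).
by apply/funext => x /=; rewrite indicE; case: (_ \in _); rewrite ?expr1n ?expr0n.
Qed.

Lemma I_indic A : measurable A -> I \1_A = fine (mu A).
Proof. by move=> mA; rewrite /Rintegral integral_indic// setIT. Qed.

Lemma center_L2 A : measurable A -> L2 mu (fun x => \1_A x - fine (mu A)).
Proof. by move=> mA; apply: L2B; [exact: L2_indic|exact: L2_cst]. Qed.

Lemma center_I A : measurable A -> I (fun x => \1_A x - fine (mu A)) = 0.
Proof.
move=> mA; rewrite RintegralB//; [|exact: L2_int (L2_indic mA)|exact: intble_cst].
by rewrite I_indic// I_cst subrr.
Qed.

Definition center A (mA : measurable A) : l20 mu := mkl20 (center_L2 mA) (center_I mA).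

Lemma sd_center A B (mA : measurable A) (mB : measurable B) : B `<=` A ->
  sd2 (center mB) (center mA) = fine (mu B) * (1 - fine (mu A)).
Proof.
move=> BA; set al := fine (mu A); set be := fine (mu B); rewrite /sd2 /=.
have -> : I (fun x => (\1_B x - be) * (\1_A x - al)) =
    I (fun x => (1 - al) * \1_B x + (- be * (\1_A x - al))).
  apply: eq_Rintegral => x _; rewrite !indicE.
  have [xB|xB] := boolP (x \in B); last by rewrite mulr0n mulr0 !add0r.
  by rewrite (mem_set (BA _ (set_mem xB))) mulr1n mulr1 mulrBl mul1r mulNr.
have iB := L2_int (L2_indic mB); have iA := L2_int (center_L2 mA).
rewrite ID; [|exact: intbleZ|exact: intbleZ]; rewrite IZ// IZ// center_I//.
by rewrite I_indic// mulr0 addr0 mulrC.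
Qed.

(** Otherwise every cyclic C has mu(CB) <= 1 - eps. Take v = 1_B - beta and w = 1_A - alpha with A =
    CB, which is C-invariant. Then <v, w> = beta (1 - alpha) and |w|^2 = alpha (1 - alpha), so the
    condition of [sl_main] for d = beta t reads t^2 alpha < 1 - alpha, which follows from t^2 < eps.
    The resulting mean zero function, invariant under a subgroup of finite index, is null by
    [invariant_null]. *)
Theorem slh_expansive n (phi : sl_hom n G) : (3 <= n)%N ->
  act_totally_ergodic a -> directionally_expansive a.
Proof.
move=> n3 te B mB muB eps eps0; apply: contrapT => no.
have small C : is_cyclic C -> (mu (\bigcup_(c in C) (a c @` B)) <= (1 - eps)%:E)%E.
  by move=> cC; rewrite leNgt; apply/negP => lt; apply: no; exists C.
have cG : countable [set: G] := slh_countable phi.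
have mimg g : measurable (a g @` B).
  by rewrite image_act -[X in measurable X]setTI; exact: act_measurable.
set be := fine (mu B).
have muB' : (be%:E = mu B)%E by rewrite fineK// fin_num_measure.
have be0 : 0 < be by rewrite -lte_fin muB'.
pose t : R := Num.min eps 1 / 2.
have t0 : 0 < t by rewrite divr_gt0// lt_min eps0 ltr01.
have t2 : t ^+ 2 < eps.
  have le_e : Num.min eps 1 <= eps by rewrite ge_min lexx.
  have le_1 : Num.min eps 1 <= 1 by rewrite ge_min lexx orbT.
  by move: t0; rewrite /t; move: (Num.min eps 1) le_e le_1 => m me m1 m0; nra.
clearbody t.
pose U (x : SL int n) u := koop (phi x) u.
have U1 u : U 1%g u = u by rewrite /U slh1 koop1.
have UM (x y : SL int n) u : U (x * y)%g u = U x (U y u) by rewrite /U slhM koopM.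
have UD (x : SL int n) u v : U x (u + v) = U x u + U x v by exact: koopD.
have UZ (x : SL int n) (c : R) u : U x (c *: u) = c *: U x u by exact: koopZ.
have Usd (x : SL int n) u v : sd2 (U x u) (U x v) = sd2 u v by exact: koop_sd.
pose rho := sep_rep (@sd2C _ _ _ mu) (@sd2D _ _ _ mu) (@sd2Z _ _ _ mu) (@sd2_ge0 _ _ _ mu)
  (@sd2_complete _ _ _ mu) U1 UM UD UZ Usd.
have rhoE (x : SL int n) u : rho x (kls u) = kls (koop (phi x) u).
  exact: (sepact_cls (@sd2C _ _ _ mu) (@sd2D _ _ _ mu) (@sd2Z _ _ _ mu) (@sd2_ge0 _ _ _ mu)
    (@sd2_complete _ _ _ mu) U1 UM Usd).
have big (h : SL int n) (i j : 'I_n) : i != j -> exists2 w : H20, rho (el i j 1 ^ h)%g w = w &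
    (be * t) ^+ 2 * dot w w < dot ((kls (center mB)) : H20) w ^+ 2.
  move=> ij; set x := phi (el i j 1 ^ h)%g.
  pose A := \bigcup_(c in cyclic_subgroup x) (a c @` B).
  have AE y : A y <-> exists2 c, cyclic_subgroup x c & B (a c^-1%g y).
    split; first by move=> [c Cc]; rewrite image_act => By; exists c.
    by move=> [c Cc By]; exists c => //; rewrite image_act.
  have mA : measurable A.
    have -> : A = \bigcup_k ((a (x ^+ k)%g @` B) `|` (a (x ^- k)%g @` B)).
      apply/seteqP; split => y.
        by move=> [c [k [->|->]] By]; exists k => //; [left|right].
      by move=> [k _ [By|By]]; [exists (x ^+ k)%g|exists (x ^- k)%g] => //; exists k; [left|right].
    by apply: bigcupT_measurable => k; apply: measurableU; exact: mimg.
  have BA : B `<=` A.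
    by move=> y By; apply/AE; exists 1%g; [exists 0%N; left; rewrite expg0|rewrite invg1 act1].
  exists (kls (center mA)).
    rewrite rhoE -/x; congr cls; apply: val_inj; apply/funext => y /=.
    congr (_ - _); rewrite !indicE; congr (_%:R); congr nat_of_bool.
    apply/idP/idP; rewrite !inE => /AE[c Cc By]; apply/AE.
      exists (x * c)%g; first exact: (cyclicM Cc).1.
      by rewrite invgM actM.
    exists (x^-1 * c)%g; first exact: (cyclicM Cc).2.
    by rewrite invgM invgK actM -[a x _]actM mulgV act1.
  rewrite !dot_kls !sd_center// -/be; set al := fine (mu A).
  have muA : (al%:E = mu A)%E by rewrite fineK// fin_num_measure.
  have al0 : 0 <= al by rewrite fine_ge0.
  have al1 : al <= 1 - eps by rewrite -lee_fin muA; apply: small; exists x.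
  have q0 : 0 < 1 - al by lra.
  rewrite !exprMn -mulrA ltr_pM2l ?exprn_gt0// mulrA [ltRHS]expr2 ltr_pM2r//.
  apply: (@le_lt_trans _ _ (t ^+ 2)); last by lra.
  by rewrite ler_piMr ?sqr_ge0//; lra.
have bet : 0 < be * t by rewrite mulr_gt0.
have [K [sgK fK [c c0 Kc]]] := @sl_main R n H20 rho (kls (center mB)) (be * t) n3 bet big.
have erg := te _ (slh_subgroup phi sgK) (slh_index phi sgK fK).
move: c0; rewrite -(repK c) (@invariant_null (phi @` K) (rep c))//; first by rewrite eqxx.
  exact: slh_subgroup.
by move=> _ [h Kh <-]; rewrite -rhoE repK; exact: Kc.
Qed.

End Koopman.

Theorem corollary1p6 (R : realType) (n : nat) (hn : (3 <= n)%N) :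
  [/\ cyclic_escape_property R (SL int n),
      cyclic_escape_property R (PSL int n) &
      cyclic_escape_property R (PGL int n)] /\
  [/\ forall (d : measure_display) (X : measurableType d)
        (mu : probability X R) (a : pmp_action (SL int n) mu),
        act_totally_ergodic a -> directionally_expansive a,
      forall (d : measure_display) (X : measurableType d)
        (mu : probability X R) (a : pmp_action (PSL int n) mu),
        act_totally_ergodic a -> directionally_expansive a &
      forall (d : measure_display) (X : measurableType d)
        (mu : probability X R) (a : pmp_action (PGL int n) mu),
        act_totally_ergodic a -> directionally_expansive a].
Proof.
split; split.
- exact: (slh_escape (slh_SL n) hn).
- exact: (slh_escape (slh_PSL n) hn).
- exact: (slh_escape (slh_PGL n) hn).
- by move=> d X mu a; exact: (slh_expansive (slh_SL n) hn).
- by move=> d X mu a; exact: (slh_expansive (slh_PSL n) hn).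
- by move=> d X mu a; exact: (slh_expansive (slh_PGL n) hn).
Qed.
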